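(* Let $k\ge1$ be an integer. For integers $N\ge1$ and $m$, put $c:=m/N$. Then for $c\in[0,k]$, $$I_k(m;N)=\gamma_k(c)\,N^{k^2-1}+O_k(N^{k^2-2}),$$ where the implied constant depends only on $k$.
   Context: For an $N\times N$ matrix $U$, the secular coefficients $\operatorname{Sc}_j(U)$ are defined by $\det(I+xU)=\sum_{j=0}^N \operatorname{Sc}_j(U)x^j$. With $U(N)$ the group of $N\times N$ unitary matrices and $dU$ its Haar probability measure, define $$I_k(m;N)=\int_{U(N)}\Big|\sum_{\substack{j_1+\cdots+j_k=m\\ 0\le j_1,\dots,j_k\le N}}\operatorname{Sc}_{j_1}(U)\cdots\operatorname{Sc}_{j_k}(U)\Big|^2\,dU .$$ The function $\gamma_k$ is $$\gamma_k(c)=\frac{1}{k!\,G(1+k)^2}\int_{[0,1]^k}\delta_c(w_1+\cdots+w_k)\prod_{i<j}(w_i-w_j)^2\,d^kw,$$ where $\delta_c(x)=\delta(x-c)$ is the delta distribution translated by $c$, and $G$ is the Barnes $G$-function, so $G(1+k)=1!\cdot2!\cdots(k-1)!$. Concretely, the integral means the integral of $\prod_{1\le i<j\le k}(w_i-w_j)^2$ with $w_k:=c-w_1-\cdots-w_{k-1}$, with respect to Lebesgue measure $dw_1\cdots dw_{k-1}$ over the set of $(w_1,\dots,w_{k-1})\in[0,1]^{k-1}$ for which $0\le w_k\le1$. *)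

(* Defs.v *)
From HB Require Import structures.
From mathcomp Require Import all_boot all_order all_algebra complex.
From mathcomp Require Import all_classical all_reals all_analysis.

Set Implicit Arguments.
Unset Strict Implicit.
Unset Printing Implicit Defensive.

Import Order.TTheory GRing.Theory Num.Theory.
Import numFieldNormedType.Exports.
Import ComplexField.Normc.

Local Open Scope classical_set_scope.
Local Open Scope ring_scope.
Local Open Scope complex_scope.

(* The usual topology of the complex plane, given by the modulus. *)
HB.instance Definition _ (R : realType) :=
  PseudoPointedMetric.copy R[i] (R[i])^o.

(* U(N), with the subspace topology of 'M_N(C) and its Borel sigma-algebra. *)
Section UnitaryGroup.
Variables (R : realType) (N : nat).

Definition unitary_set : set 'M[R[i]]_N := [set U | U \is unitarymx].

Definition unitary_group : Type := set_type unitary_set.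

Lemma unitary_set1 : 1%:M \in unitary_set.
Proof.
by apply/mem_set => /=; apply/unitarymxP; rewrite trmx1 map_mx1 mul1mx.
Qed.

Lemma unitary_setM (V U : unitary_group) :
  val V *m val U \in unitary_set.
Proof.
apply/mem_set; rewrite /unitary_set /=.
by apply: mul_unitarymx; [exact: (set_valP V)|exact: (set_valP U)].
Qed.

Definition unitary_one : unitary_group := SigSub unitary_set1.

Definition unitary_mul (V U : unitary_group) : unitary_group :=
  SigSub (unitary_setM V U).

HB.instance Definition _ := Topological.copy unitary_group
  (set_type unitary_set).
HB.instance Definition _ := isPointed.Build unitary_group unitary_one.
HB.instance Definition _ := Measurable.copy unitary_group
  (g_sigma_algebraType (@open unitary_group)).

(* Left invariance determines mu, and implies right invariance since U(N) is
   compact. *)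
Definition is_haar (mu : probability unitary_group R) : Prop :=
  forall (V : unitary_group) (A : set unitary_group),
    measurable A -> mu (unitary_mul V @^-1` A) = mu A.

End UnitaryGroup.

Definition secular_coef (R : realType) (N : nat) (U : 'M[R[i]]_N) (j : nat) :
    R[i] :=
  (\det (1%:M + 'X *: map_mx polyC U))`_j.

(* I_k(m; N) when mu is the Haar probability measure of U(N). *)
Definition secular_moment (R : realType) (k : nat) (m : int) (N : nat)
    (mu : probability (unitary_group R N) R) : R :=
  \int[mu]_U
    (normc (\sum_(j : {ffun 'I_k -> 'I_N.+1}
                  | (\sum_(i < k) (j i : nat))%N%:Z == m)
              \prod_(i < k) secular_coef (val U) (j i)) ^+ 2).

(* Lebesgue measure on R^n, seen as n-tuples: the point mass if n = 0, and the
   image under (x, w) |-> x :: w of the product measure otherwise. *)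
Section LebesgueTuple.
Variable R : realType.
Local Notation RR := (measurableTypeR R).

Section cons.
Variable n : nat.
Local Open Scope ereal_scope.

Definition tcons (p : RR * n.-tuple RR) : n.+1.-tuple RR :=
  [tuple of p.1 :: p.2].

Lemma measurable_tcons : measurable_fun [set: RR * n.-tuple RR] tcons.
Proof. exact: (measurable_cons measurable_fst measurable_snd). Qed.

Variable mu : {sigma_finite_measure set (n.-tuple RR) -> \bar R}.

Definition lebesgue_cons : set (n.+1.-tuple RR) -> \bar R :=
  pushforward (@lebesgue_measure R \x mu) tcons.

Let lebesgue_cons0 : lebesgue_cons set0 = 0.
Proof. by rewrite /lebesgue_cons /pushforward preimage_set0 measure0. Qed.

Let lebesgue_cons_ge0 A : 0 <= lebesgue_cons A.
Proof. by rewrite /lebesgue_cons /pushforward; exact: measure_ge0. Qed.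

Let lebesgue_cons_sigma_additive : semi_sigma_additive lebesgue_cons.
Proof.
move=> F mF tF mUF; rewrite /lebesgue_cons /pushforward preimage_bigcup.
apply: measure_semi_sigma_additive.
- by move=> i; rewrite -[X in measurable X]setTI; exact: measurable_tcons.
- apply/trivIsetP => /= i j _ _ ij; rewrite -preimage_setI.
  by move/trivIsetP : tF => /(_ _ _ _ _ ij) ->//; rewrite preimage_set0.
- rewrite -preimage_bigcup -[X in measurable X]setTI.
  exact: measurable_tcons.
Qed.

HB.instance Definition _ := isMeasure.Build _ _ _ lebesgue_cons
  lebesgue_cons0 lebesgue_cons_ge0 lebesgue_cons_sigma_additive.

Let lebesgue_cons_sigma_finite : sigma_finite setT lebesgue_cons.
Proof.
have /sigma_finiteP[F [FT ndF Foo]] := sigma_finiteT (@lebesgue_measure R).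
have /sigma_finiteP[G [GT ndG Goo]] := sigma_finiteT mu.
pose g (w : n.+1.-tuple RR) : RR * n.-tuple RR :=
  (thead w, [tuple of behead w]).
have mg : measurable_fun setT g.
  apply/measurable_fun_pairP; split; first exact: measurable_tnth.
  exact: measurable_behead.
have gK p : g (tcons p) = p.
  by case: p => x w; rewrite /g /tcons /= theadE; congr pair; apply/val_inj.
exists (fun i => g @^-1` (F i `*` G i)).
  apply/seteqP; split=> // w _.
  have [i _ Fi] : (\bigcup_i F i) (g w).1 by rewrite -FT.
  have [j _ Gj] : (\bigcup_i G i) (g w).2 by rewrite -GT.
  exists (maxn i j) => //; split.
  - by move: Fi; apply/subsetPset/ndF/leq_maxl.
  - by move: Gj; apply/subsetPset/ndG/leq_maxr.
move=> i; have [mF Fi] := Foo i; have [mG Gi] := Goo i; split.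
  by rewrite -[X in measurable X]setTI; apply: mg => //; exact: measurableX.
rewrite /lebesgue_cons /pushforward.
rewrite (_ : tcons @^-1` _ = F i `*` G i).
  by rewrite product_measure1E// lte_mul_pinfty// ge0_fin_numE.
by apply/funext => p; rewrite /preimage /mkset gK.
Qed.

HB.instance Definition _ := Measure_isSigmaFinite.Build _ _ _ lebesgue_cons
  lebesgue_cons_sigma_finite.

End cons.

Fixpoint lebesgue_tuple (n : nat) :
    {sigma_finite_measure set (n.-tuple RR) -> \bar R} :=
  match n with
  | 0 => \d_ ([tuple] : 0.-tuple RR)
  | n'.+1 => lebesgue_cons (lebesgue_tuple n')
  end.

End LebesgueTuple.

(* G(n) = 1! 2! ... (n - 2)! for n >= 1. *)
Definition barnesG (n : nat) : nat := \prod_(1 <= i < n.-1) i`!.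

(* The point (w_1, ..., w_k) of the hyperplane w_1 + ... + w_k = c whose first
   k - 1 coordinates are w. *)
Definition slice_point (R : realType) (k : nat) (c : R)
    (w : k.-1.-tuple (measurableTypeR R)) (i : 'I_k) : R :=
  (rcons w (c - \sum_(x <- w) x))`_i.

Definition gamma (R : realType) (k : nat) (c : R) : R :=
  ((k`! * barnesG k.+1 ^ 2)%N%:R)^-1 *
  \int[lebesgue_tuple R k.-1]_(w in
      [set w | forall i : 'I_k, 0 <= slice_point c w i <= 1])
    \prod_(i < k) \prod_(j < k | (i < j)%N)
      (slice_point c w i - slice_point c w j) ^+ 2.

(* Main.v *)
From mathcomp Require Import all_boot all_order all_algebra perm complex.
From mathcomp Require Import all_classical all_reals all_analysis measurable_realfun.
From mathcomp Require Import ring lra zify.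
Require Import Defs.
Set Implicit Arguments.
Unset Strict Implicit.
Unset Printing Implicit Defensive.
Import Order.TTheory GRing.Theory Num.Theory.
Import numFieldNormedType.Exports.
Import ComplexField.Normc.
Local Open Scope ring_scope.

(** Write M = N + k, E(x) = det(1 + xU) and G for the Barnes function.  The
    theorem comes from an exact formula, [secular_moment_lattice]:

      I_k(m; N) = 1 / (k! G(1+k)^2) * sum_l prod_(i < j) (l_i - l_j)^2,

    where l runs over the points of {0, ..., M - 1}^k whose coordinates sum to
    m + k(k-1)/2.  After the substitution w_i = (l_i - (k-1)/2) / N these points
    form a grid of mesh 1/N in a neighbourhood of size O(1/N) of the cube
    [0, 1]^k, and the constraint becomes w_1 + ... + w_k = m/N exactly.  The
    summand is homogeneous of degree k(k-1) and the slice has dimension k - 1,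
    so the sum is N^(k(k-1) + k-1) = N^(k^2-1) times a Riemann sum of the
    integral defining gamma_k(m/N).  The weight is Lipschitz and bounded with
    constants depending only on k, hence the relative error is O_k(1/N)
    ([riemann_slice], by induction on the dimension).

    The exact formula rests on the k x k minors chi_l = det(e_(l_i - j)) of the
    coefficients e_n of E, which are Schur functions of the eigenvalues of U.
    The coefficients of E^k expand in the chi_l with Vandermonde coefficients
    ([coef_exp_chi]), and the chi_l are orthonormal up to permutations of l
    ([chi_orthogonality]).  This orthogonality follows from left invariance
    alone.

    Let V = 1 + (z - 1) v v^* with |v| = |z| = 1, a unitary matrix whose only
    eigenvalue besides 1 is z.  Replacing U by V U changes every E(t) by a
    factor affine in z - 1.  Comparing coefficients of powers of z - 1 in the
    mean of conj(det U)^k E(t_1) ... E(t_(2k)) evaluates the means of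
    sum_i tr R_i and of sum_(i != j) (tr R_i tr R_j + tr R_i R_j) against that
    product, where R_i = t_i U (1 + t_i U)^-1 ([has_mean_tr1], [has_mean_tr2]).  Jacobi's
    formula turns tr R_i into t_i E'(t_i) / E(t_i), and the resolvent identity
    turns R_i R_j into a combination of R_i and R_j.  In terms of the 2k x 2k
    minors, the two evaluations say that the means of conj(det U)^k chi_l, as a
    function of l, are an eigenvector of multiplication by sum_i l_i and by
    sum_(i != j) l_i l_j.  So they vanish unless these two statistics agree
    with those of the sequence 0, ..., k-1, N+k, ..., N+2k-1, for which the
    mean is 1.  That sequence is extremal, and only its permutations survive
    ([gapseq_extremal], [chi_intE]).  The mean of the product of the E(t_i) is
    therefore a quotient of two explicit determinants.  A Bezoutian
    factorisation of the numerator ([det_gapseq_bezout]) splits the 2k points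
    into two groups of k and yields the mean of conj(det U)^k chi_l chi_p.
    Finally conj(e_j) = conj(det U) e_(N-j) rewrites conj(det U)^k chi_p as the
    conjugate of another minor. *)

(** * Determinants and Vandermonde products *)

(** The Cauchy-Binet expansion before grouping the terms by the image of [l]. *)
Lemma det_mulmx_ffun (A : comNzRingType) (r m : nat) (P : 'M[A]_(r, m)) (Q : 'M[A]_(m, r)) :
  \det (P *m Q) = \sum_(l : {ffun 'I_r -> 'I_m})
     (\prod_i P i (l i)) * \det (\matrix_(i, j) Q (l i) j).
Proof.
rewrite /determinant.
under [RHS]eq_bigr do rewrite mulr_sumr.
rewrite exchange_big /=; apply: eq_bigr => s _.
under eq_bigr do rewrite mxE.
rewrite bigA_distr_bigA /= mulr_sumr; apply: eq_bigr => l _.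
by rewrite big_split /= mulrCA; congr (_ * (_ * _)); apply: eq_bigr => i _; rewrite mxE.
Qed.

Lemma det_perm_rows (A : comNzRingType) (r : nat) (P : 'M[A]_r) (s : 'S_r) :
  \det (\matrix_(i, j) P (s i) j) = (-1) ^+ s * \det P.
Proof.
rewrite -det_perm -det_mulmx; congr (\det _).
rewrite -row_permE; apply/matrixP => i j; by rewrite !mxE.
Qed.

Lemma det_scale_rows (A : comNzRingType) r (c : 'I_r -> A) (B : 'M[A]_r) :
  \det (\matrix_(i, j) (c i * B i j)) = (\prod_i c i) * \det B.
Proof.
have -> : \matrix_(i, j) (c i * B i j) = diag_mx (\row_i c i) *m B.
  by apply/matrixP => i j; rewrite mul_diag_mx !mxE.
by rewrite det_mulmx det_diag; congr (_ * _); apply: eq_bigr => i _; rewrite mxE.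
Qed.

Definition vdm (A : comNzRingType) (r : nat) (t : 'I_r -> A) : A :=
  \det (\matrix_(i, j < r) t i ^+ j).

Lemma vdmE (A : comNzRingType) (r : nat) (t : 'I_r -> A) :
  vdm t = \prod_(i < r) \prod_(j < r | (i < j)%N) (t j - t i).
Proof.
rewrite /vdm -det_tr.
have -> : (\matrix_(i, j < r) t i ^+ j)^T = Vandermonde r (\row_i t i).
  by apply/matrixP => i j; rewrite !mxE.
rewrite det_Vandermonde; apply: eq_bigr => i _; apply: eq_bigr => j _.
by rewrite !mxE.
Qed.

Lemma vdm_neq0 (F : fieldType) (r : nat) (t : 'I_r -> F) :
  injective t -> vdm t != 0.
Proof.
move=> tI; rewrite vdmE; apply/prodf_neq0 => i _; apply/prodf_neq0 => j ij.
by rewrite subr_eq0; apply/eqP => /tI ji; rewrite ji ltnn in ij.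
Qed.

Lemma deriv_prod_XsubC (F : fieldType) (rs : seq F) (x : F) : x \notin rs ->
  (\prod_(z <- rs) ('X - z%:P))^`().[x] =
  (\sum_(z <- rs) (x - z)^-1) * (\prod_(z <- rs) ('X - z%:P)).[x].
Proof.
elim: rs => [|z rs IH]; first by rewrite !big_nil derivC horner0 mul0r.
rewrite inE negb_or => /andP[xz xrs].
rewrite !big_cons derivM hornerD !hornerM derivXsubC IH // hornerXsubC hornerC.
have xz0 : x - z != 0 by rewrite subr_eq0.
set S := \sum_(_ <- _) _; set P := _.[x].
by rewrite mul1r [RHS]mulrDl mulKf //; ring.
Qed.

(** The Vandermonde matrix after applying the Euler operator t d/dt to the
    rows in [S]. *)
Definition euler_row (A : comNzRingType) (r : nat) (t : 'I_r -> A) (S : pred 'I_r) : 'M[A]_r :=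
  \matrix_(i, j) ((if S i then j%:R else 1) * t i ^+ j).

(** The logarithmic derivative t_i d/dt_i log of the Vandermonde product. *)
Definition vdm_logderiv (F : fieldType) (r : nat) (t : 'I_r -> F) (i : 'I_r) : F :=
  \sum_(j | j != i) t i / (t i - t j).

(** The Vandermonde determinant is a polynomial in its [i0]-th point whose
    roots are the other points.  Expanding along row [i0] shows that the left
    side is t d/dt of that polynomial. *)
Lemma det_euler_row (F : fieldType) (r : nat) (t : 'I_r -> F) (i0 : 'I_r) :
  injective t -> \det (euler_row t (pred1 i0)) = vdm_logderiv t i0 * vdm t.
Proof.
move=> tI.
pose T (i : 'I_r) : {poly F} := if i == i0 then 'X else (t i)%:P.
pose q := vdm T.
pose cf (j : 'I_r) : F := cofactor (\matrix_(i, j < r) t i ^+ j) i0 j.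
have qE : q = \sum_(j < r) cf j *: 'X^j.
  rewrite /q /vdm (expand_det_row _ i0); apply: eq_bigr => j _.
  rewrite mxE {1}/T eqxx mulrC -mul_polyC; congr (_ * _).
  rewrite /cf /cofactor polyCM rmorph_sign -det_map_mx; congr (_ * \det _).
  apply/matrixP => a b; rewrite !mxE /T.
  by rewrite eq_sym (negbTE (neq_lift _ _)) rmorphXn.
have qt : q.[t i0] = vdm t.
  rewrite qE horner_sum /vdm (expand_det_row _ i0).
  by apply: eq_bigr => j _; rewrite hornerZ hornerXn mxE mulrC.
have qd : \det (euler_row t (pred1 i0)) = t i0 * (q^`()).[t i0].
  rewrite (expand_det_row _ i0) qE raddf_sum horner_sum mulr_sumr.
  apply: eq_bigr => j _; rewrite mxE /= eqxx derivZ derivXn hornerZ hornerMn hornerXn.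
  rewrite (_ : cofactor _ _ _ = cf j); last first.
    rewrite /cf /cofactor; congr (_ * \det _); apply/matrixP => a b; rewrite !mxE /=.
    by rewrite eq_sym (negbTE (neq_lift _ _)) mul1r.
  case: (nat_of_ord j) => [|n]; first by rewrite mulr0n !mul0r mulr0 mulr0.
  by rewrite /= -mulr_natl exprS; ring.
rewrite qd.
pose rs := [seq t j | j <- enum (predC1 i0)].
have urs : uniq rs by rewrite map_inj_uniq // enum_uniq.
have szrs : size rs = r.-1 by rewrite size_map -cardE cardC1 card_ord.
have rootq : all (root q) rs.
  apply/allP => z /mapP[j]; rewrite mem_enum inE /= => ji ->.
  rewrite rootE; apply/eqP.
  rewrite /q /vdm -[_.[_]]/(horner_eval _ _) -det_map_mx.
  apply: (@determinant_alternate _ _ _ j i0) => // c.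
  by rewrite !mxE /T (negbTE ji) eqxx !rmorphXn /= /horner_eval hornerX hornerC.
have urs' : uniq_roots rs by rewrite uniq_rootsE.
have [q' qq'] := uniq_roots_prod_XsubC rootq urs'.
have xn : t i0 \notin rs.
  apply/negP => /mapP[j]; rewrite mem_enum inE /= => ji /tI e.
  by rewrite e eqxx in ji.
have szq : (size q <= r)%N.
  rewrite qE; apply: (leq_trans (size_sum _ _ _)); apply/bigmax_leqP => j _.
  by rewrite (leq_trans (size_scale_leq _ _)) // size_polyXn.
have [c q'c] : exists c, q' = c%:P.
  exists q'`_0; apply: size1_polyC.
  have [->|q'0] := eqVneq q' 0; first by rewrite size_poly0.
  have := szq; rewrite qq' size_Mmonic ?monic_prod_XsubC // size_prod_XsubC szrs.
  have := ltn_ord i0; have := q'0; rewrite -size_poly_gt0.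
  by move: (size q') (nat_of_ord i0) => a b; lia.
rewrite -qt qq' q'c derivM derivC mul0r add0r !hornerM deriv_prod_XsubC // !hornerC.
have -> : vdm_logderiv t i0 = t i0 * \sum_(z <- rs) (t i0 - z)^-1.
  by rewrite /vdm_logderiv /rs big_map big_enum mulr_sumr; apply: eq_bigl => j; rewrite inE.
by ring.
Qed.

(** The Vandermonde product is homogeneous, so Euler's identity sums its
    logarithmic derivatives to its degree: the terms of an unordered pair of
    points add up to 1. *)
Lemma sum_vdm_logderiv (F : fieldType) (r : nat) (t : 'I_r -> F) :
  injective t -> \sum_i vdm_logderiv t i = \sum_(i < r) \sum_(j < r | (i < j)%N) 1.
Proof.
move=> tI; rewrite /vdm_logderiv.
under eq_bigr do rewrite (big_mkcond (fun j => j != _)) /=.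
have pairE (i j : 'I_r) : (i < j)%N -> t i / (t i - t j) + t j / (t j - t i) = 1 :> F.
  move=> ij; have : t i - t j != 0.
    by rewrite subr_eq0; apply/eqP => /tI e; rewrite e ltnn in ij.
  move=> h; rewrite -[t j - t i]opprB invrN mulrN -mulNr -mulrDl divff //.
transitivity (\sum_(i < r) \sum_(j < r | (i < j)%N) (t i / (t i - t j)) +
                \sum_(i < r) \sum_(j < r | (j < i)%N) (t i / (t i - t j))).
    rewrite -big_split /=; apply: eq_bigr => i _.
    rewrite [X in _ = X + _]big_mkcond [X in _ = _ + X]big_mkcond -big_split /=.
    apply: eq_bigr => j _; rewrite -val_eqE /=.
    by case: ltngtP; rewrite ?addr0 ?add0r.
  rewrite [X in _ + X](exchange_big_dep xpredT) //= -big_split /=.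
  apply: eq_bigr => i _; rewrite -big_split /=; apply: eq_bigr => j ij.
  by rewrite pairE.
Qed.

(** * Minors of the coefficients of a polynomial *)

(** For E = det(1 + xU) the coefficients of E are the elementary symmetric
    functions of the eigenvalues of U, and the minors are Schur functions by
    the dual Jacobi-Trudi identity, up to the order of [l]. *)
Definition chi (A : comNzRingType) (E : {poly A}) (r M : nat) (l : {ffun 'I_r -> 'I_M}) : A :=
  \det (\matrix_(i, j < r) ('X^j * E)`_(l i)).

Definition euler (A : comNzRingType) (p : {poly A}) := 'X * p^`().

Lemma euler_horner (A : comNzRingType) (p : {poly A}) M (x : A) : (size p <= M)%N ->
  (euler p).[x] = \sum_(n < M) n%:R * x ^+ n * p`_n.
Proof.
move=> sp; rewrite /euler hornerM hornerX.
rewrite (@horner_coef_wide _ M.-1); last first.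
  case: (posnP M) sp => [-> |]; first by rewrite leqn0 size_poly_eq0 => /eqP ->; rewrite deriv0 size_poly0.
  by move=> M0 sp; rewrite (leq_trans (size_poly _ _)) //; lia.
case: M sp => [|M] _; first by rewrite !big_ord0 mulr0.
rewrite big_ord_recl /= mul0r mul0r add0r mulr_sumr; apply: eq_bigr => i _.
by rewrite coef_deriv /bump /= add1n -mulr_natl exprS; ring.
Qed.

(** The power [j.-1] coming from a derivative only makes sense after a case
    analysis on [j]. *)
Lemma euler_Xn_algebra (F : fieldType) (x y z : F) j :
  x * (x ^+ j.-1 *+ j * y + x ^+ j * z) = j%:R * x ^+ j * y + x ^+ j * (x * z).
Proof.
case: j => [|n]; first by rewrite mulr0n !mul0r !add0r expr0 !mul1r.
by rewrite -mulr_natl /= exprS; ring.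
Qed.

Lemma factor_logderiv (F : fieldType) (c w y z : F) : y != 0 ->
  c * w * y + w * z = y * ((c + z / y) * w).
Proof. by move=> y0; field. Qed.

Section EulerDeterminant.
Variables (F : fieldType) (E : {poly F}) (r N M : nat) (t : 'I_r -> F).
Hypotheses (sE : (size E <= N.+1)%N) (NrM : (N + r <= M)%N).

Definition eulermx (S : pred 'I_r) : 'M[F]_r :=
  \matrix_(i, j) (if S i then (euler ('X^j * E)).[t i] else ('X^j * E).[t i]).

(** The point of the minors: a determinant built from the values at [t] of the
    polynomials X^j E is a generating function of the [chi E l] in the
    variables [t], and the Euler operator on row [i] inserts a factor [l i]. *)
Lemma det_eulermx (S : pred 'I_r) : \det (eulermx S) =
  \sum_(l : {ffun 'I_r -> 'I_M})
     (\prod_i ((if S i then (l i)%:R else 1) * t i ^+ l i)) * chi E l.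
Proof.
have sXE (j : 'I_r) : (size ('X^j * E)%R <= M)%N.
  rewrite mulrC (leq_trans (size_polyMleq _ _)) // size_polyXn.
  by have := ltn_ord j; lia.
have -> : eulermx S = (\matrix_(i < r, n < M) ((if S i then n%:R else 1) * t i ^+ n))
    *m (\matrix_(n < M, j < r) ('X^j * E)`_n).
  apply/matrixP => i j; rewrite !mxE.
  case: ifP => Si.
    rewrite (euler_horner _ (sXE j)); apply: eq_bigr => n _.
    by rewrite !mxE Si.
  rewrite (horner_coef_wide _ (sXE j)); apply: eq_bigr => n _.
  by rewrite !mxE Si mul1r mulrC.
rewrite det_mulmx_ffun; apply: eq_bigr => l _; congr (_ * _).
  by apply: eq_bigr => i _; rewrite mxE.
by rewrite /chi; congr (\det _); apply/matrixP => i j; rewrite !mxE.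
Qed.

Hypothesis tI : injective t.
Hypothesis E0 : forall i, E.[t i] != 0.
Let a i := E.[t i].
Let g i := (euler E).[t i] / E.[t i].

(** After division of row [i] by E(t_i), the Euler operator acts on it as
    j + g_i with g = t E' / E.  A general [u] in place of g lets the entries of
    g be removed one row at a time. *)
Let mix (S : pred 'I_r) (u : 'I_r -> F) : 'M[F]_r :=
  \matrix_(i, j) ((if S i then j%:R + u i else 1) * t i ^+ j).

Let eulermx_mix S : \det (eulermx S) = (\prod_i a i) * \det (mix S g).
Proof.
rewrite -det_scale_rows; congr (\det _); apply/matrixP => i j; rewrite !mxE.
case: ifP => Si; last by rewrite hornerM hornerXn mulrC mul1r.
have ai : E.[t i] != 0 := E0 i.
rewrite /g /a /euler derivM derivXn !(hornerM, hornerD, hornerX, hornerXn, hornerMn).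
have -> : t i * (t i ^+ j.-1 *+ j * E.[t i] + t i ^+ j * E^`().[t i]) =
  (j%:R * t i ^+ j) * E.[t i] + t i ^+ j * (t i * E^`().[t i]).
  exact: euler_Xn_algebra.
exact: factor_logderiv.
Qed.

Let mix_split (S : pred 'I_r) u i0 : S i0 ->
  \det (mix S u) = \det (mix S [eta u with i0 |-> 0]) + u i0 * \det (mix (predD1 S i0) u).
Proof.
move=> Si0; rewrite -[X in _ = X + _]mul1r.
apply: (@determinant_multilinear _ _ _ _ _ i0).
- apply/rowP => j; by rewrite !mxE /= eqxx Si0 /= addr0 !mul1r mulrDl.
- apply/matrixP => i j; rewrite !mxE /= (eq_sym _ i0) (negbTE (neq_lift _ _)) //.
- apply/matrixP => i j; rewrite !mxE /= (eq_sym _ i0) (negbTE (neq_lift _ _)) //.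
Qed.

Let eq_mix (S S' : pred 'I_r) (u u' : 'I_r -> F) : S =1 S' -> (forall i, S i -> u i = u' i) -> mix S u = mix S' u'.
Proof.
move=> SS uu; apply/matrixP => i j; rewrite !mxE -SS.
by case: ifP => // Si; rewrite uu.
Qed.

Let mix0 : mix pred0 g = \matrix_(i, j) (t i ^+ j).
Proof. by apply/matrixP => i j; rewrite !mxE mul1r. Qed.

Let mix_euler S : mix S (fun=> 0) = euler_row t S.
Proof. by apply/matrixP => i j; rewrite !mxE addr0. Qed.

Lemma det_eulermx0 : \det (eulermx pred0) = (\prod_i a i) * vdm t.
Proof. by rewrite eulermx_mix mix0. Qed.

Lemma det_eulermx1 i : \det (eulermx (pred1 i)) = (\prod_i a i) * vdm t * (vdm_logderiv t i + g i).
Proof.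
rewrite eulermx_mix -mulrA; congr (_ * _).
rewrite (@mix_split _ _ i) /=; last by rewrite eqxx.
rewrite (@eq_mix _ (pred1 i) _ (fun=> 0)) //; last by move=> j /= /eqP ->; rewrite eqxx.
rewrite mix_euler det_euler_row // (@eq_mix _ pred0 _ g) //; last by move=> j /=; case: eqP.
by rewrite mix0 -/(vdm t); ring.
Qed.

(** Multilinearity in rows [i] and [j] separates the contributions of the
    Euler operator on E, which are the [g], from those on the Vandermonde
    matrix. *)
Lemma det_eulermx2 i j : i != j -> \det (eulermx (pred2 i j)) =
  (\prod_i a i) * (\det (euler_row t (pred2 i j)) +
    vdm t * (vdm_logderiv t i * g j + vdm_logderiv t j * g i + g i * g j)).
Proof.
move=> ij; rewrite eulermx_mix; congr (_ * _).
have ji : j != i by rewrite eq_sym.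
rewrite (@mix_split _ _ i) /=; last by rewrite eqxx.
rewrite (@mix_split _ _ j) /=; last by rewrite eqxx orbT.
rewrite (negbTE ji) (@mix_split _ g j) /=; last by rewrite eqxx orbT (negbTE ji).
rewrite (@eq_mix _ (pred2 i j) _ (fun=> 0)) //; last first.
  by move=> m /=; case: (m == j) => //; case: (m == i).
rewrite (@eq_mix (predD1 (pred2 i j) j) (pred1 i) _ (fun=> 0)); last 2 first.
- by move=> m /=; case: (eqVneq m j) => [->|_] /=; rewrite ?(negbTE ji) ?orbF.
- by move=> m /=; case: (eqVneq m j) => //= _; case: (m == i).
rewrite (@eq_mix (predD1 (pred2 i j) i) (pred1 j) _ (fun=> 0)); last 2 first.
- by move=> m /=; case: (eqVneq m i) => [->|_] /=; rewrite ?(negbTE ij) ?orbF.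
- by move=> m /=; case: (eqVneq m j) => //= mj; rewrite orbF; case: (m == i).
rewrite (@eq_mix (predD1 (predD1 (pred2 i j) i) j) pred0 _ g) //; last by move=> m /=; case: (m == j) => //; case: (m == i).
by rewrite mix0 -/(vdm t) !mix_euler !det_euler_row //; ring.
Qed.

Definition sum_pair_ord : F := \sum_(i < r) \sum_(j < r | j != i) (i%:R * j%:R).

(** The operator sum_(i != j) of the Euler operators of rows [i] and [j] acts
    on each monomial of the Leibniz expansion by the same scalar, since the
    exponents of the monomial are a permutation of 0, ..., r - 1. *)
Lemma sum_det_euler_row2 :
  \sum_(i < r) \sum_(j < r | j != i) \det (euler_row t (pred2 i j)) = sum_pair_ord * vdm t.
Proof.
rewrite /vdm /determinant.
under eq_bigr do rewrite exchange_big /=.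
rewrite exchange_big /= mulr_sumr; apply: eq_bigr => s _.
under eq_bigr do rewrite -mulr_sumr.
rewrite -mulr_sumr mulrCA; congr (_ * _).
have -> : sum_pair_ord = \sum_(i < r) \sum_(j < r | j != i) ((s i)%:R * (s j)%:R).
  rewrite /sum_pair_ord (reindex_inj (@perm_inj _ s)) /=; apply: eq_bigr => i _.
  rewrite (reindex_inj (@perm_inj _ s)) /=; apply: eq_bigl => j.
  by rewrite (inj_eq (@perm_inj _ s)).
rewrite mulr_suml; apply: eq_bigr => i _; rewrite mulr_suml; apply: eq_bigr => j ji.
under eq_bigr do rewrite mxE.
have -> : \prod_m (\matrix_(a, b) t a ^+ b : 'M[F]_r) m (s m) = \prod_m t m ^+ s m.
  by apply: eq_bigr => m _; rewrite mxE.
rewrite big_split /=; congr (_ * _).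
rewrite (bigD1 i) //= eqxx /= (bigD1 j) //= eqxx orbT big1 ?mulr1 //.
by move=> m /andP[/= /negbTE -> /negbTE ->].
Qed.

(** In the double sum over [i != j], the cross terms of the Vandermonde
    logarithmic derivatives with [g] combine with the last sum, which collects
    the differences (t_j g_i - t_i g_j) / (t_j - t_i).  That last form is the
    one that the resolvent identity produces. *)
Lemma sum_det_eulermx2 :
  \sum_(i < r) \sum_(j < r | j != i) \det (eulermx (pred2 i j)) =
  (\prod_i a i) * vdm t *
   (sum_pair_ord + (2%:R * (\sum_(i < r) \sum_(j < r | (i < j)%N) 1) - 2%:R * (r%:R - 1)) * (\sum_i g i)
    + \sum_(i < r) \sum_(j < r | j != i) (g i * g j + (t j * g i - t i * g j) / (t j - t i))).
Proof.
rewrite (eq_bigr (fun i => \prod_i a i * \sum_(j < r | j != i)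
  (\det (euler_row t (pred2 i j)) +
    vdm t * (vdm_logderiv t i * g j + vdm_logderiv t j * g i + g i * g j)))); last first.
  move=> i _; rewrite mulr_sumr; apply: eq_bigr => j ji.
  by rewrite det_eulermx2 // eq_sym.
rewrite -mulr_sumr -!mulrA; congr (_ * _).
under eq_bigr do rewrite big_split /=.
rewrite big_split /= sum_det_euler_row2.
under eq_bigr do rewrite -mulr_sumr.
rewrite -mulr_sumr [sum_pair_ord * _]mulrC -mulrDr -addrA; congr (_ * (_ + _)).
rewrite -(sum_vdm_logderiv tI).
pose sg := \sum_i g i; pose sl := \sum_i vdm_logderiv t i.
pose slg := \sum_i vdm_logderiv t i * g i.
have e1 (u v : 'I_r -> F) : \sum_(i < r) \sum_(j < r | j != i) (u i * v j) =
    (\sum_i u i) * (\sum_i v i) - \sum_i u i * v i.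
  rewrite mulr_suml -sumrB; apply: eq_bigr => i _.
  by rewrite -mulr_sumr -mulrBr; congr (_ * _); rewrite [in RHS](bigD1 i) //= addrAC subrr add0r.
have e2 : \sum_(i < r) \sum_(j < r | j != i) ((t j * g i - t i * g j) / (t j - t i)) =
    2%:R * ((r%:R - 1) * sg - slg).
  have e3 : \sum_(i < r) \sum_(j < r | j != i) (g i * (t j / (t j - t i))) = (r%:R - 1) * sg - slg.
    rewrite /sg /slg mulr_sumr -sumrB; apply: eq_bigr => i _.
    rewrite -mulr_sumr mulrC -mulrBl; congr (_ * _); rewrite /vdm_logderiv.
    transitivity (\sum_(j < r | j != i) (1 - t i / (t i - t j))).
      apply: eq_bigr => j ji.
      have h : t j - t i != 0 by rewrite subr_eq0 (inj_eq tI).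
      by rewrite -[t i - t j]opprB invrN mulrN opprK; field.
    rewrite sumrB; congr (_ - _); rewrite sumr_const cardC1 card_ord.
    by rewrite -[X in X%:R - 1](prednK (leq_ltn_trans (leq0n i) (ltn_ord i))) -natr1 addrK.
  rewrite mulr_natl mulr2n -{1}e3.
  have -> : (r%:R - 1) * sg - slg = \sum_(i < r) \sum_(j < r | j != i) (g j * (t i / (t i - t j))).
    rewrite -e3 (exchange_big_dep xpredT) //=; apply: eq_bigr => i _; apply: eq_bigl => j.
    by rewrite eq_sym.
  rewrite -big_split /=; apply: eq_bigr => i _.
  rewrite -big_split /=; apply: eq_bigr => j ji.
  by rewrite -[t i - t j]opprB invrN; ring.
rewrite (eq_bigr (fun i => \sum_(j < r | j != i) vdm_logderiv t i * g j +
  \sum_(j < r | j != i) vdm_logderiv t j * g i + \sum_(j < r | j != i) g i * g j)); last first.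
  by move=> i _; rewrite !big_split.
rewrite !big_split /=.
have -> : \sum_(i < r) \sum_(j < r | j != i) (g i * g j + (t j * g i - t i * g j) / (t j - t i)) =
  \sum_(i < r) \sum_(j < r | j != i) (g i * g j) + 2%:R * ((r%:R - 1) * sg - slg).
  by rewrite -e2 -big_split /=; apply: eq_bigr => i _; rewrite big_split.
rewrite [X in _ + X + _](eq_bigr (fun i => \sum_(j < r | j != i) g i * vdm_logderiv t j)); last first.
  by move=> i _; apply: eq_bigr => j _; rewrite mulrC.
rewrite !e1 -/sg -/slg -/sl.
have -> : \sum_i g i * vdm_logderiv t i = slg by apply: eq_bigr => i _; rewrite mulrC.
ring.
Qed.

End EulerDeterminant.

(** * Kronecker substitution and the gap sequence *)
Lemma digits_lt M r (f : nat -> nat) : (forall i, f i < M)%N ->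
  (\sum_(i < r) f i * M ^ i < M ^ r)%N.
Proof.
move=> fM; elim: r => [|r IH]; first by rewrite big_ord0 expn0.
rewrite big_ord_recr /= expnS.
have := fM r; move: (f r) (\sum_(i < r) _)%N (M ^ r)%N IH => a b c; nia.
Qed.

Lemma digits_inj M r (f g : nat -> nat) :
  (forall i, f i < M)%N -> (forall i, g i < M)%N ->
  (\sum_(i < r) f i * M ^ i = \sum_(i < r) g i * M ^ i)%N ->
  forall i, (i < r)%N -> f i = g i.
Proof.
move=> fM gM; elim: r => [|r IH] //.
rewrite !big_ord_recr /= => e.
have := digits_lt r fM; have := digits_lt r gM.
move: e IH; set a := (\sum_(i < r) f i * _)%N; set b := (\sum_(i < r) g i * _)%N.
move=> e IH bM aM.
have fg : f r = g r.
  have := congr1 (fun x => x %/ M ^ r)%N e.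
  have M0 : (0 < M ^ r)%N by rewrite expn_gt0 (leq_ltn_trans _ (fM 0)).
  by rewrite addnC divnMDl // (divn_small aM) addn0 addnC divnMDl // (divn_small bM) addn0.
move=> i; rewrite ltnS leq_eqVlt => /orP[/eqP -> //|]; apply: IH.
by move: e; rewrite fg => /addIn.
Qed.

Lemma poly_nat_roots (F : numDomainType) (p : {poly F}) :
  (forall n, p.[n.+2%:R] = 0) -> p = 0.
Proof.
move=> p0; apply/eqP; apply: contraT => pn.
have := max_poly_roots (rs := [seq i.+2%:R | i <- iota 0 (size p)]) pn.
rewrite size_map size_iota ltnn => -> //.
  by apply/allP => _ /mapP[i _ ->]; rewrite rootE p0.
rewrite map_inj_uniq ?iota_uniq // => i j /eqP.
by rewrite eqr_nat => /eqP[].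
Qed.

(** A polynomial in [r] variables of degree less than [M] in each is determined
    by its values at the points (y, y^M, y^(M^2), ...), since base [M] digits
    encode the exponent vectors injectively.  The values y = n + 2 keep the
    coordinates distinct, and make 1 + y U invertible for unitary U. *)
Lemma kronecker_substitution (F : numDomainType) r M (c : {ffun 'I_r -> 'I_M} -> F) :
  (forall n : nat, \sum_(l : {ffun 'I_r -> 'I_M}) c l * \prod_(i < r) (n.+2%:R ^+ (M ^ i)) ^+ (l i) = 0) ->
  forall l, c l = 0.
Proof.
move=> h l0.
pose d (l : {ffun 'I_r -> 'I_M}) := (\sum_(i < r) l i * M ^ i)%N.
have dI : injective d.
  move=> l l' e; apply/ffunP => i; apply: val_inj => /=.
  have [i0 M0] : (0 < r)%N /\ (0 < M)%N.
    by split; [apply: leq_ltn_trans (ltn_ord i)|apply: leq_ltn_trans (ltn_ord (l i))].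
  pose o := Ordinal M0.
  pose f (u : {ffun 'I_r -> 'I_M}) (j : nat) : nat := if insub j is Some j' then u j' else o.
  have fM u j : (f u j < M)%N by rewrite /f; case: insub.
  have fE u (j : 'I_r) : f u j = u j by rewrite /f valK.
  rewrite -!fE; apply: (digits_inj (fM l) (fM l') (r := r)) => //.
  by under eq_bigr do rewrite fE; under [RHS]eq_bigr do rewrite fE.
pose p : {poly F} := \sum_l c l *: 'X^(d l).
have p0 : p = 0.
  apply: poly_nat_roots => n; rewrite /p horner_sum -[RHS](h n).
  apply: eq_bigr => l _; rewrite hornerZ hornerXn; congr (_ * _).
  rewrite /d (big_morph (fun m => n.+2%:R ^+ m) (@exprD _ _) (expr0 _)).
  by apply: eq_bigr => i _; rewrite -exprM mulnC.
have := congr1 (fun q : {poly F} => q`_(d l0)) p0.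
rewrite coef0 /p coef_sum (bigD1 l0) //= coefZ coefXn eqxx mulr1 big1 ?addr0 //.
by move=> l ll; rewrite coefZ coefXn (inj_eq dI) eq_sym (negbTE ll) mulr0.
Qed.

Lemma expn_ord_inj (F : numDomainType) r M n : (1 < M)%N ->
  injective (fun i : 'I_r => n.+2%:R ^+ (M ^ i) : F).
Proof.
move=> M1 i j /eqP; rewrite -!natrX eqr_nat => /eqP e.
by apply: val_inj; apply: (expnI M1); apply: (@expnI n.+2).
Qed.

Lemma chi_perm (A : comNzRingType) (E : {poly A}) r M (l : {ffun 'I_r -> 'I_M}) (s : 'S_r) :
  chi E [ffun i => l (s i)] = (-1) ^+ s * chi E l.
Proof.
rewrite -det_perm_rows; congr (\det _); apply/matrixP => i j; by rewrite !mxE ffunE.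
Qed.

Lemma chi_ninj (A : comNzRingType) (E : {poly A}) r M (l : {ffun 'I_r -> 'I_M}) :
  ~~ injectiveb l -> chi E l = 0.
Proof.
case/injectivePn => i [j ij e]; apply: (determinant_alternate ij) => c.
by rewrite !mxE e.
Qed.

Section GapSequence.
Variables (k N : nat).
Let r := (k + k)%N.
Let M := (N + r)%N.

Lemma gapseq_subproof (i : 'I_r) : ((if (i < k)%N then i : nat else N + i) < M)%N.
Proof. by case: ifP => _; rewrite ?ltn_add2l // (leq_trans (ltn_ord i)) // leq_addl. Qed.

(** The two runs of [k] exponents at the ends of {0, ..., M - 1}.  Its minor is
    the one that can be evaluated: it is a power of det U. *)
Definition gapseq : {ffun 'I_r -> 'I_M} := [ffun i => Ordinal (gapseq_subproof i)].

Lemma gapseq_inj : injective gapseq.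
Proof.
move=> i j /(congr1 val); rewrite !ffunE /= => e; apply: val_inj => /=.
by move: (nat_of_ord i) (nat_of_ord j) e => a b; case: (ltnP a k); case: (ltnP b k); lia.
Qed.

(** The matrix is block diagonal: the first block is lower triangular with
    diagonal entries E(0) = 1, the second upper triangular with diagonal
    entries the top coefficient of [E]. *)
Lemma chi_gapseq (A : comNzRingType) (E : {poly A}) : (size E <= N.+1)%N -> E`_0 = 1 ->
  chi E gapseq = E`_N ^+ k.
Proof.
move=> sE E0; rewrite /chi.
pose P := \matrix_(i, j < k) ('X^j * E)`_i.
pose Q := \matrix_(i, j < k) ('X^j * E)`_(N + i).
have -> : \matrix_(i < r, j < r) ('X^j * E)`_(gapseq i) = block_mx P 0 0 Q.
  apply/matrixP => i j; rewrite !mxE ffunE /= !coefXnM.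
  case: splitP => i' ii; rewrite mxE; case: splitP => j' jj; rewrite !mxE ?coefXnM ?ii ?jj.
  - by [].
  - by rewrite (leq_trans (ltn_ord i')) // leq_addr.
  - case: ifP => // _; apply: nth_default; apply: (leq_trans sE).
    by move: (nat_of_ord i') (nat_of_ord j') (ltn_ord j') => a b; lia.
  - by rewrite addnCA ltn_add2l subnDl.
rewrite det_ublock.
have -> : \det P = 1.
  rewrite det_trig; last first.
    by apply/is_trig_mxP => i j ij; rewrite mxE coefXnM ij.
  by apply: big1 => i _; rewrite mxE coefXnM ltnn subnn.
rewrite mul1r -det_tr det_trig; last first.
  apply/is_trig_mxP => i j ij; rewrite !mxE coefXnM; case: ifP => // _.
  by apply: nth_default; apply: (leq_trans sE); lia.
rewrite (eq_bigr (fun=> E`_N)) ?prodr_const ?card_ord // => i _.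
by rewrite !mxE coefXnM addnK ifN // -leqNgt leq_addl.
Qed.

(** The gap sequence takes the [2k] values of {0, ..., M - 1} that are
    farthest from the centre (M - 1)/2.  Hence it is, up to order, the only
    injective sequence whose sum of squared distances to the centre is as large
    as its own.  That sum is determined by the two statistics in the
    hypotheses. *)
Lemma gapseq_extremal (l : {ffun 'I_r -> 'I_M}) : injective l ->
  (\sum_i l i = \sum_i gapseq i)%N ->
  (\sum_(i < r) \sum_(j < r | j != i) l i * l j = \sum_(i < r) \sum_(j < r | j != i) gapseq i * gapseq j)%N ->
  exists s : 'S_r, l = [ffun i => gapseq (s i)].
Proof.
move=> lI e1 e2.
have sq (f : {ffun 'I_r -> 'I_M}) :
  (\sum_(i < r) \sum_(j < r | j != i) f i * f j + \sum_i f i ^ 2 = (\sum_i f i) ^ 2)%N.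
  rewrite expnS expn1 big_distrl /= -big_split /=; apply: eq_bigr => i _.
  by rewrite big_distrr /= [RHS](bigD1 i) //= addnC.
have e3 : (\sum_i l i ^ 2 = \sum_i gapseq i ^ 2)%N.
  by apply: (@addnI (\sum_(i < r) \sum_(j < r | j != i) l i * l j)%N); rewrite sq e2 sq e1.
(* The squared distance to the centre, scaled and shifted so as to be
   nonnegative exactly at the values of the gap sequence. *)
pose psi (a : nat) : int := (2%:Z * a%:Z - (M.-1)%:Z) ^+ 2 - (N.+1%:Z) ^+ 2.
have psiE (f : {ffun 'I_r -> 'I_M}) : \sum_i psi (f i) =
   4%:Z * (\sum_i f i ^ 2)%N%:Z - 4%:Z * (M.-1)%:Z * (\sum_i f i)%N%:Z +
   r%:Z * ((M.-1)%:Z ^+ 2 - N.+1%:Z ^+ 2).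
  rewrite (big_morph Posz PoszD (erefl _)) (big_morph Posz PoszD (erefl _)).
  rewrite !mulr_sumr -sumrB.
  have -> : r%:Z * ((M.-1)%:Z ^+ 2 - N.+1%:Z ^+ 2) = \sum_(i < r) ((M.-1)%:Z ^+ 2 - N.+1%:Z ^+ 2).
    by rewrite sumr_const card_ord -mulr_natl natz.
  rewrite -big_split /=; apply: eq_bigr => i _; rewrite /psi; move: (nat_of_ord (f i)) => a.
  by rewrite -[(a ^ 2)%N%:Z]/((a * a)%N%:Z) PoszM; ring.
have e4 : \sum_i psi (l i) = \sum_i psi (gapseq i) by rewrite !psiE e1 e3.
pose A := l @: [set: 'I_r]; pose B := gapseq @: [set: 'I_r].
have e5 : \sum_(a in A) psi a = \sum_(b in B) psi b.
  rewrite !big_imset /=; [|by move=> ? ? _ _; apply: gapseq_inj|by move=> ? ? _ _; apply: lI].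
  rewrite (eq_bigl xpredT); last by move=> i; rewrite inE.
  by rewrite e4; apply: eq_bigl => i; rewrite inE.
have BP (a : 'I_M) : (a \in B) = ((a < k) || (N + k <= a))%N.
  apply/imsetP/orP.
    move=> [i _ ->]; rewrite ffunE /=; case: (ltnP i k) => ik; first by left.
    by right; rewrite leq_add2l.
  case => ak.
    have ar : (a < r)%N by rewrite (leq_trans ak) // leq_addr.
    exists (Ordinal ar) => //; apply: val_inj; by rewrite ffunE /= ak.
  have ar : (a - N < r)%N by move: (nat_of_ord a) (ltn_ord a) ak => b; rewrite /M /r; lia.
  exists (Ordinal ar) => //; apply: val_inj; rewrite ffunE /= ifN; move: (nat_of_ord a) ak => b; lia.
have psiB (a : 'I_M) : a \in B -> 0 <= psi a.
  rewrite BP /psi subr_sqr => /orP[] aB.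
    apply: mulr_le0; move: (nat_of_ord a) aB (ltn_ord a) => b; rewrite /M /r; lia.
  apply: mulr_ge0; move: (nat_of_ord a) aB (ltn_ord a) => b; rewrite /M /r; lia.
have psiNB (a : 'I_M) : a \notin B -> psi a < 0.
  rewrite BP /psi subr_sqr negb_or -!ltnNge => /andP[a1 a2].
  rewrite nmulr_rlt0; move: (nat_of_ord a) a1 a2 (ltn_ord a) => b; rewrite /M /r; lia.
have AB : A \subset B.
  apply/fintype.subsetP => a aA; apply: contraT => aB.
  suff : \sum_(a in A) psi a < \sum_(b in B) psi b by rewrite e5 ltxx.
  rewrite (big_setID B) /= [ltRHS](big_setID A) /= finset.setIC ltrD2l.
  apply: (@lt_le_trans _ _ 0); last first.
    by apply: sumr_ge0 => b; rewrite inE => /andP[_ /psiB].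
  rewrite (bigD1 a) /=; last by rewrite inE aB.
  apply: ltr_wnDr (psiNB _ aB); apply: sumr_le0 => b.
  by rewrite inE => /andP[/andP[/psiNB /ltW]].
have lB i : exists j, l i == gapseq j.
  have /imsetP[j _ ->] : l i \in B by apply: (fintype.subsetP AB); apply: imset_f; rewrite inE.
  by exists j.
pose s i := xchoose (lB i).
have sE i : gapseq (s i) = l i by rewrite (eqP (xchooseP (lB i))).
have sI : injective s by move=> i j /(congr1 gapseq); rewrite !sE => /lI.
by exists (perm sI); apply/ffunP => i; rewrite ffunE permE sE.
Qed.
End GapSequence.

(** * Powers of a polynomial in terms of minors *)
Definition euler_iter (A : comNzRingType) (i : nat) (p : {poly A}) : {poly A} :=
  \poly_(n < size p) (n%:R ^+ i * p`_n).

Lemma coef_euler_iter (A : comNzRingType) i (p : {poly A}) n : (euler_iter i p)`_n = n%:R ^+ i * p`_n.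
Proof.
by rewrite coef_poly; case: ltnP => // h; rewrite nth_default ?mulr0.
Qed.

Lemma euler_iterE (A : comNzRingType) i (p : {poly A}) M : (size p <= M)%N ->
  euler_iter i p = \sum_(n < M) (n%:R ^+ i * 'X^n) * (p`_n)%:P.
Proof.
move=> pM; apply/polyP => m; rewrite coef_euler_iter coef_sum.
have cE n : ((n%:R ^+ i * 'X^n) * (p`_n)%:P)`_m = if m == n then n%:R ^+ i * p`_n else 0.
  rewrite coefMC -polyC_natr -rmorphXn /= coefCM coefXn; case: eqP => _; rewrite ?mulr1 ?mulr0 ?mul0r //.
under eq_bigr do rewrite cE.
case: (ltnP m M) => mM.
  rewrite (bigD1 (Ordinal mM)) //= eqxx big1 ?addr0 // => j jm.
  by rewrite -[X in if X then _ else _]/(Ordinal mM == j :> nat) val_eqE eq_sym (negbTE jm).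
rewrite nth_default ?mulr0 ?big1 //; last by rewrite (leq_trans pM).
by move=> j _; rewrite gtn_eqF // (leq_trans (ltn_ord j)).
Qed.

(** Leibniz's rule for the iterates of the Euler operator. *)
Lemma euler_iter_XnM (A : comNzRingType) k i j (E : {poly A}) : (i < k)%N ->
  euler_iter i ('X^j * E) = \sum_(a < k) ('C(i, a)%:R * euler_iter (i - a) E) * (j%:R ^+ a * 'X^j).
Proof.
move=> ik; transitivity ('X^j * \sum_(a < k) ('C(i, a)%:R * (j%:R ^+ a) * euler_iter (i - a) E)); last first.
  by rewrite mulr_sumr; apply: eq_bigr => a _; ring.
apply/polyP => m; rewrite coef_euler_iter !coefXnM; case: ltnP => jm; first by rewrite mulr0.
rewrite coef_sum -{1}(subnK jm) natrD exprDn mulr_suml.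
rewrite (big_ord_widen k (fun a => ((m - j)%N%:R ^+ (i - a) * j%:R ^+ a *+ 'C(i, a) : A) * E`_(m - j))) //.
rewrite big_mkcond /=; apply: eq_bigr => a _.
have cE (c d : nat) (q : {poly A}) n : (c%:R * d%:R ^+ a * q)`_n = c%:R * d%:R ^+ a * q`_n.
  by rewrite -natrX -natrM mulr_natl coefMn -[LHS]mulr_natl natrM natrX.
rewrite cE coef_euler_iter ltnS.
by case: leqP => ia; [rewrite -[_ *+ 'C(_, _)]mulr_natl; ring|rewrite bin_small // !mul0r].
Qed.

(** The matrix with entries (x d/dx)^i (x^j E) is, by Leibniz's rule, the
    product of a triangular matrix with diagonal E and of a Vandermonde matrix
    in 0, ..., k - 1 whose columns are scaled by x^j.  So its determinant is
    E^k times the left-hand constant, up to k! and a power of x.  Expanding the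
    same determinant over the coefficients of the x^j E gives the minors, and
    antisymmetrising over the rows turns the powers l_i^i into the Vandermonde
    product of [l], at the price of the factor k!. *)
Lemma coef_exp_chi (A : comNzRingType) (E : {poly A}) k N (m : nat) : (size E <= N.+1)%N ->
  k`!%:R * vdm (fun i : 'I_k => i%:R : A) * (E ^+ k)`_m =
  \sum_(l : {ffun 'I_k -> 'I_(N + k)} | (\sum_i l i == m + \sum_(i < k) i)%N)
    vdm (fun i => (l i)%:R) * chi E l.
Proof.
move=> sE; set M := (N + k)%N.
pose rho := (\sum_(i < k) i)%N.
have sXE (j : 'I_k) : (size ('X^j * E)%R <= M)%N.
  rewrite mulrC (leq_trans (size_polyMleq _ _)) // size_polyXn.
  by move: (nat_of_ord j) (ltn_ord j) => b; rewrite /M; lia.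
have key : (k`!%:R * vdm (fun i : 'I_k => i%:R : A))%:P * 'X^rho * E ^+ k =
    \sum_(l : {ffun 'I_k -> 'I_M}) (vdm (fun i => (l i)%:R) * chi E l)%:P * 'X^(\sum_i l i).
  pose Mx : 'M[{poly A}]_k := \matrix_(i, j) euler_iter i ('X^j * E).
  have detMx : \det Mx = (vdm (fun i : 'I_k => i%:R : A))%:P * 'X^rho * E ^+ k.
    have -> : Mx = (\matrix_(i < k, a < k) ('C(i, a)%:R * euler_iter (i - a) E)) *m
        (\matrix_(a < k, j < k) (j%:R ^+ a * 'X^j)).
      by apply/matrixP => i j; rewrite !mxE (euler_iter_XnM _ _ (ltn_ord i)); apply: eq_bigr => a _; rewrite !mxE.
    rewrite det_mulmx mulrC; congr (_ * _).
      rewrite -det_tr.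
      have -> : (\matrix_(a < k, j < k) (j%:R ^+ a * 'X^j : {poly A}))^T =
          \matrix_(i, j) ('X^i * (map_mx polyC (\matrix_(i < k, j < k) ((i%:R : A) ^+ j))) i j).
        apply/matrixP => i j; rewrite !mxE mulrC rmorphXn /= polyC_natr //.
      rewrite det_scale_rows mulrC det_map_mx; congr (_ * _).
      by rewrite (big_morph _ (@exprD _ 'X) (expr0 _)).
    rewrite det_trig; last by apply/is_trig_mxP => i j ij; rewrite mxE bin_small ?mul0r.
    rewrite (eq_bigr (fun=> E)) ?prodr_const ?card_ord // => i _.
    rewrite mxE subnn binn mul1r; apply/polyP => n; by rewrite coef_euler_iter mul1r.
  rewrite polyCM -!mulrA [X in _ * X]mulrA -detMx.
  transitivity (\sum_(s : 'S_k) \det Mx).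
    by rewrite polyC_natr sumr_const card_Sn mulr_natl.
  pose Pi (s : 'S_k) : 'M[{poly A}]_(k, M) := \matrix_(i, n) (n%:R ^+ (s i) * 'X^n).
  pose Q : 'M[{poly A}]_(M, k) := \matrix_(n, j) (('X^j * E)`_n)%:P.
  have detPi s : \det (Pi s *m Q) = (-1) ^+ s * \det Mx.
    rewrite -det_perm_rows; congr (\det _); apply/matrixP => i j; rewrite !mxE.
    by rewrite (euler_iterE _ (sXE j)); apply: eq_bigr => n _; rewrite !mxE.
  have chiQ (l : {ffun 'I_k -> 'I_M}) : \det (\matrix_(i, j) Q (l i) j) = (chi E l)%:P.
    by rewrite -det_map_mx; congr (\det _); apply/matrixP => i j; rewrite !mxE.
  rewrite (eq_bigr (fun s : 'S_k => \sum_(l : {ffun 'I_k -> 'I_M})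
      (-1) ^+ s * ((\prod_i Pi s i (l i)) * (chi E l)%:P))); last first.
    move=> s _; rewrite -mulr_sumr.
    have -> : \det Mx = (-1) ^+ s * \det (Pi s *m Q) by rewrite detPi mulrA -expr2 sqrr_sign mul1r.
    by rewrite det_mulmx_ffun; congr (_ * _); apply: eq_bigr => l _; rewrite chiQ.
  rewrite exchange_big /=; apply: eq_bigr => l _.
  under eq_bigr do rewrite mulrA.
  rewrite -mulr_suml polyCM -!mulrA [(chi E l)%:P * _]mulrC !mulrA; congr (_ * _).
  rewrite /vdm /determinant rmorph_sum mulr_suml; apply: eq_bigr => s _.
  rewrite rmorphM rmorph_sign -mulrA; congr (_ * _).
  rewrite (big_morph _ (@exprD _ 'X) (expr0 _)) rmorph_prod -big_split /=.
  by apply: eq_bigr => i _; rewrite !mxE rmorphXn /= polyC_natr.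
have := congr1 (fun p : {poly A} => p`_(m + rho)) key.
rewrite -mulrA coefCM coefXnM addnK ifN; last by rewrite -leqNgt leq_addl.
move=> ->; rewrite coef_sum [RHS]big_mkcond /=; apply: eq_bigr => l _.
by rewrite coefCM coefXn eq_sym; case: eqP => _; rewrite ?mulr1 ?mulr0.
Qed.

(** * A Bezoutian factorisation *)
Definition glue (T : Type) k (x y : 'I_k -> T) (i : 'I_(k + k)) : T :=
  match fintype.split i with inl i => x i | inr i => y i end.

Lemma glue_l T k (x y : 'I_k -> T) i : glue x y (lshift k i) = x i.
Proof. by rewrite /glue; case: splitP => j /= e; [congr x; apply: val_inj|move: (ltn_ord i); rewrite e ltnNge leq_addr]. Qed.

Lemma glue_r T k (x y : 'I_k -> T) i : glue x y (rshift k i) = y i.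
Proof. by rewrite /glue; case: splitP => j /= e; [move: (ltn_ord j); rewrite -e ltnNge leq_addr|congr y; apply: val_inj; apply: (@addnI k)]. Qed.

(** The sign (-1)^(k(k-1)/2), as a product over pairs to match [vdmE]. *)
Definition pair_sign (A : comNzRingType) k : A := \prod_(i < k) \prod_(j < k | (i < j)%N) -1.

Lemma pair_sign_sqr (A : comNzRingType) k : pair_sign A k * pair_sign A k = 1.
Proof.
rewrite /pair_sign -big_split big1 // => i _; rewrite -big_split big1 //= => j _.
by rewrite mulrNN mulr1.
Qed.

Lemma prod_diff_neq (A : comNzRingType) k (x : 'I_k -> A) :
  \prod_(i < k) \prod_(j < k | j != i) (x i - x j) = pair_sign A k * (vdm x * vdm x).
Proof.
transitivity (\prod_(i < k) \prod_(j < k | (i < j)%N) (x i - x j) *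
    \prod_(i < k) \prod_(j < k | (j < i)%N) (x i - x j)).
  rewrite -big_split /=; apply: eq_bigr => i _.
  rewrite big_mkcond [X in _ = X * _]big_mkcond [X in _ = _ * X]big_mkcond -big_split /=.
  apply: eq_bigr => j _; rewrite -val_eqE /=.
  by case: ltngtP; rewrite ?mulr1 ?mul1r.
rewrite mulrA vdmE; congr (_ * _).
  rewrite /pair_sign -big_split; apply: eq_bigr => i _; rewrite -big_split; apply: eq_bigr => j _.
  by rewrite /= mulN1r opprB.
by rewrite (exchange_big_dep xpredT).
Qed.

Lemma vdm_glue (A : comNzRingType) k (x y : 'I_k -> A) :
  vdm (glue x y) = vdm x * vdm y * \prod_(i < k) \prod_(j < k) (y j - x i).
Proof.
rewrite !vdmE big_split_ord /=.
rewrite [RHS]mulrAC -[X in _ = X * _]big_split /=; congr (_ * _); apply: eq_bigr => i _.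
  rewrite big_split_ord /=; congr (_ * _).
    by apply: eq_bigr => j _; rewrite !glue_l.
  apply: eq_big => j; last by move=> _; rewrite glue_l glue_r.
  by rewrite (leq_trans (ltn_ord i)) // leq_addr.
rewrite big_split_ord /= big_pred0 ?mul1r; last first.
  by move=> j; have := ltn_ord j; lia.
apply: eq_big => j; last by move=> _; rewrite !glue_r.
by rewrite ltn_add2l.
Qed.

Section Bezout.
Variables (F : fieldType) (k N : nat) (x y : 'I_k -> F).
Hypothesis xI : injective x.
Let d i := \prod_(r | r != i) (x i - x r).
Let P j := \prod_r (y j - x r).
Let W : 'M[F]_k := \matrix_(j, i) (\prod_(r | r != i) (y j - x r) / d i).
Let V (z : 'I_k -> F) : 'M[F]_k := \matrix_(i, c) z i ^+ c.

Let d0 i : d i != 0.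
Proof. by apply/prodf_neq0 => r ri; rewrite subr_eq0 eq_sym (inj_eq xI). Qed.

(** Lagrange interpolation at the points [x] is exact on polynomials of degree
    less than [k]; [W] is the matrix of the interpolation coefficients at the
    points [y]. *)
Lemma lagrange_mx : W *m V x = V y.
Proof.
apply/matrixP => j c; rewrite !mxE.
pose l i : {poly F} := (d i)^-1 *: \prod_(r | r != i) ('X - (x r)%:P).
pose p := \sum_i (x i ^+ c) *: l i - 'X^c.
have p0 : p = 0.
  apply/eqP; apply: contraT => pn.
  have : (size p <= k)%N.
    rewrite (leq_trans (size_polyD _ _)) // geq_max size_polyN size_polyXn ltn_ord andbT.
    apply: (leq_trans (size_sum _ _ _)); apply/bigmax_leqP => i _.
    rewrite (leq_trans (size_scale_leq _ _)) // (leq_trans (size_scale_leq _ _)) //.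
    have -> : \prod_(r | r != i) ('X - (x r)%:P) = \prod_(r <- enum (predC1 i)) ('X - (x r)%:P).
      by rewrite big_enum.
    by rewrite size_prod_XsubC -cardE cardC1 card_ord prednK // (leq_ltn_trans _ (ltn_ord i)).
  have urs : uniq [seq x i | i <- enum 'I_k] by rewrite map_inj_uniq // enum_uniq.
  move=> sp; have := max_poly_roots pn _ urs; rewrite size_map size_enum_ord ltnNge sp; apply.
  apply/allP => _ /mapP[i _ ->]; rewrite rootE /p hornerD hornerN hornerXn horner_sum.
  rewrite (bigD1 i) //= big1 ?addr0.
    rewrite /l !hornerZ horner_prod (eq_bigr (fun r => x i - x r)); last by move=> r _; rewrite hornerXsubC.
    by rewrite -/(d i) mulVf // mulr1 subrr.
  move=> m mi; rewrite /l !hornerZ horner_prod (bigD1 i) 1?eq_sym //= hornerXsubC subrr.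
  by rewrite mul0r !mulr0.
have /eqP : p.[y j] = 0 by rewrite p0 horner0.
rewrite /p hornerD hornerN hornerXn horner_sum subr_eq0 => /eqP <-.
apply: eq_bigr => i _; rewrite /l !mxE !hornerZ horner_prod mulrC; congr (_ * _).
by rewrite mulrC; congr (_ * _); apply: eq_bigr => r _; rewrite hornerXsubC.
Qed.

(** The entries are the divided differences (y^M - x^M) / (y - x). *)
Definition bezout_mx (M : nat) : 'M[F]_k := \matrix_(i, j) \sum_(n < M) x i ^+ (M.-1 - n) * y j ^+ n.

(** With V the Vandermonde matrices and D the diagonal matrices of M-th powers,
    the left matrix is the block matrix (V_x, D_x V_x; V_y, D_y V_y).  Since
    V_y = W V_x, a block row operation leaves D_y W - W D_x in the corner, and
    the entries of this commutator are divided differences times Cauchy-type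
    factors. *)
Lemma det_gapseq_bezout :
  \det (\matrix_(i, c < k + k) glue x y i ^+ gapseq k N c) =
  pair_sign F k * (\prod_(i < k) \prod_(j < k) (y j - x i)) * \det (bezout_mx (N + k)).
Proof.
pose M := (N + k)%N.
pose Dx := diag_mx (\row_i (x i ^+ M)).
pose Dy := diag_mx (\row_i (y i ^+ M)).
have Vx : \det (V x) != 0 by apply: vdm_neq0.
have -> : \matrix_(i, c < k + k) glue x y i ^+ gapseq k N c =
    block_mx (V x) (Dx *m V x) (V y) (Dy *m V y).
  apply/matrixP => i c; rewrite -(splitK i) -(splitK c) mxE.
  case: (fintype.split i) => i'; case: (fintype.split c) => c' /=; rewrite ?glue_l ?glue_r ffunE /=.
  - by rewrite block_mxEul mxE ltn_ord.
  - by rewrite block_mxEur ltnNge leq_addr /= mul_diag_mx !mxE -exprD /M addnA.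
  - by rewrite block_mxEdl mxE ltn_ord.
  - by rewrite block_mxEdr ltnNge leq_addr /= mul_diag_mx !mxE -exprD /M addnA.
have -> : \det (block_mx (V x) (Dx *m V x) (V y) (Dy *m V y)) =
   \det (block_mx (V x) (Dx *m V x) 0 ((Dy *m W - W *m Dx) *m V x)).
  transitivity (\det (block_mx 1%:M 0 (- W) 1%:M *m block_mx (V x) (Dx *m V x) (V y) (Dy *m V y))).
    by rewrite det_mulmx det_lblock !det1 !mul1r.
  congr (\det _); rewrite mulmx_block !mul1mx !mul0mx !addr0 -lagrange_mx.
  by rewrite mulNmx addNr mulNmx addrC mulmxBl !mulmxA.
rewrite det_ublock det_mulmx.
have -> : Dy *m W - W *m Dx =
    \matrix_(j, i) (P j * (\matrix_(i, j) ((d i)^-1 * bezout_mx M i j))^T j i).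
  apply/matrixP => j i; rewrite mul_diag_mx mul_mx_diag !mxE.
  have -> : P j = (y j - x i) * \prod_(r | r != i) (y j - x r) by rewrite /P (bigD1 i).
  rewrite [_ / d i * _]mulrC -mulrBl -[y j ^+ M - _]opprB subrXX -mulNr opprB.
  rewrite -!mulrA; congr (_ * _); rewrite mulrCA; congr (_ * _); exact: mulrC.
rewrite det_scale_rows det_tr det_scale_rows prodfV.
have -> : \prod_i d i = pair_sign F k * (\det (V x) * \det (V x)) by apply: prod_diff_neq.
rewrite invfM invfM.
have -> : (pair_sign F k)^-1 = pair_sign F k.
  by apply: (mulfI (x := pair_sign F k)); rewrite ?divff ?pair_sign_sqr // -unitfE; apply/unitrP; exists (pair_sign F k); rewrite pair_sign_sqr.
have -> : \prod_i P i = \prod_(i < k) \prod_(j < k) (y j - x i) by rewrite exchange_big.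
by rewrite -/M; field.
Qed.

End Bezout.

(** * Polynomial identities in two groups of variables *)
Lemma det_bezout_mx (F : fieldType) k M (x y : 'I_k -> F) :
  \det (bezout_mx x y M) = \sum_(l : {ffun 'I_k -> 'I_M}) \sum_(s : 'S_k)
     (-1) ^+ s * ((\prod_i x i ^+ l i) * \prod_i y i ^+ (rev_ord (l (s i)))).
Proof.
have -> : bezout_mx x y M = (\matrix_(i < k, n < M) x i ^+ n) *m (\matrix_(n < M, j < k) y j ^+ (rev_ord n)).
  apply/matrixP => i j; rewrite !mxE (reindex_inj rev_ord_inj) /=; apply: eq_bigr => n _.
  by rewrite !mxE /=; congr (_ ^+ _ * _); have := ltn_ord n; lia.
rewrite det_mulmx_ffun; apply: eq_bigr => l _.
under eq_bigr do rewrite mxE.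
rewrite -det_tr /determinant mulr_sumr; apply: eq_bigr => s _; rewrite mulrCA; congr (_ * (_ * _)).
by apply: eq_bigr => i _; rewrite !mxE.
Qed.

Lemma sum_ffun_glue (A : comNzRingType) k M (c : {ffun 'I_k -> 'I_M} -> {ffun 'I_k -> 'I_M} -> A) :
  \sum_l \sum_p c l p = \sum_(q : {ffun 'I_(k + k) -> 'I_M})
    c [ffun i => q (lshift k i)] [ffun i => q (rshift k i)].
Proof.
rewrite pair_big /=.
rewrite (reindex (fun q : {ffun 'I_(k + k) -> 'I_M} => ([ffun i => q (lshift k i)], [ffun i => q (rshift k i)]))) //.
exists (fun lp : {ffun 'I_k -> 'I_M} * {ffun 'I_k -> 'I_M} => [ffun i => glue (fun j => lp.1 j) (fun j => lp.2 j) i]).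
- move=> q _; apply/ffunP => i; rewrite ffunE -(splitK i).
  by case: (fintype.split i) => j /=; rewrite ?glue_l ?glue_r ffunE.
- by move=> [l p] _ /=; congr pair; apply/ffunP => i; rewrite !ffunE ?glue_l ?glue_r.
Qed.

Definition kronecker_pt (F : numDomainType) r M n (i : 'I_r) : F := n.+2%:R ^+ (M ^ i).

Lemma kronecker_substitution2 (F : numDomainType) k M (a b : {ffun 'I_k -> 'I_M} -> {ffun 'I_k -> 'I_M} -> F) :
  (forall n, let x i := kronecker_pt F M n (lshift k i) in let y i := kronecker_pt F M n (rshift k i) in
    \sum_l \sum_p a l p * ((\prod_i x i ^+ l i) * \prod_i y i ^+ p i) =
    \sum_l \sum_p b l p * ((\prod_i x i ^+ l i) * \prod_i y i ^+ p i)) ->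
  forall l p, a l p = b l p.
Proof.
move=> h l p; apply/eqP; rewrite -subr_eq0; apply/eqP.
pose c (q : {ffun 'I_(k + k) -> 'I_M}) :=
  a [ffun i => q (lshift k i)] [ffun i => q (rshift k i)] - b [ffun i => q (lshift k i)] [ffun i => q (rshift k i)].
have := @kronecker_substitution F _ _ c _ [ffun i => glue l p i].
rewrite /c.
have -> : [ffun i => [ffun i0 => glue l p i0] (lshift k i)] = l by apply/ffunP => i; rewrite !ffunE glue_l.
have -> : [ffun i => [ffun i0 => glue l p i0] (rshift k i)] = p by apply/ffunP => i; rewrite !ffunE glue_r.
apply => n.
have := h n => /= /eqP.
pose x (i : 'I_k) := kronecker_pt F M n (lshift k i); pose y (i : 'I_k) := kronecker_pt F M n (rshift k i).
rewrite (@sum_ffun_glue F k M (fun l p => a l p * ((\prod_i x i ^+ l i) * \prod_i y i ^+ p i))).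
rewrite (@sum_ffun_glue F k M (fun l p => b l p * ((\prod_i x i ^+ l i) * \prod_i y i ^+ p i))).
rewrite -subr_eq0 -sumrB => /eqP e.
rewrite -[RHS]e; apply: eq_bigr => q _; rewrite -mulrBl big_split_ord /=; congr (_ * (_ * _)).
- by apply: eq_bigr => i _; rewrite ffunE.
- by apply: eq_bigr => i _; rewrite ffunE.
Qed.

(** * Characteristic polynomials and resolvents *)
Lemma det_rank1 (A : comNzRingType) n (u : 'cV[A]_n) (w : 'rV[A]_n) :
  \det (1%:M + u *m w) = 1 + (w *m u) 0 0.
Proof.
transitivity (\det (block_mx 1%:M u (- w) (1%:M : 'M[A]_1))).
  have -> : block_mx 1%:M u (- w) (1%:M : 'M[A]_1) =
    block_mx 1%:M u 0 1%:M *m block_mx (1%:M + u *m w) 0 (- w) 1%:M.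
    rewrite mulmx_block !mul1mx !mul0mx !mulmx1 ?mulmx0 !add0r.
    by rewrite mulmxN addrK.
  by rewrite det_mulmx det_ublock det_lblock !det1 !mul1r mulr1.
have -> : block_mx 1%:M u (- w) (1%:M : 'M[A]_1) =
    block_mx 1%:M 0 (- w) 1%:M *m block_mx 1%:M u 0 (1%:M + w *m u).
  rewrite mulmx_block !mul1mx !mul0mx !mulmx1 ?mulmx0 !addr0.
  by rewrite mulNmx addrC addrK.
by rewrite det_mulmx det_lblock det_ublock !det1 !mul1r det_mx11 !mxE eqxx.
Qed.

(** Jacobi's formula. *)
Lemma deriv_det (A : comNzRingType) n (P : 'M[{poly A}]_n) :
  (\det P)^`() = \sum_i \sum_j (P i j)^`() * cofactor P i j.
Proof.
have dprod (r : nat) (f : 'I_r -> {poly A}) :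
    (\prod_i f i)^`() = \sum_i (f i)^`() * \prod_(j | j != i) f j.
  elim: r f => [|r IH] f; first by rewrite !big_ord0 -polyC1 derivC.
  rewrite !big_ord_recl derivM IH mulr_sumr; congr (_ + _).
    by congr (_ * _); rewrite [RHS]big_mkcond big_ord_recl eqxx /= mul1r.
  apply: eq_bigr => i _; rewrite mulrCA; congr (_ * _).
  rewrite [RHS]big_mkcond big_ord_recl /=; congr (_ * _).
  by rewrite [LHS]big_mkcond.
have -> : (\det P)^`() = \sum_i \det (\matrix_(a, b) (if a == i then (P a b)^`() else P a b)).
  rewrite /determinant raddf_sum /= exchange_big /=; apply: eq_bigr => s _.
  rewrite -mulr_sumr.
  have -> (b : bool) (q : {poly A}) : ((-1) ^+ b * q)^`() = (-1) ^+ b * q^`().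
    by case: b; rewrite ?expr1 ?expr0 ?mul1r // !mulN1r derivN.
  rewrite dprod; congr (_ * _); apply: eq_bigr => i _.
  rewrite [RHS](bigD1 i) //= mxE eqxx; congr (_ * _); apply: eq_bigr => j ji.
  by rewrite mxE (negbTE ji).
apply: eq_bigr => i _; rewrite (expand_det_row _ i); apply: eq_bigr => j _.
rewrite mxE eqxx; congr (_ * _); rewrite /cofactor; congr (_ * \det _).
by apply/matrixP => a b; rewrite !mxE eq_sym (negbTE (neq_lift _ _)).
Qed.

(** The generating polynomial of the secular coefficients. *)
Definition secpoly (A : comNzRingType) N (U : 'M[A]_N) : {poly A} :=
  \det (1%:M + 'X *: map_mx polyC U).

Lemma secpoly_horner (A : comNzRingType) N (U : 'M[A]_N) t :
  (secpoly U).[t] = \det (1%:M + t *: U).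
Proof.
rewrite /secpoly -[_.[t]]/(horner_eval t _) -det_map_mx; congr (\det _).
apply/matrixP => i j; rewrite !mxE /= /horner_eval hornerD hornerM hornerX hornerC.
by case: (i == j); rewrite ?mulr1n ?mulr0n hornerC.
Qed.

Lemma secpoly_euler (F : fieldType) N (U : 'M[F]_N) t : 1%:M + t *: U \in unitmx ->
  (euler (secpoly U)).[t] = (secpoly U).[t] * \tr (t *: U *m invmx (1%:M + t *: U)).
Proof.
move=> Ut; rewrite /euler hornerM hornerX /secpoly deriv_det secpoly_horner.
rewrite -[in RHS]scalemxAl mxtraceZ mulrCA; congr (_ * _).
rewrite /invmx Ut -scalemxAr mxtraceZ mulrA divff ?mul1r; last by rewrite -unitfE -unitmxE.
rewrite horner_sum; apply: eq_bigr => i _; rewrite horner_sum mxE; apply: eq_bigr => j _.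
rewrite hornerM !mxE; congr (_ * _).
  by rewrite derivD derivM derivX derivC mulr0 addr0 mul1r; case: (i == j);
    rewrite ?mulr1n ?mulr0n -?polyC1 derivC add0r hornerC.
rewrite /cofactor hornerM horner_exp hornerN -polyC1 hornerC; congr (_ * _).
rewrite -[_.[t]]/(horner_eval t _) -det_map_mx; congr (\det _).
apply/matrixP => a b; rewrite !mxE /= /horner_eval hornerD hornerM hornerX hornerC.
by case: (_ == _); rewrite ?mulr1n ?mulr0n hornerC.
Qed.

Definition resol (F : fieldType) N (U : 'M[F]_N) (t : F) : 'M[F]_N :=
  t *: U *m invmx (1%:M + t *: U).

Lemma resolE (F : fieldType) N (U : 'M[F]_N) t : 1%:M + t *: U \in unitmx ->
  resol U t = 1%:M - invmx (1%:M + t *: U).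
Proof.
move=> Ut; rewrite /resol -{1}[t *: U](addKr 1%:M) mulmxDl mulmxV // mulNmx mul1mx.
by rewrite addrC.
Qed.

(** The resolvent identity, for t U (1 + t U)^-1 = 1 - (1 + t U)^-1. *)
Lemma resol_mul (F : fieldType) N (U : 'M[F]_N) s t :
  1%:M + s *: U \in unitmx -> 1%:M + t *: U \in unitmx ->
  (t - s) *: (resol U s *m resol U t) = t *: resol U s - s *: resol U t.
Proof.
move=> Us Ut; rewrite !resolE //.
set A := 1%:M + s *: U in Us *; set B := 1%:M + t *: U in Ut *.
have e : (t - s) *: (invmx A *m invmx B) = t *: invmx B - s *: invmx A.
  have -> : t *: invmx B - s *: invmx A = invmx A *m (t *: A - s *: B) *m invmx B.
    rewrite mulmxBr mulmxBl -!scalemxAr -!scalemxAl mulVmx // mul1mx.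
    by rewrite -mulmxA mulmxV // mulmx1.
  rewrite /A /B !scalerDr !scalerA [s * t]mulrC opprD addrACA subrr addr0 -scalerBl.
  by rewrite -scalemxAr mulmx1 -scalemxAl.
rewrite mulmxBl mul1mx mulmxBr mulmx1 !scalerBr e.
apply/matrixP => i j; rewrite !mxE; move: (_%:R : F) (invmx A i j) (invmx B i j) => a b c; ring.
Qed.

Lemma resol_mul_trace (F : fieldType) N (U : 'M[F]_N) s t : s != t ->
  1%:M + s *: U \in unitmx -> 1%:M + t *: U \in unitmx ->
  \tr (resol U s *m resol U t) = (t * \tr (resol U s) - s * \tr (resol U t)) / (t - s).
Proof.
move=> st Us Ut; have ts : t - s != 0 by rewrite subr_eq0 eq_sym.
apply: (mulfI ts); rewrite mulrCA divff // mulr1.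
by rewrite -mxtraceZ resol_mul // raddfB /= !mxtraceZ.
Qed.

(** Multiplication by a rank one perturbation of the identity makes det(1 + tU)
    affine in the parameter of the perturbation. *)
Lemma det_rank1_pert (F : fieldType) N (U : 'M[F]_N) t z (u : 'cV[F]_N) (w : 'rV[F]_N) :
  1%:M + t *: U \in unitmx ->
  (secpoly ((1%:M + (z - 1) *: (u *m w)) *m U)).[t] =
  (secpoly U).[t] * (1 + (z - 1) * (w *m resol U t *m u) 0 0).
Proof.
move=> Ut; rewrite !secpoly_horner.
have -> : 1%:M + t *: ((1%:M + (z - 1) *: (u *m w)) *m U) =
    (1%:M + u *m ((z - 1) *: (w *m resol U t))) *m (1%:M + t *: U).
  rewrite mulmxDl mul1mx mulmxDl mul1mx scalerDr addrA; congr (_ + _).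
  have e : resol U t *m (1%:M + t *: U) = t *: U by rewrite /resol -mulmxA mulVmx // mulmx1.
  have -> : u *m ((z - 1) *: (w *m resol U t)) *m (1%:M + t *: U) =
      (z - 1) *: (u *m (w *m (resol U t *m (1%:M + t *: U)))).
    by rewrite -scalemxAr -scalemxAl !mulmxA.
  by rewrite e -scalemxAl -!scalemxAr !scalerA mulrC mulmxA.
rewrite det_mulmx mulrC det_rank1 -scalemxAl mxE.
done.
Qed.

(** * Polynomial identities on the unit circle *)
Lemma coef_prod_lin (F : comNzRingType) r (a : 'I_r -> F) :
  let p := \prod_i (1 + (a i) *: 'X) in
  [/\ p`_0 = 1, p`_1 = \sum_i a i &
     2%:R * p`_2 = \sum_(i < r) \sum_(j < r | j != i) a i * a j].
Proof.
move=> p.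
have [p0 p1 p2] : [/\ p`_0 = 1, p`_1 = \sum_i a i &
     2%:R * p`_2 = (\sum_i a i) ^+ 2 - \sum_i a i ^+ 2].
  rewrite /p {p}; elim: r a => [|r IH] a.
    by rewrite !big_ord0 !coef1 /= !mulr0 expr0n subr0.
  rewrite !big_ord_recl; have [p0 p1 p2] := IH (fun i => a (lift ord0 i)).
  set q := \prod_(i < r) _ in p0 p1 p2 *.
  rewrite mulrDl mul1r -scalerAl !coefD !coefZ !coefXM /= p0 p1 mulrDr p2; split.
  - by rewrite mulr0 addr0.
  - by rewrite mulr1 addrC.
  - ring.
split => //; rewrite p2 expr2 mulr_suml -sumrB; apply: eq_bigr => i _.
by rewrite -mulr_sumr expr2 -mulrBr; congr (_ * _); rewrite [X in X - _](bigD1 i) //= addrAC subrr add0r.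
Qed.

(** Infinitely many explicit points of the unit circle, images of the integers
    under the Cayley transform. *)
Definition cayley (C : numClosedFieldType) (n : nat) : C := (1 + 'i * n.+1%:R) / (1 - 'i * n.+1%:R).

Lemma cayley_den (C : numClosedFieldType) n : 1 - 'i * n.+1%:R != 0 :> C.
Proof.
apply/eqP => /eqP; rewrite subr_eq0 => /eqP /(congr1 (fun x => x ^+ 2)).
rewrite expr1n exprMn sqrCi mulN1r -natrX => /eqP.
by rewrite -subr_eq0 opprK nat1r pnatr_eq0.
Qed.

Lemma cayley_conj (C : numClosedFieldType) n : (cayley C n)^* * cayley C n = 1.
Proof.
rewrite /cayley fmorph_div rmorphB rmorphD rmorphM rmorph1 /= conjCi rmorph_nat mulNr opprK.
have h := cayley_den C n.
have h' : 1 + 'i * n.+1%:R != 0 :> C.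
  by rewrite -conjC_eq0 rmorphD rmorphM rmorph1 /= conjCi rmorph_nat mulNr.
by rewrite mulrA divfK // divff.
Qed.

Lemma poly_cayley_roots (C : numClosedFieldType) (p : {poly C}) :
  (forall n, p.[cayley C n - 1] = 0) -> p = 0.
Proof.
move=> p0; apply/eqP; apply: contraT => pn.
have := max_poly_roots (rs := [seq cayley C n - 1 | n <- iota 0 (size p)]) pn.
rewrite size_map size_iota ltnn => -> //.
  by apply/allP => _ /mapP[i _ ->]; rewrite rootE p0.
rewrite map_inj_uniq ?iota_uniq // => m n /addIr.
have hm := cayley_den C m; have hn := cayley_den C n.
rewrite /cayley => /eqP; rewrite eqr_div // => /eqP e.
have : 2%:R * 'i * (m.+1%:R - n.+1%:R) = 0 :> C.
  have := congr1 (fun x => x - (1 + 'i * n.+1%:R) * (1 - 'i * m.+1%:R)) e.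
  by rewrite subrr => <-; ring.
move=> /eqP; rewrite !mulf_eq0 pnatr_eq0 (negbTE (neq0Ci C)) /= subr_eq0 eqr_nat.
by move=> /eqP[].
Qed.

Lemma coef_exprD1n (F : comNzRingType) k m : ((1 + 'X : {poly F}) ^+ k)`_m = 'C(k, m)%:R.
Proof.
rewrite addrC exprD1n coef_sum.
case: (ltnP m k.+1) => mk.
  rewrite (bigD1 (Ordinal mk)) //= coefMn coefXn eqxx big1 ?addr0 // => i im.
  rewrite coefMn coefXn -[X in X%:R]/(nat_of_bool (Ordinal mk == i :> nat)) val_eqE eq_sym (negbTE im).
  by rewrite mul0rn.
rewrite bin_small // big1 // => i _; rewrite coefMn coefXn gtn_eqF ?mul0rn //.
exact: leq_trans (ltn_ord i) mk.
Qed.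

(** The hypothesis says that two polynomials in z - 1, one of them
    z^k = (1 + (z - 1))^k up to the constant [b ord0], agree at infinitely many
    points of the circle. *)
Lemma unit_circle_coefs (C : numClosedFieldType) (r k : nat) (b : 'I_r.+3 -> C) :
  (forall n, \sum_(m < r.+3) (cayley C n - 1) ^+ m * b m = cayley C n ^+ k * b ord0) ->
  b (inord 1) = k%:R * b ord0 /\ b (inord 2) = 'C(k, 2)%:R * b ord0.
Proof.
move=> h.
pose p : {poly C} := \sum_(m < r.+3) b m *: 'X^m - b ord0 *: (1 + 'X) ^+ k.
have p0 : p = 0.
  apply: poly_cayley_roots => n; rewrite /p hornerD hornerN hornerZ horner_exp hornerD hornerX -polyC1 hornerC.
  rewrite subrKC [b ord0 * _]mulrC -h horner_sum; apply/eqP; rewrite subr_eq0; apply/eqP.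
  by apply: eq_bigr => m _; rewrite hornerZ hornerXn mulrC.
have co m : (m < r.+3)%N -> b (inord m) = 'C(k, m)%:R * b ord0.
  move=> mr; have := congr1 (fun q : {poly C} => q`_m) p0.
  rewrite coef0 /p coefB coefZ coef_sum (bigD1 (inord m)) //= coefZ coefXn inordK // eqxx mulr1.
  rewrite big1 ?addr0; last first.
    move=> j jm; rewrite coefZ coefXn; case: eqP => [e|]; last by rewrite mulr0.
    by case/eqP: jm; apply: val_inj; rewrite /= inordK.
  move/eqP; rewrite subr_eq0 => /eqP ->; rewrite mulrC; congr (_ * _).
  exact: coef_exprD1n.
by split; [rewrite co // bin1|rewrite co].
Qed.

(** * Unitary matrices *)
Section UnitaryAlgebra.
Variables (C : numClosedFieldType) (N : nat).
Implicit Types U V : 'M[C]_N.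

Definition adjm (U : 'M[C]_N) : 'M[C]_N := map_mx Num.conj U^T.
Definition unitary U := U *m adjm U = 1%:M.

Lemma unitary_det U : unitary U -> (\det U)^* * \det U = 1.
Proof.
by move=> /(congr1 (fun A => \det A)); rewrite det_mulmx /adjm det_map_mx det_tr det1 mulrC.
Qed.

(** The eigenvalues of U lie on the unit circle, so -1/t is not one of them
    when t >= 2. *)
Lemma unitary_resol_unit U n : unitary U -> 1%:M + n.+2%:R *: U \in unitmx.
Proof.
move=> uU; rewrite unitmxE unitfE; apply/negP => /det0P[v v0 vU].
have e : v = - (n.+2%:R *: (v *m U)).
  by apply/eqP; rewrite -addr_eq0 -[X in X + _]mulmx1 scalemxAr -mulmxDr vU.
pose S := (v *m map_mx Num.conj v^T) 0 0.
have SE : S = n.+2%:R ^+ 2 * S.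
  rewrite /S {1 2}e linearN /= map_mxN mulNmx mulmxN opprK linearZ /= map_mxZ rmorph_nat.
  rewrite -scalemxAl -scalemxAr scalerA mxE expr2; congr (_ * _).
  rewrite trmx_mul map_mxM -!mulmxA [U *m _]mulmxA.
  have -> : U *m map_mx Num.conj U^T = 1%:M by [].
  by rewrite mul1mx.
have S0 : S = 0.
  move/eqP: SE; rewrite -subr_eq0 -{1}[S]mul1r -mulrBl mulf_eq0 -natrX subr_eq0.
  by rewrite (@eqr_nat _ 1) => /orP[|/eqP //]; rewrite expnS; lia.
case/eqP: v0; apply/rowP => j; rewrite !mxE.
have := S0; rewrite /S mxE => /eqP; rewrite psumr_eq0; last first.
  by move=> i _; rewrite !mxE mul_conjC_ge0.
by move=> /allP /(_ j (mem_index_enum _)); rewrite !mxE mul_conjC_eq0 => /eqP.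
Qed.

Lemma secpoly_rev U : exists2 p : {poly C},
  [/\ p \is monic, size p = N.+1 & forall t, p.[t] = \det (t%:M + U)] &
  forall m, (secpoly U)`_m = if (m <= N)%N then p`_(N - m) else 0.
Proof.
pose p := char_poly (- U).
have pE t : p.[t] = \det (t%:M + U).
  rewrite /p /char_poly -[_.[t]]/(horner_eval t _) -det_map_mx; congr (\det _).
  apply/matrixP => i j; rewrite !mxE /= /horner_eval hornerD hornerN hornerC opprK.
  by case: (i == j); rewrite ?mulr1n ?mulr0n ?hornerX ?horner0.
exists p; first by split=> //; [exact: char_poly_monic|exact: size_char_poly].
have -> : secpoly U = \poly_(m < N.+1) p`_(N - m).
  apply/eqP; rewrite -subr_eq0; apply/eqP; apply: poly_nat_roots => n.
  rewrite hornerD hornerN secpoly_horner; apply/eqP; rewrite subr_eq0; apply/eqP.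
  set t := n.+2%:R; have t0 : t != 0 by rewrite pnatr_eq0.
  have -> : 1%:M + t *: U = t *: (t^-1%:M + U).
    by rewrite scalerDr -[t^-1%:M]scalemx1 scalerA divff // scale1r.
  rewrite detZ -pE horner_poly (@horner_coef_wide _ N.+1) ?size_char_poly // mulr_sumr.
  rewrite (reindex_inj rev_ord_inj) /=; apply: eq_bigr => i _.
  rewrite subSS mulrCA; congr (_ * _).
  have iN : (i <= N)%N by rewrite -ltnS.
  by rewrite exprVn -[in t ^+ N](subnK iN) exprD mulrC mulKf // expf_neq0.
by move=> m; rewrite coef_poly ltnS.
Qed.

Lemma secpoly_size U : (size (secpoly U) <= N.+1)%N.
Proof.
have [p _ pE] := secpoly_rev U; apply/leq_sizeP => j jN.
by rewrite pE leqNgt jN.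
Qed.

Lemma secpoly0 U : (secpoly U)`_0 = 1.
Proof.
have [p [/monicP pm sp _] pE] := secpoly_rev U; rewrite pE subn0.
by move: pm; rewrite /lead_coef sp.
Qed.

Lemma secpolyN U : (secpoly U)`_N = \det U.
Proof.
have [p [_ _ ph] pE] := secpoly_rev U; rewrite pE leqnn subnn -horner_coef0 ph.
by congr (\det _); apply/matrixP => i j; rewrite !mxE mul0rn add0r.
Qed.

Lemma det_adjm U : \det (adjm U) = (\det U)^*.
Proof. by rewrite /adjm det_map_mx det_tr. Qed.

(** Conjugating 1 + tU gives 1 + t U^-1 = U^-1 (U + t), and det(U + t) is the
    reversed polynomial. *)
Lemma secpoly_conj U m : unitary U -> (m <= N)%N ->
  ((secpoly U)`_m)^* = (\det U)^* * (secpoly U)`_(N - m).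
Proof.
move=> uU mN.
have [p [_ sp ph] pE] := secpoly_rev U; rewrite [in RHS]pE leq_subr subKn //.
suff /(congr1 (fun q : {poly C} => q`_m)) : map_poly Num.conj (secpoly U) = (\det U)^* *: p.
  by rewrite coef_map coefZ.
apply/eqP; rewrite -subr_eq0; apply/eqP; apply: poly_nat_roots => n.
rewrite hornerD hornerN hornerZ -[n.+2%:R](rmorph_nat Num.conj) horner_map /= rmorph_nat.
rewrite secpoly_horner ph -!det_adjm -det_mulmx; apply/eqP; rewrite subr_eq0; apply/eqP.
congr (\det _); rewrite mulmxDr (mulmx1C uU).
rewrite -[_.+2%:R%:M]scalemx1 -scalemxAr mulmx1 addrC.
by apply/matrixP => i j; rewrite !mxE rmorphD rmorphM /= !rmorph_nat eq_sym addrC.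
Qed.

End UnitaryAlgebra.

(** * Minors under a left invariant mean *)

(** The orthogonality of the minors uses only a positive left invariant linear
    functional on an algebra of functions containing the matrix entries.  This
    keeps the algebra apart from measurability and integrability, which the
    next part provides for the Haar integral. *)
Section Haar.
Variables (C : numClosedFieldType) (N : nat) (T : Type) (val : T -> 'M[C]_N).
Variables (nice : (T -> C) -> Prop) (I : (T -> C) -> C).
Hypothesis val_unitary : forall U, unitary (val U).
Hypothesis nice_ext : forall f g, f =1 g -> nice f -> nice g.
Hypothesis nice_cst : forall c, nice (fun=> c).
Hypothesis nice_entry : forall i j, nice (fun U => val U i j).
Hypothesis niceD : forall f g, nice f -> nice g -> nice (fun U => f U + g U).
Hypothesis niceM : forall f g, nice f -> nice g -> nice (fun U => f U * g U).
Hypothesis niceJ : forall f, nice f -> nice (fun U => (f U)^*).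
Hypothesis I_ext : forall f g, f =1 g -> I f = I g.
Hypothesis I_cst : forall c, I (fun=> c) = c.
Hypothesis ID : forall f g, nice f -> nice g -> I (fun U => f U + g U) = I f + I g.
Hypothesis IZ : forall c f, nice f -> I (fun U => c * f U) = c * I f.
Hypothesis I_ge0 : forall f, nice f -> (forall U, 0 <= f U) -> 0 <= I f.
Hypothesis I_inv : forall (V : 'M[C]_N) (F : 'M[C]_N -> C), unitary V ->
  nice (fun U => F (val U)) -> I (fun U => F (V *m val U)) = I (fun U => F (val U)).

Lemma nice_sum (J : Type) (s : seq J) (P : pred J) (f : J -> T -> C) :
  (forall j, P j -> nice (f j)) -> nice (fun U => \sum_(j <- s | P j) f j U).
Proof.
move=> nf; elim: s => [|j s IH].
  by apply: nice_ext (nice_cst 0) => U; rewrite big_nil.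
have [Pj|Pj] := boolP (P j).
  by apply: nice_ext (niceD (nf _ Pj) IH) => U; rewrite big_cons Pj.
by apply: nice_ext IH => U; rewrite big_cons (negbTE Pj).
Qed.

Lemma nice_prod (J : Type) (s : seq J) (P : pred J) (f : J -> T -> C) :
  (forall j, P j -> nice (f j)) -> nice (fun U => \prod_(j <- s | P j) f j U).
Proof.
move=> nf; elim: s => [|j s IH].
  by apply: nice_ext (nice_cst 1) => U; rewrite big_nil.
have [Pj|Pj] := boolP (P j).
  by apply: nice_ext (niceM (nf _ Pj) IH) => U; rewrite big_cons Pj.
by apply: nice_ext IH => U; rewrite big_cons (negbTE Pj).
Qed.

Lemma nice_det n (A : T -> 'M[C]_n) :
  (forall i j, nice (fun U => A U i j)) -> nice (fun U => \det (A U)).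
Proof.
by move=> nA; apply: nice_sum => s _; apply: niceM; [exact: nice_cst|exact: nice_prod].
Qed.

Lemma nice_mul m n p (A : T -> 'M[C]_(m, n)) (B : T -> 'M[C]_(n, p)) :
  (forall i j, nice (fun U => A U i j)) -> (forall i j, nice (fun U => B U i j)) ->
  forall i j, nice (fun U => (A U *m B U) i j).
Proof.
move=> nA nB i j.
apply: nice_ext (nice_sum (index_enum _) (P := xpredT) (f := fun a U => A U i a * B U a j) _).
  by move=> U; rewrite mxE.
by move=> a _; apply: niceM.
Qed.

Lemma I_sum (J : Type) (s : seq J) (P : pred J) (f : J -> T -> C) :
  (forall j, P j -> nice (f j)) ->
  I (fun U => \sum_(j <- s | P j) f j U) = \sum_(j <- s | P j) I (f j).
Proof.
move=> nf; elim: s => [|j s IH].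
  by rewrite big_nil -[RHS]I_cst; apply: I_ext => U; rewrite big_nil.
rewrite big_cons -IH; have [Pj|Pj] := boolP (P j).
  by rewrite -ID; [apply: I_ext => U; rewrite big_cons Pj|exact: nf|exact: nice_sum].
by apply: I_ext => U; rewrite big_cons (negbTE Pj).
Qed.

Definition pnice (q : T -> {poly C}) := forall m, nice (fun U => (q U)`_m).

Lemma pnice_cst c : pnice (fun=> c).
Proof. by move=> m; exact: nice_cst. Qed.

Lemma pniceC f : nice f -> pnice (fun U => (f U)%:P).
Proof.
move=> nf m; case: m => [|m].
  by apply: nice_ext nf => U; rewrite coefC eqxx.
by apply: nice_ext (nice_cst 0) => U; rewrite coefC.
Qed.

Lemma pniceD p q : pnice p -> pnice q -> pnice (fun U => p U + q U).
Proof.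
by move=> np nq m; apply: nice_ext (niceD (np m) (nq m)) => U; rewrite coefD.
Qed.

Lemma pniceM p q : pnice p -> pnice q -> pnice (fun U => p U * q U).
Proof.
move=> np nq m.
apply: nice_ext (nice_sum (index_enum _) (P := xpredT)
  (f := fun (i : 'I_m.+1) U => (p U)`_i * (q U)`_(m - i)) _).
  by move=> U; rewrite coefM.
by move=> i _; apply: niceM.
Qed.

Lemma pnice_ext p q : p =1 q -> pnice p -> pnice q.
Proof. by move=> pq np m; apply: nice_ext (np m) => U; rewrite pq. Qed.

Lemma pnice_sum (J : Type) (s : seq J) (P : pred J) (f : J -> T -> {poly C}) :
  (forall j, P j -> pnice (f j)) -> pnice (fun U => \sum_(j <- s | P j) f j U).
Proof.
move=> nf m; apply: nice_ext (nice_sum s (fun j Pj => nf j Pj m)) => U.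
by rewrite coef_sum.
Qed.

Lemma pnice_prod (J : Type) (s : seq J) (P : pred J) (f : J -> T -> {poly C}) :
  (forall j, P j -> pnice (f j)) -> pnice (fun U => \prod_(j <- s | P j) f j U).
Proof.
move=> nf; elim: s => [|j s IH].
  by apply: pnice_ext (pnice_cst 1) => U; rewrite big_nil.
have [Pj|Pj] := boolP (P j).
  by apply: pnice_ext (pniceM (nf _ Pj) IH) => U; rewrite big_cons Pj.
by apply: pnice_ext IH => U; rewrite big_cons (negbTE Pj).
Qed.

Local Notation E U := (secpoly (val U)).

Lemma pnice_secpoly : pnice (fun U => E U).
Proof.
apply: pnice_sum => s _; apply: pniceM; first exact: pnice_cst.
apply: pnice_prod => i _.
apply: (@pnice_ext (fun U => (1%:M : 'M[{poly C}]_N) i (s i) + 'X * (val U i (s i))%:P)).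
  by move=> U; rewrite !mxE.
apply: pniceD; first exact: pnice_cst.
by apply: pniceM; [exact: pnice_cst|exact: pniceC].
Qed.

Lemma nice_secpoly_horner t : nice (fun U => (E U).[t]).
Proof.
apply: nice_ext (nice_det (A := fun U => 1%:M + t *: val U) _).
  by move=> U; rewrite secpoly_horner.
move=> i j; apply: (@nice_ext (fun U => (1%:M : 'M[C]_N) i j + t * val U i j)).
  by move=> U; rewrite !mxE.
by apply: niceD; [exact: nice_cst|apply: niceM; [exact: nice_cst|exact: nice_entry]].
Qed.

Lemma nice_chi r M (l : {ffun 'I_r -> 'I_M}) : nice (fun U => chi (E U) l).
Proof.
apply: nice_det => i j.
apply: nice_ext ((pniceM (pnice_cst 'X^j) pnice_secpoly) (l i)) => U.
by rewrite !mxE.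
Qed.

Lemma nice_resol n (u : 'cV[C]_N) (w : 'rV[C]_N) : nice (fun U => (E U).[n.+2%:R] * (w *m resol (val U) n.+2%:R *m u) 0 0).
Proof.
set t := n.+2%:R.
pose A U := (w *m (t *: val U) *m \adj (1%:M + t *: val U) *m u) : 'M[C]_1.
have n1 i j : nice (fun U => (1%:M + t *: val U) i j).
  apply: (@nice_ext (fun U => (1%:M : 'M[C]_N) i j + t * val U i j)); first by move=> U; rewrite !mxE.
  by apply: niceD; [exact: nice_cst|apply: niceM; [exact: nice_cst|exact: nice_entry]].
have nA : nice (fun U => A U 0 0).
  have nc m p (B : 'M[C]_(m, p)) i j : nice (fun=> B i j) by exact: nice_cst.
  rewrite /A; apply: (nice_mul (A := fun U => w *m (t *: val U) *m \adj (1%:M + t *: val U)) (B := fun=> u)) => //.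
  apply: (nice_mul (A := fun U => w *m (t *: val U)) (B := fun U => \adj (1%:M + t *: val U))); last first.
    move=> i j; apply: (@nice_ext (fun U => cofactor (1%:M + t *: val U) j i)).
      by move=> U; rewrite mxE.
    apply: niceM; first exact: nice_cst.
    apply: nice_det => a b; apply: nice_ext (n1 (lift j a) (lift i b)) => U.
    by rewrite !mxE.
  apply: (nice_mul (A := fun=> w) (B := fun U => t *: val U)) => // i j.
  apply: nice_ext (niceM (nice_cst t) (nice_entry i j)) => U.
  by rewrite !mxE.
apply: nice_ext nA => U; rewrite /A /resol.
have Ut := unitary_resol_unit n (val_unitary U).
rewrite /invmx -/t Ut secpoly_horner; set tU := t *: val U; set d := \det _.
have d0 : d != 0 by rewrite -unitfE -unitmxE.
have aux (X Y : 'M[C]_N) c : w *m (X *m (c *: Y)) *m u = c *: (w *m X *m Y *m u).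
  by rewrite -!scalemxAr -scalemxAl !mulmxA.
by rewrite aux [in RHS]mxE mulrA divff // mul1r.
Qed.

Section Rank1.
Variables (r k : nat) (tau : 'I_r -> nat).
Let t i : C := (tau i).+2%:R.
Let f U := ((\det (val U))^*) ^+ k.
Let FF U := \prod_i (E U).[t i].
Let H := I (fun U => f U * FF U).

Lemma nice_detJ : nice f.
Proof.
have nd : nice (fun U => (\det (val U))^*) by apply/niceJ/nice_det => i j; exact: nice_entry.
rewrite /f; elim: (k) => [|k' IH]; first by apply: nice_ext (nice_cst 1) => U; rewrite expr0.
by apply: nice_ext (niceM nd IH) => U; rewrite exprS.
Qed.

(** The mean of [phi] against the weight [f * FF] is [c] times the total
    weight [H].  The weight is complex, hence the unnormalised form. *)
Definition has_mean (c : C) (phi : T -> C) :=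
  nice (fun U => f U * FF U * phi U) /\ I (fun U => f U * FF U * phi U) = c * H.

Lemma has_mean_ext c phi psi : phi =1 psi -> has_mean c phi -> has_mean c psi.
Proof.
move=> e [n i]; split; first by apply: nice_ext n => U; rewrite e.
by rewrite -i; apply: I_ext => U; rewrite e.
Qed.

Lemma has_meanD c d phi psi : has_mean c phi -> has_mean d psi -> has_mean (c + d) (fun U => phi U + psi U).
Proof.
move=> [n i] [n' i']; split.
  by apply: nice_ext (niceD n n') => U; rewrite mulrDr.
by rewrite mulrDl -i -i' -ID //; apply: I_ext => U; rewrite mulrDr.
Qed.

Lemma has_meanZ a c phi : has_mean c phi -> has_mean (a * c) (fun U => a * phi U).
Proof.
move=> [n i]; split.
  by apply: nice_ext (niceM (nice_cst a) n) => U; rewrite mulrCA.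
by rewrite -mulrA -i -IZ //; apply: I_ext => U; rewrite mulrCA.
Qed.

Lemma has_mean_sum (J : Type) (s : seq J) (P : pred J) (c : J -> C) (phi : J -> T -> C) :
  (forall j, P j -> has_mean (c j) (phi j)) ->
  has_mean (\sum_(j <- s | P j) c j) (fun U => \sum_(j <- s | P j) phi j U).
Proof.
move=> g; elim: s => [|j s IH].
  split; first by apply: nice_ext (nice_cst 0) => U; rewrite big_nil mulr0.
  rewrite big_nil mul0r -[RHS](I_cst 0); apply: I_ext => U; by rewrite big_nil mulr0.
rewrite big_cons; have [Pj|Pj] := boolP (P j).
  by apply: has_mean_ext (has_meanD (g _ Pj) IH) => U; rewrite big_cons Pj.
by apply: has_mean_ext IH => U; rewrite big_cons (negbTE Pj).
Qed.

(** Invariance under V = 1 + (z - 1) u w.  As det V = z, the factor [f]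
    contributes conj(z)^k, and each E(t_i) becomes
    E(t_i) (1 + (z - 1) a_i).  So the mean of the product, a polynomial in
    z - 1, equals z^k times its constant term at infinitely many z on the unit
    circle, and its coefficients are those of z^k up to that constant. *)
Lemma rank1_moments (u : 'cV[C]_N) (w : 'rV[C]_N) :
  (w *m u) 0 0 = 1 ->
  (forall n, unitary (1%:M + (cayley C n - 1) *: (u *m w))) ->
  let a U i := (w *m resol (val U) (t i) *m u) 0 0 in
  has_mean k%:R (fun U => \sum_i a U i) /\
  has_mean (2%:R * 'C(k, 2)%:R) (fun U => \sum_(i < r) \sum_(j < r | j != i) a U i * a U j).
Proof.
move=> wu uV a.
have Ut U i : 1%:M + t i *: val U \in unitmx := unitary_resol_unit _ (val_unitary U).
have E0 U i : (E U).[t i] != 0 by rewrite secpoly_horner -unitfE -unitmxE.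
pose q U := \prod_i (((E U).[t i])%:P + ((E U).[t i] * a U i)%:P * 'X).
have nq : pnice q.
  apply: pnice_prod => i _; apply: pniceD; first exact/pniceC/nice_secpoly_horner.
  by apply: pniceM; [exact/pniceC/nice_resol|exact: pnice_cst].
have qE U : q U = (FF U)%:P * \prod_i (1 + a U i *: 'X).
  rewrite /FF rmorph_prod -big_split; apply: eq_bigr => i _ /=.
  by rewrite -[a U i *: 'X]mul_polyC mulrDr mulr1 polyCM mulrA.
have qc U : [/\ (q U)`_0 = FF U, (q U)`_1 = FF U * \sum_i a U i &
     2%:R * (q U)`_2 = FF U * \sum_(i < r) \sum_(j < r | j != i) a U i * a U j].
  have [q0 q1 q2] := coef_prod_lin (a U).
  by rewrite qE !coefCM q0 q1 mulr1 mulrCA q2.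
have szq U : (size (q U) <= r.+3)%N.
  apply: leq_trans (size_poly_prod_leq _ _) _; rewrite leq_subLR.
  have le2 : forall i : 'I_r, true -> (size (((E U).[t i])%:P + ((E U).[t i] * a U i)%:P * 'X)%R <= 2)%N.
    by move=> i _; rewrite addrC size_MXaddC; case: ifP => // _; rewrite ltnS size_polyC leq_b1.
  have := leq_sum (index_enum _) le2; rewrite sum_nat_const card_ord => le.
  apply: (leq_trans (n := (r * 2).+1)); first by rewrite ltnS.
  by lia.
pose b (m : 'I_r.+3) := I (fun U => f U * (q U)`_m).
have nb m : nice (fun U => f U * (q U)`_m) by apply: niceM => //; exact: nice_detJ.
have [|b1 b2] := @unit_circle_coefs C r k b.
  move=> n; set z := cayley C n.
  pose F0 (A : 'M[C]_N) := ((\det A)^*) ^+ k * \prod_i (secpoly A).[t i].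
  have nF0 : nice (fun U => F0 (val U)).
    by apply: niceM; [exact: nice_detJ|apply: nice_prod => i _; exact: nice_secpoly_horner].
  pose V := 1%:M + (z - 1) *: (u *m w).
  pose S U := \sum_(m < r.+3) (z - 1) ^+ m * (f U * (q U)`_m).
  have nS : nice S by apply: nice_sum => m _; apply: niceM.
  have detV : \det V = z.
    by rewrite /V scalemxAl det_rank1 -scalemxAr mxE wu mulr1 subrKC.
  have pt U : F0 (V *m val U) = z^* ^+ k * S U.
    rewrite /F0 det_mulmx rmorphM /= detV exprMn -mulrA; congr (_ * _).
    rewrite /S; transitivity (f U * (q U).[z - 1]).
      congr (_ * _); rewrite /q horner_prod; apply: eq_bigr => i _.
      by rewrite det_rank1_pert // hornerD hornerM !hornerC hornerX -/(a U i); ring.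
    rewrite (horner_coef_wide _ (szq U)) mulr_sumr; apply: eq_bigr => m _.
    by rewrite [RHS]mulrC mulrA.
  have H0 : b ord0 = I (fun U => F0 (val U)).
    by apply: I_ext => U; have [-> _ _] := qc U.
  have := I_inv (uV n) nF0; rewrite -/z -/V -H0 (I_ext pt) IZ // => <-.
  rewrite mulrA -exprMn [z * _]mulrC cayley_conj expr1n mul1r I_sum.
    by apply: eq_bigr => m _; rewrite -IZ.
  by move=> m _; apply: niceM.
split; split.
- by apply: nice_ext (nb (inord 1)) => U; have [_ + _] := qc U; rewrite inordK // -mulrA => ->.
- have -> : H = b ord0 by apply: I_ext => U; have [-> _ _] := qc U.
  rewrite -b1; apply: I_ext => U; have [_ + _] := qc U; by rewrite inordK // -mulrA => ->.
- apply: nice_ext (niceM (nice_cst 2%:R) (nb (inord 2))) => U; have [_ _ +] := qc U.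
  by rewrite inordK // mulrCA -mulrA => ->.
- have -> : H = b ord0 by apply: I_ext => U; have [-> _ _] := qc U.
  rewrite -mulrA -b2 -IZ //; apply: I_ext => U; have [_ _ +] := qc U.
  by rewrite inordK // mulrCA -mulrA => ->.
Qed.

Lemma delta_entry (G : 'M[C]_N) a c :
  ((delta_mx 0 a : 'rV_N) *m G *m (delta_mx c 0 : 'cV_N)) 0 0 = G a c.
Proof. by rewrite -rowE -colE !mxE. Qed.

(** The matrix [u *m w] is the orthogonal projection onto the line of [u], and
    the perturbed matrix multiplies this line by z, of modulus 1. *)
Lemma unitary_rank1 (u : 'cV[C]_N) (s : C) (w : 'rV[C]_N) n : s^* = s ->
  w = s *: map_mx Num.conj u^T -> (w *m u) 0 0 = 1 ->
  unitary (1%:M + (cayley C n - 1) *: (u *m w)).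
Proof.
move=> sr we wu; set z := cayley C n.
have P2 : (u *m w) *m (u *m w) = u *m w.
  rewrite -mulmxA [w *m _]mulmxA [w *m u]mx11_scalar wu mul1mx //.
have Padj : adjm (u *m w) = u *m w.
  apply/matrixP => i j; rewrite we !mxE rmorph_sum; apply: eq_bigr => a _.
  by rewrite !mxE !rmorphM /= conjCK sr mulrCA [RHS]mulrCA; congr (_ * _); exact: mulrC.
have zz : z * z^* = 1 by rewrite mulrC cayley_conj.
rewrite /unitary.
have -> : adjm (1%:M + (z - 1) *: (u *m w)) = 1%:M + (z^* - 1) *: (u *m w).
  rewrite -[in RHS]Padj; apply/matrixP => i j.
  by rewrite /adjm !mxE rmorphD rmorphM rmorphB rmorph1 /= rmorph_nat eq_sym.
rewrite mulmxDl mul1mx mulmxDr mulmx1 -scalemxAl -scalemxAr P2 -addrA -scalerDr.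
have e : (z^* - 1) + (z - 1) + (z - 1) * (z^* - 1) = 0.
  transitivity (z * z^* - 1); first by ring.
  by rewrite zz subrr.
rewrite -[RHS]addr0; congr (_ + _).
by rewrite scalerDr scalerA addrA -!scalerDl e scale0r.
Qed.

(** The vectors e_a + omega e_c with omega^4 = 1 are enough to recover the
    mixed terms below by polarisation. *)
Definition fourth_roots : seq C := [:: 1; -1; 'i; - 'i].
Definition pair_mean : C := 2%:R * 'C(k, 2)%:R.
Definition tr2_mean : C := \sum_(a < N) 2%:R * pair_mean +
  \sum_(a < N) \sum_(c < N | c != a) 2%:R^-1 * (\sum_(om <- fourth_roots) pair_mean + (-1) * pair_mean + (-1) * pair_mean).

Let G U i := resol (val U) (t i).

Lemma has_mean_entry a : has_mean k%:R (fun U => \sum_i G U i a a) /\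
  has_mean pair_mean (fun U => \sum_(i < r) \sum_(j < r | j != i) G U i a a * G U j a a).
Proof.
have [|n|g1 g2] := @rank1_moments (delta_mx a 0) (delta_mx 0 a).
- by rewrite mul_delta_mx mxE !eqxx.
- apply: (@unitary_rank1 _ 1); rewrite ?rmorph1 //.
    by apply/matrixP => i j; rewrite !mxE mul1r rmorph_nat andbC.
  by rewrite mul_delta_mx mxE !eqxx.
- split; [apply: has_mean_ext g1 => U|apply: has_mean_ext g2 => U].
    by apply: eq_bigr => i _; rewrite delta_entry.
  by apply: eq_bigr => i _; apply: eq_bigr => j _; rewrite !delta_entry.
Qed.

Let A U a c om i := 2%:R^-1 * (G U i a a + om * G U i a c + om^* * G U i c a + G U i c c).

Lemma has_mean_pair a c om : a != c -> om \in fourth_roots ->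
  has_mean pair_mean (fun U => \sum_(i < r) \sum_(j < r | j != i) A U a c om i * A U a c om j).
Proof.
move=> ac omw.
have om1 : om * om^* = 1.
  move: omw; rewrite !inE => /or4P[] /eqP ->.
  - by rewrite rmorph1 mulr1.
  - by rewrite rmorphN rmorph1 mulrNN mulr1.
  - by rewrite conjCi mulrN -expr2 sqrCi opprK.
  - by rewrite rmorphN /= conjCi opprK mulNr -expr2 sqrCi opprK.
pose u : 'cV[C]_N := delta_mx a 0 + om *: delta_mx c 0.
pose w : 'rV[C]_N := 2%:R^-1 *: (delta_mx 0 a + om^* *: delta_mx 0 c).
have entry (B : 'M[C]_N) : (w *m B *m u) 0 0 =
    2%:R^-1 * (B a a + om * B a c + om^* * B c a + B c c).
  rewrite /w /u -!scalemxAl mxE; congr (_ * _).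
  rewrite !(mulmxDl, mulmxDr) -!(scalemxAl, scalemxAr).
  have aux (p q s : C) (X Y Z W : 'M[C]_1) : (X + q *: Z + (p *: Y + q *: (s *: W))) 0 0 =
    X 0 0 + p * Y 0 0 + q * Z 0 0 + s * q * W 0 0 by rewrite !mxE; ring.
  by rewrite aux !delta_entry om1 mul1r.
have wu : (w *m u) 0 0 = 1.
  rewrite -[w]mulmx1 entry !mxE !eqxx (negbTE ac) eq_sym (negbTE ac) !mulr0 !addr0.
  by rewrite -mulr2n mulVf // pnatr_eq0.
have [//|n|_ g2] := @rank1_moments u w.
  apply: (@unitary_rank1 _ 2%:R^-1) => //; first by rewrite fmorphV rmorph_nat.
  congr (_ *: _); apply/matrixP => i j; rewrite !mxE rmorphD rmorphM /= !rmorph_nat.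
  by congr (_%:R + _ * _%:R); rewrite andbC.
by apply: has_mean_ext g2 => U; apply: eq_bigr => i _; apply: eq_bigr => j _; rewrite !entry.
Qed.

(** The average over the fourth roots of unity keeps the monomials invariant
    under the rotation of omega; the term (x - y)(x' - y') disappears because
    1 + 'i^2 = 0. *)
Lemma polarize (S S' x y x' y' : C) :
  \sum_(om <- fourth_roots) (2%:R^-1 * (S + om * x + om^* * y)) * (2%:R^-1 * (S' + om * x' + om^* * y')) =
  S * S' + x * y' + y * x'.
Proof.
rewrite /fourth_roots !big_cons big_nil !rmorphN /= !rmorph1 !conjCi !opprK addr0.
have I2 : 'i * 'i = -1 :> C by rewrite -expr2 sqrCi.
set j := 'i in I2 *.
transitivity (S * S' + x * y' + y * x' + 2%:R^-1 * (1 + j * j) * (x - y) * (x' - y')).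
  by field.
by rewrite I2 subrr mulr0 !mul0r addr0.
Qed.

(** The traces on the left, written in terms of the diagonal entries and of
    the polarised expressions of [polarize], whose means are known. *)
Lemma tr_pair (X Y : 'M[C]_N) : \tr X * \tr Y + \tr (X *m Y) =
  \sum_a 2%:R * (X a a * Y a a) + \sum_(a < N) \sum_(c < N | c != a) 2%:R^-1 *
     ((X a a + X c c) * (Y a a + Y c c) + X a c * Y c a + X c a * Y a c
      + (-1) * (X a a * Y a a) + (-1) * (X c c * Y c c)).
Proof.
have -> : \tr X * \tr Y + \tr (X *m Y) =
    \sum_a 2%:R * (X a a * Y a a) + \sum_(a < N) \sum_(c < N | c != a) (X a a * Y c c + X a c * Y c a).
  rewrite mulr_suml -!big_split /=; apply: eq_bigr => a _.
  rewrite mxE mulr_sumr -big_split (bigD1 a) //=; congr (_ + _); ring.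
congr (_ + _).
have sw (F : 'I_N -> 'I_N -> C) : \sum_(a < N) \sum_(c < N | c != a) F a c =
    \sum_(a < N) \sum_(c < N | c != a) F c a.
  rewrite (exchange_big_dep xpredT) //=; apply: eq_bigr => a _; apply: eq_bigl => c.
  by rewrite eq_sym.
apply: (mulfI (x := 2%:R)); first by rewrite pnatr_eq0.
rewrite mulr_natl mulr2n [X in _ + X]sw -big_split mulr_sumr /=; apply: eq_bigr => a _.
rewrite -big_split mulr_sumr /=; apply: eq_bigr => c _.
by field.
Qed.

Lemma has_mean_tr1 : has_mean (k%:R * N%:R) (fun U => \sum_i \tr (G U i)).
Proof.
have -> : k%:R * N%:R = \sum_(a < N) (k%:R : C) by rewrite sumr_const card_ord mulr_natr.
have g : has_mean (\sum_(a < N) k%:R) (fun U => \sum_a \sum_i G U i a a).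
  by apply: has_mean_sum => a _; exact: (has_mean_entry a).1.
by apply: has_mean_ext g => U; rewrite exchange_big.
Qed.

Lemma has_mean_tr2 : has_mean tr2_mean (fun U => \sum_(i < r) \sum_(j < r | j != i)
  (\tr (G U i) * \tr (G U j) + \tr (G U i *m G U j))).
Proof.
pose Q (phi : 'I_r -> C) := \sum_(i < r) \sum_(j < r | j != i) phi i * phi j.
have g1 : has_mean (\sum_(a < N) 2%:R * pair_mean) (fun U => \sum_a 2%:R * Q (fun i => G U i a a)).
  by apply: has_mean_sum => a _; apply: has_meanZ; exact: (has_mean_entry a).2.
have g2 : has_mean (\sum_(a < N) \sum_(c < N | c != a) 2%:R^-1 * (\sum_(om <- fourth_roots) pair_mean + (-1) * pair_mean + (-1) * pair_mean))
   (fun U => \sum_(a < N) \sum_(c < N | c != a)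
     2%:R^-1 * (\sum_(om <- fourth_roots) Q (A U a c om) + (-1) * Q (fun i => G U i a a) + (-1) * Q (fun i => G U i c c))).
  apply: has_mean_sum => a _; apply: has_mean_sum => c ca; apply: has_meanZ.
  apply: has_meanD; last by apply: has_meanZ; exact: (has_mean_entry c).2.
  apply: has_meanD; last by apply: has_meanZ; exact: (has_mean_entry a).2.
  rewrite big_seq; apply: (@has_mean_ext _ (fun U => \sum_(om <- fourth_roots | om \in fourth_roots) Q (A U a c om))).
    by move=> U; rewrite [RHS]big_seq.
  by apply: has_mean_sum => om omw; apply: has_mean_pair; rewrite // eq_sym.
apply: has_mean_ext (has_meanD g1 g2) => U.
pose P2 (F : 'I_r -> 'I_r -> C) := \sum_(i < r) \sum_(j < r | j != i) F i j.
have P2Z c F : P2 (fun i j => c * F i j) = c * P2 F.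
  by rewrite mulr_sumr; apply: eq_bigr => i _; rewrite mulr_sumr.
have P2D F F' : P2 (fun i j => F i j + F' i j) = P2 F + P2 F'.
  by rewrite -big_split; apply: eq_bigr => i _; rewrite -big_split.
have P2S (J : Type) (s : seq J) (P : pred J) (F : J -> 'I_r -> 'I_r -> C) :
    P2 (fun i j => \sum_(a <- s | P a) F a i j) = \sum_(a <- s | P a) P2 (F a).
  by rewrite exchange_big; apply: eq_bigr => i _; rewrite exchange_big.
symmetry; transitivity (P2 (fun i j => \sum_a 2%:R * (G U i a a * G U j a a) +
  \sum_(a < N) \sum_(c < N | c != a) 2%:R^-1 * (\sum_(om <- fourth_roots) A U a c om i * A U a c om j
   + (-1) * (G U i a a * G U j a a) + (-1) * (G U i c c * G U j c c)))).
  apply: eq_bigr => i _; apply: eq_bigr => j _; rewrite tr_pair; congr (_ + _).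
  apply: eq_bigr => a _; apply: eq_bigr => c _; rewrite -polarize.
  congr (_ * (_ + _ + _)); apply: eq_bigr => om _; rewrite /A.
  by congr (_ * _ * (_ * _)); ring.
rewrite P2D !P2S; congr (_ + _).
  by apply: eq_bigr => a _; rewrite P2Z.
apply: eq_bigr => a _; rewrite P2S; apply: eq_bigr => c _.
by rewrite P2Z !P2D P2S !P2Z.
Qed.

Definition chi_int (l : {ffun 'I_r -> 'I_(N + r)}) : C := I (fun U => f U * chi (E U) l).

Lemma I_eulermx (S : pred 'I_r) :
  nice (fun U => f U * \det (eulermx (E U) t S)) /\
  I (fun U => f U * \det (eulermx (E U) t S)) =
  \sum_(l : {ffun 'I_r -> 'I_(N + r)})
     (\prod_i ((if S i then (l i)%:R else 1) * t i ^+ l i)) * chi_int l.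
Proof.
pose F (l : {ffun 'I_r -> 'I_(N + r)}) U :=
  (\prod_i ((if S i then (l i)%:R else 1) * t i ^+ l i)) * (f U * chi (E U) l).
have nc (l : {ffun 'I_r -> 'I_(N + r)}) : nice (fun U => f U * chi (E U) l).
  by apply: niceM; [exact: nice_detJ|exact: nice_chi].
have nF l : nice (F l) by apply: niceM => //; exact: nice_cst.
have e U : \sum_l F l U = f U * \det (eulermx (E U) t S).
  rewrite (det_eulermx t (secpoly_size (val U)) (leqnn _)) mulr_sumr.
  by apply: eq_bigr => l _; rewrite /F mulrCA.
split; first by apply: nice_ext e _; apply: nice_sum.
rewrite -(I_ext e) I_sum //; apply: eq_bigr => l _.
by rewrite /F IZ.
Qed.

Hypothesis tauI : injective tau.

Let tI : injective t.
Proof. by move=> i j /eqP; rewrite /t eqr_nat => /eqP [] /tauI. Qed.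

Let E0 U i : (E U).[t i] != 0.
Proof. by rewrite secpoly_horner -unitfE -unitmxE; exact: unitary_resol_unit. Qed.

Let Lam : C := \sum_(i < r) \sum_(j < r | (i < j)%N) 1.

Let has_mean0 c phi : has_mean c phi ->
  I (fun U => f U * (FF U * vdm t * phi U)) = vdm t * (c * H).
Proof.
move=> [n i]; rewrite -i -IZ //; apply: I_ext => U; ring.
Qed.

(** The mean of the product of the E(t_i) as a generating function, in the
    variables [t], of the means of the minors. *)
Lemma vdm_int : vdm t * H = \sum_(l : {ffun 'I_r -> 'I_(N + r)}) (\prod_i t i ^+ l i) * chi_int l.
Proof.
have [n e] := I_eulermx pred0.
have -> : vdm t * H = I (fun U => f U * \det (eulermx (E U) t pred0)).
  rewrite /H -IZ; last first.
    by apply: niceM; [exact: nice_detJ|apply: nice_prod => i _; exact: nice_secpoly_horner].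
  apply: I_ext => U; rewrite (det_eulermx0 (E0 U)) -/(FF U); ring.
rewrite e; apply: eq_bigr => l _; congr (_ * _); apply: eq_bigr => i _; by rewrite mul1r.
Qed.

(** Applying the sum of the Euler operators to [vdm_int]: on the side of the
    means this is multiplication by a scalar because t E'/E = tr R. *)
Lemma vdm_int_sum : \sum_(l : {ffun 'I_r -> 'I_(N + r)}) (\sum_i l i)%:R * ((\prod_i t i ^+ l i) * chi_int l)
  = (Lam + k%:R * N%:R) * (vdm t * H).
Proof.
transitivity (\sum_i I (fun U => f U * \det (eulermx (E U) t (pred1 i)))).
  rewrite (eq_bigr _ (fun i _ => (I_eulermx (pred1 i)).2)) exchange_big /=.
  apply: eq_bigr => l _; rewrite natr_sum mulr_suml; apply: eq_bigr => i _.
  rewrite mulrA; congr (_ * _); rewrite big_split; congr (_ * _).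
  by rewrite (bigD1 i) //= eqxx big1 ?mulr1 // => j /negbTE ->.
rewrite -I_sum; last by move=> i _; exact: (I_eulermx _).1.
have g : has_mean (Lam + k%:R * N%:R) (fun U => Lam + \sum_i \tr (G U i)).
  apply: has_meanD has_mean_tr1; split.
    apply: nice_ext (niceM (nice_cst Lam) (niceM nice_detJ (nice_prod (index_enum _) (P := xpredT) (fun i _ => nice_secpoly_horner (t i))))) => U.
    by rewrite mulrC.
  rewrite /H -IZ; last by apply: niceM; [exact: nice_detJ|apply: nice_prod => i _; exact: nice_secpoly_horner].
  by apply: I_ext => U; rewrite mulrC.
rewrite [RHS]mulrCA -(has_mean0 g); apply: I_ext => U; rewrite -mulr_sumr; congr (_ * _).
rewrite (eq_bigr _ (fun i _ => det_eulermx1 tI (E0 U) i)) -mulr_sumr; congr (_ * _).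
rewrite big_split (sum_vdm_logderiv tI); congr (_ + _); apply: eq_bigr => i _.
by rewrite secpoly_euler ?unitary_resol_unit // mulrAC divff // mul1r.
Qed.

Definition pair_eigenvalue : C := sum_pair_ord C r + (2%:R * (\sum_(i < r) \sum_(j < r | (i < j)%N) 1) - 2%:R * (r%:R - 1)) * (k%:R * N%:R) + tr2_mean.

(** The second order analogue of [vdm_int_sum].  The resolvent identity turns
    the differences in [sum_det_eulermx2] into the traces tr R_i R_j that
    [has_mean_tr2] controls. *)
Lemma vdm_int_pairs : \sum_(l : {ffun 'I_r -> 'I_(N + r)})
   (\sum_(i < r) \sum_(j < r | j != i) l i * l j)%:R * ((\prod_i t i ^+ l i) * chi_int l)
  = pair_eigenvalue * (vdm t * H).
Proof.
transitivity (\sum_(i < r) \sum_(j < r | j != i) I (fun U => f U * \det (eulermx (E U) t (pred2 i j)))).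
  transitivity (\sum_(i < r) \sum_(j < r | j != i) \sum_(l : {ffun 'I_r -> 'I_(N + r)})
     (l i * l j)%:R * ((\prod_i t i ^+ l i) * chi_int l)); last first.
    apply: eq_bigr => i _; apply: eq_bigr => j ji; rewrite (I_eulermx _).2.
    apply: eq_bigr => l _; rewrite mulrA; congr (_ * _); rewrite big_split; congr (_ * _).
    rewrite (bigD1 i) //= eqxx (bigD1 j) //= eqxx orbT natrM big1 ?mulr1 //.
    by move=> m /andP[/negbTE -> /negbTE ->].
  under [RHS]eq_bigr do rewrite exchange_big /=.
  rewrite [RHS]exchange_big /=; apply: eq_bigr => l _.
  rewrite natr_sum mulr_suml; apply: eq_bigr => i _; rewrite natr_sum mulr_suml.
  by [].
have nn i j : nice (fun U => f U * \det (eulermx (E U) t (pred2 i j))) by exact: (I_eulermx _).1.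
have -> : \sum_(i < r) \sum_(j < r | j != i) I (fun U => f U * \det (eulermx (E U) t (pred2 i j))) =
   I (fun U => \sum_(i < r) \sum_(j < r | j != i) f U * \det (eulermx (E U) t (pred2 i j))).
  rewrite I_sum; last by move=> i _; apply: nice_sum.
  by apply: eq_bigr => i _; rewrite I_sum.
have nH : nice (fun U => f U * FF U).
  by apply: niceM; [exact: nice_detJ|apply: nice_prod => i _; exact: nice_secpoly_horner].
have g : has_mean pair_eigenvalue (fun U => sum_pair_ord C r + (2%:R * Lam - 2%:R * (r%:R - 1)) * (\sum_i \tr (G U i)) +
   \sum_(i < r) \sum_(j < r | j != i) (\tr (G U i) * \tr (G U j) + \tr (G U i *m G U j))).
  apply: has_meanD has_mean_tr2; apply: has_meanD; last exact/has_meanZ/has_mean_tr1.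
  split; first by apply: nice_ext (niceM nH (nice_cst (sum_pair_ord C r))) => U.
  by rewrite /H -IZ //; apply: I_ext => U; rewrite mulrC.
rewrite [RHS]mulrCA -(has_mean0 g); apply: I_ext => U.
transitivity (f U * \sum_(i < r) \sum_(j < r | j != i) \det (eulermx (E U) t (pred2 i j))).
  by rewrite mulr_sumr; apply: eq_bigr => i _; rewrite mulr_sumr.
congr (_ * _); rewrite (sum_det_eulermx2 tI (E0 U)) -/(FF U); congr (_ * _).
have gE i : (euler (E U)).[t i] / (E U).[t i] = \tr (G U i).
  by rewrite secpoly_euler ?unitary_resol_unit // mulrAC divff // mul1r.
congr (_ + _ * _ + _); first by apply: eq_bigr => i _; rewrite gE.
apply: eq_bigr => i _; apply: eq_bigr => j ji; rewrite !gE; congr (_ + _).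
by rewrite /G resol_mul_trace ?unitary_resol_unit // (inj_eq tI) eq_sym.
Qed.

End Rank1.

Section Characters.
Variable (k : nat).
Let f U := ((\det (val U))^*) ^+ k.

Let f_det U : f U * \det (val U) ^+ k = 1.
Proof. by rewrite /f -exprMn unitary_det // expr1n. Qed.

Lemma kronecker_pt_tau r M n (i : 'I_r) : (1 < M)%N -> kronecker_pt C M n i = ((n.+2 ^ (M ^ i) - 2).+2)%:R.
Proof.
move=> M1; rewrite /kronecker_pt -natrX; congr (_%:R); rewrite -[RHS]addn2 subnK //.
by rewrite -{1}[n.+2]expn1 (leq_trans (_ : 2 <= n.+2 ^ 1)%N) // leq_exp2l // expn_gt0 ltnW.
Qed.

Lemma tau_inj r M n : (1 < M)%N -> injective (fun i : 'I_r => (n.+2 ^ (M ^ i) - 2)%N).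
Proof.
move=> M1 i j e; apply: (@expn_ord_inj C r M n M1) => /=.
by rewrite -!/(kronecker_pt C M n _) !kronecker_pt_tau // e.
Qed.

Let ch (l : {ffun 'I_(k + k) -> 'I_(N + (k + k))}) : C := chi_int k l.

Lemma chi_int_gapseq : ch (gapseq k N) = 1.
Proof.
rewrite /ch /chi_int -[RHS]I_cst; apply: I_ext => U.
by rewrite chi_gapseq ?secpoly_size ?secpoly0 // secpolyN; exact: f_det.
Qed.

Lemma chi_int_perm (l : {ffun 'I_(k + k) -> 'I_(N + (k + k))}) (s : 'S_(k + k)) : ch [ffun i => l (s i)] = (-1) ^+ s * ch l.
Proof.
rewrite /ch /chi_int -IZ; last by apply: niceM; [exact: nice_detJ|exact: nice_chi].
by apply: I_ext => U; rewrite chi_perm mulrCA.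
Qed.

Lemma chi_int_ninj (l : {ffun 'I_(k + k) -> 'I_(N + (k + k))}) : ~~ injectiveb l -> ch l = 0.
Proof.
by move=> ln; rewrite /ch /chi_int -[RHS]I_cst; apply: I_ext => U; rewrite chi_ninj // mulr0.
Qed.

Hypothesis M1 : (1 < N + k)%N.

(** By Kronecker substitution, [vdm_int_sum] and [vdm_int_pairs] hold
    coefficient by coefficient: wherever the mean is nonzero, the two
    statistics of [l] are the fixed eigenvalues, which are read off at the gap
    sequence. *)
Lemma chi_intE (l : {ffun 'I_(k + k) -> 'I_(N + (k + k))}) : ch l = \sum_(s : 'S_(k + k)) (-1) ^+ s * (l == [ffun i => gapseq k N (s i)])%:R.
Proof.
have M2 : (1 < N + (k + k))%N by rewrite addnA (leq_trans M1) ?leq_addr.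
have eigen (w : {ffun 'I_(k + k) -> 'I_(N + (k + k))} -> nat) (kap : C) :
    (forall n, let t i := (n.+2 ^ ((N + (k + k)) ^ i) - 2).+2%:R : C in
      \sum_(l : {ffun 'I_(k + k) -> 'I_(N + (k + k))}) (w l)%:R * ((\prod_(i < k + k) t i ^+ l i) * ch l) =
      kap * \sum_(l : {ffun 'I_(k + k) -> 'I_(N + (k + k))}) (\prod_(i < k + k) t i ^+ l i) * ch l) ->
    forall l, ch l != 0 -> w l = w (gapseq k N).
  move=> h l' l0.
  have key l'' : ((w l'')%:R - kap) * ch l'' = 0.
    apply: (@kronecker_substitution C _ _ (fun l => ((w l)%:R - kap) * ch l)) => n.
    have /eqP := h n; rewrite -subr_eq0 mulr_sumr -sumrB /= => /eqP e; rewrite -[RHS]e.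
    apply: eq_bigr => l2 _.
    rewrite (eq_bigr (fun i : 'I_(k + k) => (n.+2 ^ ((N + (k + k)) ^ i) - 2).+2%:R ^+ l2 i)).
      by rewrite -mulrBl -!mulrA; congr (_ * _); exact: mulrC.
    by move=> i _; rewrite -kronecker_pt_tau.
  have := key l'; have := key (gapseq k N); rewrite chi_int_gapseq mulr1 => /eqP.
  rewrite subr_eq0 => /eqP <- /eqP; rewrite mulf_eq0 (negbTE l0) orbF subr_eq0 eqr_nat.
  by move/eqP.

have e1 l' : ch l' != 0 -> (\sum_i l' i = \sum_i gapseq k N i)%N.
  move: l'; apply: (eigen (fun l => \sum_i l i)%N) => n t.
  have tI := tau_inj (r := k + k) (n := n) M2.
  by rewrite [LHS](vdm_int_sum k tI) vdm_int.
have e2 l' : ch l' != 0 -> (\sum_(i < k + k) \sum_(j < k + k | j != i) l' i * l' j =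
    \sum_(i < k + k) \sum_(j < k + k | j != i) gapseq k N i * gapseq k N j)%N.
  move: l'; apply: (eigen (fun l => \sum_(i < k + k) \sum_(j < k + k | j != i) l i * l j)%N) => n t.
  have tI := tau_inj (r := k + k) (n := n) M2.
  by rewrite [LHS](vdm_int_pairs k tI) vdm_int.
have [/existsP[s /eqP ls]|nl] := boolP [exists s : 'S_(k + k), l == [ffun i => gapseq k N (s i)]].
  rewrite ls chi_int_perm chi_int_gapseq mulr1 (bigD1 s) //= eqxx mulr1 big1 ?addr0 // => s' s's.
  case: eqP => [/ffunP e|]; last by rewrite mulr0.
  case/eqP: s's; apply/permP => i; have := e i; rewrite ffunE [RHS]ffunE => /(@gapseq_inj k N) ->//.
rewrite big1; last first.
  move=> s _; case: eqP => [e|]; last by rewrite mulr0.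
  by case/negP: nl; apply/existsP; exists s; apply/eqP.
apply/eqP; apply: contraNT nl => l0.
have lI : injective l by apply/injectiveP; apply: contraNT l0 => /chi_int_ninj ->.
have [s ls] := gapseq_extremal lI (e1 _ l0) (e2 _ l0).
by apply/existsP; exists s; apply/eqP.
Qed.

(** Inserting [chi_intE] in [vdm_int] at 2k points evaluates the mean of the
    product of the E(t_i) as the determinant of the t_i^(gapseq c) divided by
    the Vandermonde product.  Splitting the points into x and y, the Bezoutian
    factorisation cancels the factors y_j - x_i, and both sides become
    polynomials in x and y whose coefficients can be compared. *)
Lemma int_chi_chi (l p : {ffun 'I_k -> 'I_(N + k)}) :
  I (fun U => f U * (chi (E U) l * chi (E U) p)) =
  pair_sign C k * \sum_(s : 'S_k) (-1) ^+ s * (p == [ffun i => rev_ord (l (s i))])%:R.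
Proof.
move: l p; apply: kronecker_substitution2 => n x y.
pose tau (i : 'I_(k + k)) := (n.+2 ^ ((N + k) ^ i) - 2)%N.
pose t i : C := (tau i).+2%:R.
have tauI : injective tau by exact: tau_inj.
have tI : injective t by move=> i j /eqP; rewrite /t eqr_nat => /eqP [] /tauI.
have xE i : x i = t (lshift k i) by rewrite /x kronecker_pt_tau.
have yE i : y i = t (rshift k i) by rewrite /y kronecker_pt_tau.
have tE : glue x y =1 t.
  by move=> i; rewrite -(splitK i); case: (fintype.split i) => j /=; rewrite ?glue_l ?glue_r.
have xI : injective x by move=> i j; rewrite !xE => /tI /lshift_inj.
pose H := I (fun U => f U * \prod_i (E U).[t i]).
have vH : vdm t * H = \det (\matrix_(i, c < k + k) t i ^+ gapseq k N c).
  rewrite (vdm_int k tau) /determinant.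
  under eq_bigr do rewrite -/(ch _) chi_intE mulr_sumr.
  rewrite exchange_big /=; apply: eq_bigr => s _.
  rewrite (bigD1 [ffun i => gapseq k N (s i)]) //= eqxx mulr1 [X in _ + X]big1 ?addr0.
    by rewrite mulrC; congr (_ * _); apply: eq_bigr => i _; rewrite mxE ffunE.
  by move=> l /negbTE ->; rewrite !mulr0.
pose P := \prod_(i < k) \prod_(j < k) (y j - x i).
have P0 : P != 0.
  apply/prodf_neq0 => i _; apply/prodf_neq0 => j _; rewrite subr_eq0 xE yE (inj_eq tI).
  by rewrite eq_sym eq_lrshift.
have vxy : vdm x * vdm y * H = pair_sign C k * \det (bezout_mx x y (N + k)).
  apply: (mulfI P0).
  transitivity (vdm t * H).
    have -> : vdm t = vdm (glue x y).
      by congr (\det _); apply/matrixP => i j; rewrite !mxE tE.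
    by rewrite vdm_glue -/P; ring.
  rewrite vH [RHS]mulrCA mulrA -det_gapseq_bezout //; congr (\det _).
  by apply/matrixP => i j; rewrite !mxE tE.
transitivity (vdm x * vdm y * H).
  have nfc (l p : {ffun 'I_k -> 'I_(N + k)}) : nice (fun U => f U * (chi (E U) l * chi (E U) p)).
    by apply: niceM; [exact: nice_detJ|apply: niceM; exact: nice_chi].
  have nlp (l p : {ffun 'I_k -> 'I_(N + k)}) : nice (fun U => ((\prod_i x i ^+ l i) * \prod_i y i ^+ p i) * (f U * (chi (E U) l * chi (E U) p))).
    by apply: niceM => //; exact: nice_cst.
  transitivity (I (fun U => \sum_(l : {ffun 'I_k -> 'I_(N + k)}) \sum_(p : {ffun 'I_k -> 'I_(N + k)})
     ((\prod_i x i ^+ l i) * \prod_i y i ^+ p i) * (f U * (chi (E U) l * chi (E U) p)))).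
    rewrite I_sum; last by move=> l _; apply: nice_sum.
    apply: eq_bigr => l _; rewrite I_sum //; apply: eq_bigr => p _.
    by rewrite IZ // mulrC.
  rewrite /H -IZ; last first.
    by apply: niceM; [exact: nice_detJ|apply: nice_prod => i _; exact: nice_secpoly_horner].
  apply: I_ext => U.
  have expand (z : 'I_k -> C) : (forall i, (E U).[z i] != 0) ->
      vdm z * \prod_i (E U).[z i] = \sum_(l : {ffun 'I_k -> 'I_(N + k)}) (\prod_i z i ^+ l i) * chi (E U) l.
    move=> z0; rewrite mulrC -det_eulermx0 // (det_eulermx z (secpoly_size (val U)) (leqnn _)).
    by apply: eq_bigr => l _; congr (_ * _); apply: eq_bigr => i _; rewrite mul1r.
  have E0 i : (E U).[t i] != 0.
    by rewrite secpoly_horner -unitfE -unitmxE; exact: unitary_resol_unit.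
  rewrite big_split_ord /=.
  rewrite (eq_bigr (fun i => (E U).[x i])); last by move=> i _; rewrite xE.
  rewrite [X in _ * (_ * (_ * X))](eq_bigr (fun i => (E U).[y i])); last by move=> i _; rewrite yE.
  transitivity (f U * ((vdm x * \prod_i (E U).[x i]) * (vdm y * \prod_i (E U).[y i]))); last by ring.
  rewrite !expand; [|by move=> i; rewrite yE|by move=> i; rewrite xE].
  rewrite big_distrlr /= mulr_sumr; apply: eq_bigr => l _; rewrite mulr_sumr; apply: eq_bigr => p _.
  ring.
rewrite vxy det_bezout_mx mulr_sumr; apply: eq_bigr => l _.
under [RHS]eq_bigr do rewrite -mulrA mulr_suml.
rewrite -mulr_sumr exchange_big /=; congr (_ * _); apply: eq_bigr => s _.
rewrite (bigD1 [ffun i => rev_ord (l (s i))]) //= eqxx mulr1 [X in _ + X]big1 ?addr0.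
  by congr (_ * (_ * _)); apply: eq_bigr => i _; rewrite ffunE.
by move=> p /negbTE ->; rewrite mulr0 mul0r.
Qed.

Let dlt : C := (-1) ^+ (perm (@rev_ord_inj k)).

(** The symmetry conj(e_j) = conj(det U) e_(N-j) applied to each entry; the
    reversal of the indices also reverses the columns, whence the sign. *)
Lemma chi_conj U (p : {ffun 'I_k -> 'I_(N + k)}) :
  (chi (E U) p)^* = dlt * (f U * chi (E U) [ffun i => rev_ord (p i)]).
Proof.
rewrite -det_map_mx.
pose B : 'M[C]_k := \matrix_(i, j) ('X^j * E U)`_(rev_ord (p i)).
have -> : map_mx Num.conj (\matrix_(i, j < k) ('X^j * E U)`_(p i)) =
    (\matrix_(i, j) ((\det (val U))^* * (\matrix_(i, j) B^T ((perm (@rev_ord_inj k)) i) j)^T i j)).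
  apply/matrixP => i j; rewrite !mxE permE !coefXnM /=.
  have pi := ltn_ord (p i); have jk := ltn_ord j.
  have sE m : (N < m)%N -> (E U)`_m = 0.
    by move=> Nm; apply: nth_default; apply: (leq_trans (secpoly_size (val U))).
  move: (nat_of_ord (p i)) (nat_of_ord j) pi jk => a b pi jk.
  case: (ltnP a b) => ab.
    rewrite rmorph0; case: ifP => // _; rewrite ?mulr0 // sE ?mulr0 //; lia.
  case: (leqP (a - b) N) => abN.
    rewrite secpoly_conj // ifN; last by lia.
    by congr (_ * _`_ _); lia.
  by rewrite sE // rmorph0 ifT ?mulr0 //; lia.
rewrite det_scale_rows prodr_const card_ord det_tr det_perm_rows det_tr mulrCA.
congr (_ * (_ * _)).
by congr (\det _); apply/matrixP => i j; rewrite !mxE ffunE.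
Qed.

(** The computation gives the result up to a global sign depending on [k] only.
    The sign is +1 because the mean of |chi_l|^2 is nonnegative. *)
Lemma chi_orthogonality (l p : {ffun 'I_k -> 'I_(N + k)}) :
  I (fun U => chi (E U) l * (chi (E U) p)^*) =
  \sum_(s : 'S_k) (-1) ^+ s * (p == [ffun i => l (s i)])%:R.
Proof.
have main (l' p' : {ffun 'I_k -> 'I_(N + k)}) : I (fun U => chi (E U) l' * (chi (E U) p')^*) =
    dlt * pair_sign C k * \sum_(s : 'S_k) (-1) ^+ s * (p' == [ffun i => l' (s i)])%:R.
  transitivity (dlt * I (fun U => f U * (chi (E U) l' * chi (E U) [ffun i => rev_ord (p' i)]))).
    rewrite -IZ; last by apply: niceM; [exact: nice_detJ|apply: niceM; exact: nice_chi].
    by apply: I_ext => U; rewrite chi_conj; ring.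
  rewrite int_chi_chi mulrA; congr (_ * _); apply: eq_bigr => s _; congr (_ * _%:R).
  congr nat_of_bool; apply/eqP/eqP => /ffunP e; apply/ffunP => i; have := e i; rewrite !ffunE.
    by move/rev_ord_inj.
  by move=> ->.
have sg : dlt * pair_sign C k = 1.
  have sq : (dlt * pair_sign C k) ^+ 2 = 1.
    by rewrite exprMn [_ ^+ 2]expr2 -signr_addb addbb [pair_sign _ _ ^+ 2]expr2 pair_sign_sqr mulr1.
  have /orP[/eqP //|/eqP e] : (dlt * pair_sign C k == 1) || (dlt * pair_sign C k == -1) by rewrite -sqrf_eq1 sq.
  pose l0 : {ffun 'I_k -> 'I_(N + k)} := [ffun i => widen_ord (leq_addl N k) i].
  have : 0 <= I (fun U => chi (E U) l0 * (chi (E U) l0)^*).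
    apply: I_ge0; last by move=> U; exact: mul_conjC_ge0.
    by apply: niceM; [exact: nice_chi|apply: niceJ; exact: nice_chi].
  rewrite main e (bigD1 (1%g : 'S_k)) //= big1 => [|s s1].
    rewrite odd_perm1 expr0 (_ : _ == _) ?mulr1 ?addr0 ?mulr1.
      by rewrite oppr_ge0 ler10.
    by apply/eqP/ffunP => i; rewrite !ffunE perm1.
  case: eqP => [/ffunP h|]; last by rewrite mulr0.
  case/eqP: s1; apply/permP => i; rewrite perm1; have := h i; rewrite !ffunE.
  by move=> /(congr1 (@nat_of_ord _)) /= e'; apply: val_inj.
by rewrite main sg mul1r.
Qed.

(** Bessel's identity for the expansion [coef_exp_chi].  Each orbit of [l] under
    permutations contributes k! times the square of its coefficient, since
    the Vandermonde product and [chi] are both alternating; this cancels one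
    of the two factors k!. *)
Lemma invariant_moment_sum m :
  I (fun U => (E U ^+ k)`_m * ((E U ^+ k)`_m)^*) =
  (k`!%:R * vdm (fun i : 'I_k => i%:R : C) ^+ 2)^-1 *
  \sum_(l : {ffun 'I_k -> 'I_(N + k)} | (\sum_i l i == m + \sum_(i < k) i)%N)
     vdm (fun i => (l i)%:R) ^+ 2.
Proof.
set v := vdm _; set cond := fun l : {ffun 'I_k -> 'I_(N + k)} => (\sum_i l i == m + \sum_(i < k) i)%N.
pose V (l : {ffun 'I_k -> 'I_(N + k)}) : C := vdm (fun i => (l i)%:R).
have v0 : v != 0 by apply: vdm_neq0 => i j /eqP; rewrite eqr_nat => /eqP /val_inj.
have k0 : k`!%:R != 0 :> C by rewrite pnatr_eq0 -lt0n fact_gt0.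
have kv0 : k`!%:R * v != 0 by rewrite mulf_neq0.
have ZE U : (E U ^+ k)`_m = (k`!%:R * v)^-1 * \sum_(l | cond l) V l * chi (E U) l.
  by rewrite -(coef_exp_chi k m (secpoly_size (val U))) mulKf.
have Vr l : (V l)^* = V l.
  rewrite /V -det_map_mx; congr (\det _); apply/matrixP => i j.
  by rewrite !mxE -natrX rmorph_nat.
have vr : (k`!%:R * v)^* = k`!%:R * v.
  rewrite rmorphM rmorph_nat; congr (_ * _).
  rewrite /v -det_map_mx; congr (\det _); apply/matrixP => i j.
  by rewrite !mxE -natrX rmorph_nat.
have nlp (l p : {ffun 'I_k -> 'I_(N + k)}) : nice (fun U => chi (E U) l * (chi (E U) p)^*).
  by apply: niceM; [exact: nice_chi|apply: niceJ; exact: nice_chi].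
have nlp' (l p : {ffun 'I_k -> 'I_(N + k)}) : nice (fun U => (V l * V p) * (chi (E U) l * (chi (E U) p)^*)).
  by apply: niceM => //; exact: nice_cst.
transitivity (((k`!%:R * v) ^+ 2)^-1 * I (fun U => \sum_(l | cond l) \sum_(p | cond p)
    (V l * V p) * (chi (E U) l * (chi (E U) p)^*))).
  rewrite -IZ; last by apply: nice_sum => l _; apply: nice_sum.
  apply: I_ext => U; rewrite ZE [X in _ * X]rmorphM /= [X in _ * (X * _)]fmorphV /= vr rmorph_sum mulrACA -invfM -expr2.
  congr (_ * _); rewrite mulr_suml; apply: eq_bigr => l _; rewrite mulr_sumr; apply: eq_bigr => p _.
  by rewrite rmorphM /= Vr; ring.
have -> : ((k`!%:R * v) ^+ 2)^-1 = (k`!%:R * v ^+ 2)^-1 * k`!%:R^-1.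
  by rewrite -invfM; congr (_^-1); ring.
rewrite -mulrA; congr (_ * _); apply: (mulfI k0); rewrite mulVKf //.
rewrite I_sum; last by move=> l _; apply: nice_sum.
rewrite mulr_sumr; apply: eq_bigr => l cl.
rewrite I_sum //.
transitivity (\sum_(p | cond p) \sum_(s : 'S_k) V l * V p * ((-1) ^+ s * (p == [ffun i => l (s i)])%:R)).
  by apply: eq_bigr => p _; rewrite IZ // chi_orthogonality mulr_sumr.
rewrite exchange_big /= mulr_natl.
transitivity (\sum_(s : 'S_k) V l ^+ 2); last by rewrite sumr_const card_Sn.
apply: eq_bigr => s _.
have cls : cond [ffun i => l (s i)].
  rewrite /cond -(eqP cl) [X in _ == X](reindex_inj (@perm_inj _ s)) /=; apply/eqP.
  by apply: eq_bigr => i _; rewrite ffunE.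
rewrite (bigD1 [ffun i => l (s i)]) //= eqxx mulr1 big1 ?addr0; last first.
  by move=> p /andP[_ /negbTE ->]; rewrite !mulr0.
have -> : V [ffun i => l (s i)] = (-1) ^+ s * V l.
  rewrite /V /vdm -det_perm_rows; congr (\det _); apply/matrixP => i j.
  by rewrite !mxE ffunE.
by rewrite -mulrA [_ * V l * _]mulrAC -expr2 sqrr_sign mul1r expr2.
Qed.

End Characters.
End Haar.

(** * The Haar integral on the unitary group *)
Section ComplexIntegral.
Local Open Scope classical_set_scope.
Local Open Scope ring_scope.
Local Open Scope complex_scope.
Variables (R : realType) (N : nat) (mu : probability (unitary_group R N) R).
Notation UG := (unitary_group R N).
Notation C := (R[i]).
Definition umx (U : UG) : 'M[C]_N := val U.

Lemma measurable_continuous (f : UG -> R) : continuous f -> measurable_fun setT f.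
Proof.
move=> /continuousP cf; apply: (measurability _ (RGenOpens.measurableE R)) => _ [_ [a [b ->] <-]].
rewrite setTI; apply: sub_sigma_algebra; apply: cf; exact: interval_open.
Qed.

Lemma entry_continuous (i j : 'I_N) : continuous (fun U : UG => umx U i j : C).
Proof.
move=> U A /= nA.
have h : continuous (@set_val _ (@unitary_set R N)) by exact: initial_continuous.
apply: (h U [set M | A (M i j)]).
exists (fun a b => if (a == i) && (b == j) then A else setT).
  by move=> a b; case: ifP => [/andP[/eqP -> /eqP ->]//|_]; exact: filterT.
by move=> M /= /(_ i j); rewrite !eqxx.
Qed.

Lemma Re_continuous : continuous (fun z : C => complex.Re z : R).
Proof.
move=> z A /nbhs_ballP[e /= e0 eA]; apply/nbhs_ballP; exists e%:C => /=; first by rewrite ltcR.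
move=> y zy; apply: eA; rewrite /ball /= -ltcR; apply: le_lt_trans zy.
by apply: le_trans (normc_ge_Re _); case: (z) (y) => [a b] [a' b'].
Qed.

Lemma normc_ge_Im (z : C) : `|complex.Im z|%:C <= `|z|.
Proof.
apply: le_trans (_ : `|z * 'i| <= _); last by rewrite normrM normCi mulr1.
apply: le_trans (normc_ge_Re _); case: z => a b /=.
by rewrite mulr0 mulr1 sub0r normrN.
Qed.

Lemma Im_continuous : continuous (fun z : C => complex.Im z : R).
Proof.
move=> z A /nbhs_ballP[e /= e0 eA]; apply/nbhs_ballP; exists e%:C => /=; first by rewrite ltcR.
move=> y zy; apply: eA; rewrite /ball /= -ltcR; apply: le_lt_trans zy.
by apply: le_trans (normc_ge_Im _); case: (z) (y) => [a b] [a' b'].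
Qed.

(** Needed for measurability of translations: the sigma-algebra of the group is
    generated by the open sets. *)
Lemma unitary_mul_continuous (V : UG) : continuous (unitary_mul V).
Proof.
have h : continuous (@set_val _ (@unitary_set R N)) by exact: initial_continuous.
apply: (@continuous_comp_initial _ _ _ (@set_val _ (@unitary_set R N))).
move=> U A [P nP PA] /=.
have : nbhs U [set U' : UG | forall i j, P i j ((umx V *m umx U') i j)].
  apply: (@filter_forall UG 'I_N (fun i U' => forall j, P i j ((umx V *m umx U') i j)) (nbhs U)) => i.
  apply: (@filter_forall UG 'I_N (fun j U' => P i j ((umx V *m umx U') i j)) (nbhs U)) => j.
  have cE (s : seq 'I_N) : (fun U' : UG => \sum_(a <- s) umx V i a * umx U' a j : C^o) @ U -->
      (\sum_(a <- s) umx V i a * umx U a j : C^o).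
    elim: s => [|a s IH].
      rewrite big_nil (_ : (fun U' : UG => _) = cst (0 : C^o)); last by apply/funext => U'; rewrite big_nil.
      exact (@cvg_cst C^o 0 UG (nbhs U) (nbhs_filter U)).
    rewrite big_cons (_ : (fun U' : UG => _) = (fun U' : UG => umx V i a * umx U' a j + \sum_(b <- s) umx V i b * umx U' b j : C^o)).
      refine (@cvgD _ C^o UG (nbhs U) (nbhs_filter U) _ _ _ _ _ IH).
      refine (@cvgM C UG (nbhs U) (nbhs_filter U) (fun _ => umx V i a) (fun U' => umx U' a j) _ _ _ _).
        exact (@cvg_cst C^o _ UG (nbhs U) (nbhs_filter U)).
      exact: entry_continuous.
    by apply/funext => U'; rewrite big_cons.
  have nPij : nbhs (\sum_a umx V i a * umx U a j : C^o) (P i j).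
    by have := nP i j; rewrite /= mxE.
  refine (@filterS UG (nbhs U) (nbhs_filter U) _ _ _ (cE (index_enum _) (P i j) nPij)) => U'.
  by rewrite /= mxE.
move=> nU; refine (@filterS UG (nbhs U) (nbhs_filter U) _ _ _ nU) => U' h'.
by apply: PA => i j; exact: h'.
Qed.

Lemma measurable_unitary_mul (V : UG) : measurable_fun setT (unitary_mul V).
Proof.
have /continuousP cV := @unitary_mul_continuous V.
apply: (measurability (@open UG)) => // _ [A oA <-].
by rewrite setTI; apply: sub_sigma_algebra; exact: cV.
Qed.

(** Boundedness makes these functions integrable and their class stable under
    products. *)
Definition nice (f : UG -> C) := (exists B : R, forall U, normc (f U) <= B) /\
  measurable_fun setT (fun U => complex.Re (f U)) /\ measurable_fun setT (fun U => complex.Im (f U)).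

Definition Cint (f : UG -> C) : C :=
  (\int[mu]_U complex.Re (f U))%R +i* (\int[mu]_U complex.Im (f U))%R.

Lemma normc_Re (z : C) : `|complex.Re z| <= normc z.
Proof. by have := normc_ge_Re z; rewrite /Num.Def.normr /= lecR. Qed.

Lemma normc_Im (z : C) : `|complex.Im z| <= normc z.
Proof. by have := normc_ge_Im z; rewrite /Num.Def.normr /= lecR. Qed.

Lemma integrable_bounded (g : UG -> R) B : measurable_fun setT g ->
  (forall U, `|g U| <= B) -> mu.-integrable setT (EFin \o g).
Proof.
move=> mg gB; apply: (@le_integrable _ _ _ mu setT measurableT (EFin \o g) (EFin \o cst B)) => //.
- exact/measurable_EFinP.
- move=> U _; rewrite /= lee_fin; apply: le_trans (gB U) _; exact: ler_norm.
- exact: finite_measure_integrable_cst.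
Qed.

Lemma nice_int f : nice f -> mu.-integrable setT (EFin \o (fun U => complex.Re (f U))) /\
  mu.-integrable setT (EFin \o (fun U => complex.Im (f U))).
Proof.
move=> [[B fB] [mr mi]]; split; apply: integrable_bounded (B) _ _ => // U.
  exact: le_trans (normc_Re _) (fB U).
exact: le_trans (normc_Im _) (fB U).
Qed.

Lemma ReM (x y : C) : complex.Re (x * y) = complex.Re x * complex.Re y - complex.Im x * complex.Im y.
Proof. by case: x y => [a b] [c d]. Qed.

Lemma ImM (x y : C) : complex.Im (x * y) = complex.Re x * complex.Im y + complex.Im x * complex.Re y.
Proof. by case: x y => [a b] [c d]. Qed.

Lemma ReD (x y : C) : complex.Re (x + y) = complex.Re x + complex.Re y.
Proof. by case: x y => [a b] [c d]. Qed.

Lemma ImD (x y : C) : complex.Im (x + y) = complex.Im x + complex.Im y.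
Proof. by case: x y => [a b] [c d]. Qed.

Lemma conjE (x : C) : (Num.conj x : C) = complex.Re x -i* complex.Im x.
Proof. by case: x. Qed.

Lemma nice_ext f g : f =1 g -> nice f -> nice g.
Proof. by move=> fg; have -> : g = f by apply/funext => U; rewrite fg. Qed.

Lemma nice_cst (c : C) : nice (fun=> c).
Proof. by split; [exists (normc c)|split; exact: measurable_cst]. Qed.

Lemma niceD f g : nice f -> nice g -> nice (fun U => f U + g U).
Proof.
move=> [[B fB] [fr fi]] [[B' gB] [gr gi]]; split.
  exists (B + B') => U; apply: le_trans (lerD (fB U) (gB U)).
  by have := ler_normD (f U) (g U); rewrite /Num.Def.normr /= -rmorphD lecR.
split; under eq_fun do rewrite ?ReD ?ImD; exact: measurable_funD.
Qed.

Lemma niceM f g : nice f -> nice g -> nice (fun U => f U * g U).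
Proof.
move=> [[B fB] [fr fi]] [[B' gB] [gr gi]]; split.
  exists (B * B') => U; rewrite normcM; apply: ler_pM => //.
    by apply: le_trans (normr_ge0 _) (normc_Re _).
  by apply: le_trans (normr_ge0 _) (normc_Re _).
split; under eq_fun do rewrite ?ReM ?ImM.
  by apply: measurable_funB; exact: measurable_funM.
by apply: measurable_funD; exact: measurable_funM.
Qed.

Lemma niceJ f : nice f -> nice (fun U => Num.conj (f U)).
Proof.
move=> [[B fB] [fr fi]]; split.
  exists B => U; apply: le_trans (fB U); rewrite conjE; case: (f U) => a b /=.
  by rewrite sqrrN.
split; under eq_fun do rewrite conjE /=; first by [].
by apply: measurableT_comp fi; exact: oppr_measurable.
Qed.

Lemma umx_unitary U : unitary (umx U).
Proof.
have /unitarymxP := set_valP U.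
rewrite /unitary /adjm => h; rewrite -[RHS]h; congr (_ *m _).
Qed.

Lemma nice_entry i j : nice (fun U => umx U i j).
Proof.
split; last first.
  split; apply: measurable_continuous => U.
    by apply: (@continuous_comp UG C R); [exact: entry_continuous|exact: Re_continuous].
  by apply: (@continuous_comp UG C R); [exact: entry_continuous|exact: Im_continuous].
exists 1 => U.
have := umx_unitary U => /(congr1 (fun A : 'M[C]_N => A i i)).
rewrite !mxE eqxx (bigD1 j) //= !mxE => e.
have : `|umx U i j| ^+ 2 <= 1 :> C.
  rewrite normCK -[X in _ <= X]/(true%:R : C) -e lerDl; apply: sumr_ge0 => a _; rewrite !mxE; exact: mul_conjC_ge0.
rewrite -[X in _ <= X](expr1n _ 2) ler_pXn2r ?nnegrE //.
by rewrite /Num.Def.normr /= -[1]/(1%:C) lecR.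
Qed.

Lemma Cint_ext f g : f =1 g -> Cint f = Cint g.
Proof. by move=> fg; have -> : f = g by apply/funext. Qed.

Lemma mu1 : fine (mu setT) = 1.
Proof. by rewrite probability_setT. Qed.

Lemma Cint_cst c : Cint (fun=> c) = c.
Proof.
by rewrite /Cint !Rintegral_cst // mu1 !mulr1; case: c.
Qed.

Lemma CintD f g : nice f -> nice g -> Cint (fun U => f U + g U) = Cint f + Cint g.
Proof.
move=> /nice_int[fr fi] /nice_int[gr gi]; rewrite /Cint.
under eq_Rintegral do rewrite ReD.
under [X in _ +i* X]eq_Rintegral do rewrite ImD.
by rewrite !RintegralD.
Qed.

Lemma CintZ c f : nice f -> Cint (fun U => c * f U) = c * Cint f.
Proof.
move=> /nice_int[fr fi]; rewrite /Cint.
have i1 (a : R) (g : UG -> R) : mu.-integrable setT (EFin \o g) ->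
   mu.-integrable setT (EFin \o (fun U => a * g U)).
  by move=> ig; apply: (integrableZl measurableT a ig).
under eq_Rintegral do rewrite ReM.
under [X in _ +i* X]eq_Rintegral do rewrite ImM.
rewrite RintegralB //; [|exact: i1|exact: i1]; rewrite RintegralD //; [|exact: i1|exact: i1].
by rewrite !RintegralZl //; case: c.
Qed.

Lemma Cint_ge0 f : nice f -> (forall U, 0 <= f U) -> 0 <= Cint f.
Proof.
move=> _ f0; rewrite /Cint.
rewrite (_ : (fun U => complex.Im (f U)) = cst 0); last first.
  by apply/funext => U; have := f0 U; rewrite lecE /= => /andP[/eqP].
rewrite Rintegral_cst // mul0r lecE /= eqxx /=.
by apply: Rintegral_ge0 => U _; have := f0 U; rewrite lecE /= => /andP[].
Qed.

Hypothesis haar : is_haar mu.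

Lemma Rint_inv (V : UG) (g : UG -> R) B : measurable_fun setT g ->
  (forall U, `|g U| <= B) ->
  (\int[mu]_U g (unitary_mul V U))%R = (\int[mu]_U g U)%R.
Proof.
move=> mg gB; rewrite /Rintegral; congr fine.
have mV := measurable_unitary_mul V.
have mg' : measurable_fun setT (EFin \o g) by exact/measurable_EFinP.
have ig' : mu.-integrable (unitary_mul V @^-1` setT) ((EFin \o g) \o unitary_mul V).
  rewrite preimage_setT; apply: (@integrable_bounded (g \o unitary_mul V) B) => [|U].
    exact: measurableT_comp mg mV.
  exact: gB.
rewrite -[LHS](integral_pushforward mV mg' ig' measurableT).
apply: eq_measure_integral => A mA _; exact: haar.
Qed.

Lemma Cint_inv (V : 'M[C]_N) (F : 'M[C]_N -> C) : unitary V ->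
  nice (fun U => F (umx U)) -> Cint (fun U => F (V *m umx U)) = Cint (fun U => F (umx U)).
Proof.
move=> uV nF.
have VS : V \in @unitary_set R N by apply/mem_set/unitarymxP.
pose V' : UG := SigSub VS.
have [[B FB] [mr mi]] := nF.
rewrite /Cint -(Rint_inv V' mr (B := B)); last by move=> U; exact: le_trans (normc_Re _) (FB U).
rewrite -(Rint_inv V' mi (B := B)); last by move=> U; exact: le_trans (normc_Im _) (FB U).
by [].
Qed.

Lemma secular_moment_lattice (k m : nat) : (1 < N + k)%N ->
  secular_moment k m%:Z mu =
  (k`!%:R * vdm (fun i : 'I_k => i%:R : R) ^+ 2)^-1 *
  \sum_(l : {ffun 'I_k -> 'I_(N + k)} | (\sum_i l i == m + \sum_(i < k) i)%N)
     vdm (fun i => (l i)%:R : R) ^+ 2.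
Proof.
move=> Nk.
have := @invariant_moment_sum C N UG umx nice Cint umx_unitary nice_ext nice_cst nice_entry
   niceD niceM niceJ Cint_ext Cint_cst CintD CintZ Cint_ge0 Cint_inv k Nk m.
have vc n (x : 'I_n -> nat) : vdm (fun i => (x i)%:R : C) = (vdm (fun i => (x i)%:R : R))%:C.
  rewrite /vdm -det_map_mx; congr (\det _); apply/matrixP => i j.
  by rewrite !mxE rmorphXn /= rmorph_nat.
rewrite vc; under eq_bigr do rewrite vc -rmorphXn.
rewrite -rmorph_sum -rmorphXn -[k`!%:R](rmorph_nat (real_complex R)) -rmorphM -fmorphV -rmorphM /=.
move=> /(congr1 (@complex.Re R)) /= <-.
rewrite /secular_moment; apply: eq_Rintegral => U _.
have -> : \sum_(j : {ffun 'I_k -> 'I_N.+1} | (\sum_(i < k) (j i : nat))%N%:Z == m%:Z)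
       \prod_(i < k) secular_coef (val U) (j i) = (secpoly (umx U) ^+ k)`_m.
  have -> : secpoly (umx U) = \sum_(j < N.+1) (secular_coef (val U) j)%:P * 'X^j.
    rewrite -[LHS](coefK) (poly_def) (big_ord_widen N.+1 (fun j => (secpoly (umx U))`_j *: 'X^j) (secpoly_size _)).
    rewrite big_mkcond; apply: eq_bigr => j _; rewrite mul_polyC; case: ltnP => // sj.
    by rewrite /secular_coef -/(secpoly (umx U)) nth_default // scale0r.
  rewrite -[in RHS](card_ord k) -prodr_const bigA_distr_bigA /= coef_sum big_mkcond /=.
  apply: eq_bigr => j _; rewrite big_split /= -rmorph_prod coefCM.
  rewrite -(big_morph _ (@exprD _ 'X) (expr0 _)) coefXn eqz_nat eq_sym.
  by case: eqP => _; rewrite ?mulr1 ?mulr0.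
by case: (_`_m) => a b; rewrite conjE ReM /= mulrN opprK sqr_sqrtr ?addr_ge0 ?sqr_ge0.
Qed.

End ComplexIntegral.

(** * One-dimensional Riemann sums *)
Section OneDim.
Local Open Scope classical_set_scope.
Local Open Scope ring_scope.
Variable R : realType.
Notation mu := (@lebesgue_measure R).

Lemma lebesgue_measure_itv_lt (a b : R) :
  mu `[a, b[ = (if a < b then b - a else 0)%:E.
Proof. by rewrite lebesgue_measure_itv /= lte_fin; case: ifP => _; rewrite // -EFinB. Qed.

Lemma integrable_itv (f : R -> R) (a b : R) (B : R) : measurable_fun setT f ->
  (forall x, `|f x| <= B) -> mu.-integrable `[a, b[ (EFin \o f).
Proof.
move=> mf fB; have mD : measurable (`[a, b[%classic : set R) by exact: measurable_itv.
apply: (@le_integrable _ _ _ mu _ mD (EFin \o f) (EFin \o cst B)) => //.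
- by apply/measurable_EFinP; exact: measurable_funTS.
- by move=> x _; rewrite /= lee_fin; apply: le_trans (fB x) _; exact: ler_norm.
- apply/integrableP; split; first by apply/measurable_EFinP; exact: measurable_cst.
  rewrite /= integral_cst // [X in (_ * X)%E](lebesgue_measure_itv_lt a b).
  by rewrite -EFinM ltry.
Qed.

Lemma Rintegral_chasles (f : R -> R) (B : R) (a : nat -> R) (n : nat) :
  measurable_fun setT f -> (forall x, `|f x| <= B) -> {homo a : i j / (i <= j)%N >-> i <= j} ->
  (\int[mu]_(x in `[a 0%N, a n[) f x = \sum_(i < n) \int[mu]_(x in `[a i, a i.+1[) f x)%R.
Proof.
move=> mf fB am; elim: n => [|n IH].
  by rewrite big_ord0 set_itv_ge ?Rintegral_set0 // bnd_simp ltxx.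
rewrite big_ord_recr /= -IH -Rintegral_setU //.
- congr (\int[mu]_(x in _) _)%R; apply: itv_bndbnd_setU; rewrite bnd_simp; exact: am.
- rewrite -itv_bndbnd_setU ?bnd_simp; [exact: integrable_itv mf fB|exact: am|exact: am].
- apply/disj_setPS => x [] /=; rewrite !in_itv /= => /andP[_ xa] /andP[ax _].
  by move: xa; rewrite ltNge ax.
Qed.

Lemma Rintegral_itv_cst (a b r : R) : a <= b -> (\int[mu]_(x in `[a, b[) r = r * (b - a))%R.
Proof.
move=> ab; rewrite Rintegral_cst //; congr (_ * _).
rewrite [X in fine X](lebesgue_measure_itv_lt a b) /=.
by case: ltgtP ab => // -> _; rewrite subrr.
Qed.

Lemma Rintegral_itv_indic (a b c d : R) : c <= d ->
  (\int[mu]_(x in `[a, b[) (if c <= x <= d then 1 else 0) <= d - c)%R.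
Proof.
move=> cd; have mD : measurable (`[a, b[%classic : set R) by exact: measurable_itv.
have mE : measurable (`[c, d]%classic : set R) by exact: measurable_itv.
rewrite (_ : (fun x : R => _) = \1_`[c, d]); last first.
  by apply/funext => x; rewrite indicE mem_setE in_itv /=; case: ifP.
rewrite /Rintegral integral_indic // -lee_fin.
have h : (mu (`[c, d] `&` `[a, b[) <= (d - c)%:E)%E.
  apply: (@le_trans _ _ (mu `[c, d])).
    by apply: le_measure; rewrite ?inE //; apply: measurableI.
  by rewrite lebesgue_measure_itv /= lte_fin; case: ltgtP cd => // -> _; rewrite subrr.
by rewrite fineK // ge0_fin_numE // (le_lt_trans h) // ltry.
Qed.

Variables (N M : nat) (h e s P0 P1 : R) (p : R -> R).
Hypotheses (N1 : (1 <= N)%N) (h0 : 0 <= h) (Mh : M%:R = N%:R + 2 * h + 1).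
Hypotheses (e0 : 0 <= e) (eh : e <= h / N%:R).
Let box x := - (h / N%:R) <= x <= 1 + h / N%:R.
Hypothesis mp : measurable_fun setT p.
Hypothesis pP : forall v, box v -> box (s - v) -> 0 <= p v <= P0.
Hypothesis pL : forall v w, box v -> box (s - v) -> box w -> box (s - w) ->
  `|p v - p w| <= P1 * `|v - w|.
Hypotheses (P00 : 0 <= P0) (P10 : 0 <= P1).

Let g v : R := if (0 <= v <= 1) && (0 <= s - v <= 1) then p v else 0.
Let g' v : R := if - e <= s - v <= 1 + e then p v else 0.
Let pt (i : nat) : R := (i%:R - h) / N%:R.
Let d := (h + 1) / N%:R.
(** On a cell of the Riemann sum, [g] differs from the value of [g'] at the left
    end by at most P1 / N, except near the four points 0, 1, s - 1, s where a
    cut-off may switch.  There the difference is only bounded by P0; [b] below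
    is the resulting majorant. *)
Let near c (v : R) : R := if c - d <= v <= c + d then 1 else 0.
Let b v : R := P1 / N%:R + P0 * (near 0 v + near 1 v + near (s - 1) v + near s v).

Let N0 : 0 < N%:R :> R. Proof. by rewrite ltr0n. Qed.

Let hN0 : 0 <= h / N%:R. Proof. by rewrite divr_ge0 // ltW. Qed.
Let iN0 : 0 < N%:R^-1 :> R. Proof. by rewrite invr_gt0. Qed.
Let dE : d = h / N%:R + N%:R^-1. Proof. by rewrite /d mulrDl mul1r. Qed.

Let ptS i : pt i.+1 = pt i + N%:R^-1.
Proof. by rewrite /pt -natr1 -addrA [1 + _]addrC addrA mulrDl mul1r. Qed.

Let pt_box i : (i < M)%N -> box (pt i).
Proof.
move=> iM; rewrite /box /pt; apply/andP; split.
  by rewrite mulrBl lerDr divr_ge0 // ltW.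
have : i%:R + 1 <= M%:R :> R by rewrite natr1 ler_nat.
rewrite Mh => im; rewrite -subr_ge0.
have -> : 1 + h / N%:R - (i%:R - h) / N%:R = (N%:R + 2 * h - i%:R) / N%:R.
  by field; rewrite lt0r_neq0.
by apply: divr_ge0; [lra|rewrite ltW].
Qed.

Let near_ge0 c v : 0 <= near c v.
Proof. by rewrite /near; case: ifP. Qed.

Let g_bnd v : 0 <= g v <= P0.
Proof.
rewrite /g; case: ifP => [/andP[/andP[v0 v1] /andP[sv0 sv1]]|_]; last by rewrite lexx.
by apply: pP; rewrite /box; have := hN0; lra.
Qed.

Let g'_bnd i : (i < M)%N -> 0 <= g' (pt i) <= P0.
Proof.
move=> iM; rewrite /g'; case: ifP => [/andP[a1 a2]|_]; last by rewrite lexx.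
by apply: pP; [exact: pt_box|rewrite /box; move: eh; lra].
Qed.

Let pointwise i v : (i < M)%N -> pt i <= v -> v < pt i.+1 -> `|g' (pt i) - g v| <= b v.
Proof.
move=> iM; rewrite ptS => v1 v2.
have := g'_bnd iM; have := g_bnd v => /andP[ga gb] /andP[ga' gb'].
have iN := iN0; have hN := hN0.
have b0 : 0 <= P1 / N%:R by rewrite divr_ge0 // ltW.
have crude : `|g' (pt i) - g v| <= P0 by rewrite ler_norml; lra.
have sumge : 1 <= near 0 v + near 1 v + near (s - 1) v + near s v -> `|g' (pt i) - g v| <= b v.
  move=> n1; apply: le_trans crude _; rewrite /b -[leLHS]add0r; apply: lerD => //.
  by rewrite ler_peMr.
have k1 := near_ge0 0 v; have k2 := near_ge0 1 v.
have k3 := near_ge0 (s - 1) v; have k4 := near_ge0 s v.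
have [n1|n1] := boolP (0 - d <= v <= 0 + d).
  have e1 : near 0 v = 1 by rewrite /near n1.
  by apply: sumge; rewrite e1; lra.
have [n2|n2] := boolP (1 - d <= v <= 1 + d).
  have e1 : near 1 v = 1 by rewrite /near n2.
  by apply: sumge; rewrite e1; lra.
have [n3|n3] := boolP (s - 1 - d <= v <= s - 1 + d).
  have e1 : near (s - 1) v = 1 by rewrite /near n3.
  by apply: sumge; rewrite e1; lra.
have [n4|n4] := boolP (s - d <= v <= s + d).
  have e1 : near s v = 1 by rewrite /near n4.
  by apply: sumge; rewrite e1; lra.
have bge : P1 / N%:R <= b v by rewrite /b lerDl mulr_ge0 // !addr_ge0.
apply: le_trans bge.
have /andP[x1 x2] := pt_box iM.
move: n1 n2 n3 n4; rewrite dE !negb_and -!ltNge => n1 n2 n3 n4.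
rewrite {1}/g; case: ifP => [/andP[/andP[w1 w2] /andP[w3 w4]]|gF].
  have m3 : s - 1 + (h / N%:R + N%:R^-1) < v by case/orP: n3 => ?; lra.
  have m4 : v < s - (h / N%:R + N%:R^-1) by case/orP: n4 => ?; lra.
  have f1 : - e <= s - pt i <= 1 + e.
    move: e0 v1 v2 m3 m4 hN iN; move: (pt i) (h / N%:R) (N%:R^-1 : R) => x H J.
    by move=> *; lra.
  rewrite /g' f1.
  have bv : box v by rewrite /box; lra.
  have bsv : box (s - v) by rewrite /box; lra.
  have bsx : box (s - pt i) by rewrite /box; lra.
  apply: le_trans (pL (pt_box iM) bsx bv bsv) _; rewrite ler_wpM2l //.
  by rewrite ler_norml; lra.
rewrite subr0 /g' ifF ?normr0 //.
apply/negP => /andP[gT1 gT2]; move/negP: gF; apply.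
move: e0 eh v1 v2 x1 x2 n1 n2 n3 n4 gT1 gT2 hN iN.
move: (pt i) (h / N%:R) (N%:R^-1 : R) => x H J E0 EH v1 v2 x1 x2 n1 n2 n3 n4 gT1 gT2 hN iN.
have w1 : 0 <= v by case/orP: n1 => ?; lra.
have w2 : v <= 1 by case/orP: n2 => ?; lra.
have w3 : s - 1 <= v by case/orP: n3 => ?; lra.
have w4 : v <= s by case/orP: n4 => ?; lra.
by lra.
Qed.

Let mnear c : measurable_fun setT (near c).
Proof.
rewrite (_ : near c = \1_`[c - d, c + d]); last first.
  by apply/funext => x; rewrite indicE mem_setE in_itv /= /near; case: ifP.
exact: measurable_indic.
Qed.

Let mg : measurable_fun setT g.
Proof.
rewrite (_ : g = (fun x => \1_(`[0, 1] `&` `[s - 1, s]) x * p x)).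
  by apply: measurable_funM => //; apply: measurable_indic; apply: measurableI.
apply/funext => x; rewrite indicE in_setI !mem_setE !in_itv /= /g.
have -> : (s - 1 <= x <= s) = (0 <= s - x <= 1) by apply/idP/idP; lra.
by case: ifP; rewrite ?mul1r ?mul0r.
Qed.

Let b_bnd x : `|b x| <= P1 / N%:R + P0 * 4.
Proof.
have n1 c : 0 <= near c x <= 1 by rewrite /near; case: ifP => _; rewrite ?lexx ?ler01.
have c0 : 0 <= P1 / N%:R by rewrite divr_ge0 // ltW.
have /andP[a1 a2] := n1 0; have /andP[a3 a4] := n1 1.
have /andP[a5 a6] := n1 (s - 1); have /andP[a7 a8] := n1 s.
rewrite ger0_norm; last by rewrite addr_ge0 // mulr_ge0 // !addr_ge0.
by rewrite lerD2l ler_wpM2l //; lra.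
Qed.

Let pt0 : pt 0%N = - (h / N%:R).
Proof. by rewrite /pt sub0r mulNr. Qed.

Let ptM : pt M = 1 + d.
Proof. by rewrite /pt /d Mh; field; rewrite lt0r_neq0. Qed.

(** The sum runs over the points (i - h) / N with i < M, which overshoot [0, 1]
    by h / N on both sides, and the cut-off on [s - v] may be relaxed by
    e <= h / N.  Both effects, as well as the discontinuities of the integrand,
    only concern boundedly many cells. *)
Lemma riemann_dim1 :
  `|(N%:R^-1 * \sum_(i < M) g' (pt i)) - \int[mu]_(v in `[0, 1]) (if 0 <= s - v <= 1 then p v else 0)|%R
   <= (P1 * (2 * h + 2) + P0 * 8 * (h + 1)) / N%:R.
Proof.
have gB x : `|g x| <= P0 by rewrite ler_norml; have := g_bnd x; lra.
have am : {homo pt : i j / (i <= j)%N >-> i <= j}.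
  by move=> i j ij; rewrite /pt ler_pM2r ?invr_gt0 // lerD2r ler_nat.
have -> : (\int[mu]_(v in `[0, 1]) (if 0 <= s - v <= 1 then p v else 0))%R =
   (\sum_(i < M) \int[mu]_(x in `[pt i, pt i.+1[) g x)%R.
  rewrite -(Rintegral_chasles _ mg gB am) Rintegral_mkcond [RHS]Rintegral_mkcond.
  apply: eq_Rintegral => x _; rewrite !patchE /g !mem_setE !in_itv /=.
  case: ifP => [/andP[x0 x1]|x01]; last by case: ifP.
  have -> : pt 0%N <= x < pt M.
    rewrite pt0 ptM; apply/andP; split; first by apply: le_trans x0; rewrite oppr_le0.
    by apply: le_lt_trans x1 _; rewrite ltrDl dE ltr_wpDl.
  by [].
rewrite mulr_sumr -sumrB; apply: le_trans (ler_norm_sum _ _ _) _.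
have mb : measurable_fun setT b.
  apply: measurable_funD => //; apply: measurable_funM => //.
  by do 3 apply: measurable_funD => //.
apply: (@le_trans _ _ (\sum_(i < M) \int[mu]_(x in `[pt i, pt i.+1[) b x)%R).
  apply: ler_sum => i _.
  have ii : pt i <= pt i.+1 by apply: am.
  have -> : N%:R^-1 * g' (pt i) = (\int[mu]_(x in `[pt i, pt i.+1[) g' (pt i))%R.
    by rewrite Rintegral_itv_cst // ptS addrAC subrr add0r mulrC.
  have mD : measurable (`[pt i, pt i.+1[%classic : set R) by exact: measurable_itv.
  rewrite -RintegralB //; last 2 first.
  - by apply: integrable_itv (`|g' (pt i)|) _ _ => //.
  - by apply: integrable_itv gB.
  have mgg : measurable_fun setT (fun x => g' (pt i) - g x) by exact: measurable_funB.
  have ggB x : `|g' (pt i) - g x| <= `|g' (pt i)| + P0.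
    by apply: le_trans (ler_normB _ _) _; rewrite lerD2l.
  have := @le_normr_Rintegral _ _ _ mu _ (fun x => g' (pt i) - g x) mD (integrable_itv _ _ mgg ggB).
  move=> /le_trans; apply.
  apply: le_Rintegral => //.
  - apply: (integrable_itv _ _ (B := `|g' (pt i)| + P0)); last by move=> x; rewrite normr_id.
    exact: measurableT_comp.
  - by apply: integrable_itv mb b_bnd.
  - by move=> x; rewrite /= in_itv /= => /andP[x1 x2]; apply: pointwise.
rewrite -(Rintegral_chasles _ mb b_bnd am).
have pMt : pt 0%N <= pt M by exact: am.
have d0 : 0 <= d by rewrite dE addr_ge0 // ltW.
have mD : measurable (`[pt 0%N, pt M[%classic : set R) by exact: measurable_itv.
have nB c x : `|near c x| <= 1 by rewrite /near; case: ifP => _; rewrite ?normr1 ?normr0 ?ler01.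
have inear c : mu.-integrable `[pt 0%N, pt M[ (EFin \o near c) by exact: integrable_itv (mnear c) (nB c).
have nD c : (\int[mu]_(x in `[pt 0%N, pt M[) near c x <= 2 * d)%R.
  apply: le_trans (Rintegral_itv_indic _ _ _) _; first by lra.
  by lra.
have iD (u v : R -> R) : mu.-integrable `[pt 0%N, pt M[ (EFin \o u) ->
    mu.-integrable `[pt 0%N, pt M[ (EFin \o v) -> mu.-integrable `[pt 0%N, pt M[ (EFin \o (fun x => u x + v x)).
  by move=> iu iv; rewrite (_ : _ \o _ = (EFin \o u) \+ (EFin \o v))%E //; exact: integrableD.
have i2 := iD _ _ (inear 0) (inear 1).
have i3 := iD _ _ i2 (inear (s - 1)).
have i4 := iD _ _ i3 (inear s).
rewrite RintegralD //; last 2 first.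
- by apply: integrable_itv (`|P1 / N%:R|) _ _.
- rewrite (_ : _ \o _ = (fun x => P0%:E * (EFin \o (fun x => near 0 x + near 1 x + near (s - 1) x + near s x)%R) x)%E) //.
  exact: integrableZl.
rewrite Rintegral_itv_cst // RintegralZl // !RintegralD //.
have -> : (P1 * (2 * h + 2) + P0 * 8 * (h + 1)) / N%:R = P1 / N%:R * (2 * h + 2) + P0 * (2 * d + 2 * d + 2 * d + 2 * d).
  by rewrite /d; field; rewrite lt0r_neq0.
apply: lerD.
  apply: ler_wpM2l; first by rewrite divr_ge0 // ltW.
  rewrite pt0 ptM /d opprK -addrA -mulrDl.
  have -> : h + 1 + h = 2 * h + 1 by ring.
  have : (2 * h + 1) / N%:R <= 2 * h + 1.
    rewrite ler_pdivrMr //; apply: ler_peMr; last by rewrite ler1n.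
    by rewrite addr_ge0 // mulr_ge0.
  lra.
by apply: ler_wpM2l => //; do 3 apply: lerD => //.
Qed.

End OneDim.

(** * Slices of the cube *)
Section Slice.
Local Open Scope classical_set_scope.
Local Open Scope ring_scope.
Variable R : realType.
Notation RR := (measurableTypeR R).
Notation mu := (@lebesgue_measure R).
Implicit Types (W : seq R -> R) (s u : R).

Definition seq_measurable W m := measurable_fun setT (fun t : m.-tuple RR => W t : RR).

Definition l1 (w w' : seq R) := \sum_(p <- zip w w') `|p.1 - p.2|.

(** Weights are functions of sequences so that fixing the first coordinate
    stays inside the same type.  They are controlled on [1 - b, b]^m with
    b >= 1, slightly larger than the unit cube, because lattice points may lie
    outside the latter. *)
Definition regular (b : R) (P0 P1 : R) W m :=
  let box w := all (fun x => 1 - b <= x <= b) w in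
  [/\ forall w, size w = m -> box w -> 0 <= W w <= P0,
      forall w w', size w = m -> size w' = m -> box w -> box w' -> `|W w - W w'| <= P1 * l1 w w' &
      seq_measurable W m].

Definition slice_tuple n s (w : n.-tuple RR) : n.+1.-tuple RR := [tuple of rcons w (s - \sum_(x <- w) x)].

Lemma measurable_slice_tuple n s : measurable_fun setT (@slice_tuple n s).
Proof.
apply/measurable_fun_tnthP => i.
have [ilt|ige] := ltnP i n.
  rewrite (_ : _ \o _ = (fun w : n.-tuple RR => tnth w (Ordinal ilt))); first exact: measurable_tnth.
  apply/funext => w /=; rewrite (tnth_nth 0) /= nth_rcons size_tuple ilt.
  by rewrite (tnth_nth 0).
rewrite (_ : _ \o _ = (fun w : n.-tuple RR => s - \sum_(j < n) tnth w j)).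
  apply: measurable_funB; first exact: measurable_cst.
  by apply: measurable_sum => j; exact: measurable_tnth.
apply/funext => w /=; rewrite (tnth_nth 0) /= nth_rcons size_tuple ltnNge ige /=.
have -> : nat_of_ord i == n by rewrite eqn_leq ige andbT -ltnS.
by rewrite big_tuple.
Qed.

Definition slice_fun n W s (w : n.-tuple RR) : R :=
  if all (fun x => 0 <= x <= 1) (slice_tuple s w) then W (slice_tuple s w) else 0.

Lemma measurable_slice_fun n W s : seq_measurable W n.+1 -> measurable_fun setT (@slice_fun n W s : _ -> RR).
Proof.
move=> mW.
rewrite (_ : slice_fun W s = (fun w : n.-tuple RR => (\prod_(i < n.+1) \1_(`[0, 1]%classic : set R) (tnth (slice_tuple s w) i)) * W (slice_tuple s w))).
  apply: measurable_funM.
    apply: measurable_prod => i _.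
    apply: (measurableT_comp (f := \1_(`[0, 1]%classic : set R) : RR -> RR) (g := fun w => tnth (slice_tuple s w) i)).
      by apply: measurable_indic; exact: measurable_itv.
    apply: (measurableT_comp (f := fun t : n.+1.-tuple RR => tnth t i)); last exact: measurable_slice_tuple.
    exact: measurable_tnth.
  exact: (measurableT_comp mW (measurable_slice_tuple s)).
apply/funext => w; rewrite /slice_fun; case: ifPn => [/all_tnthP h|/allPn[x /tnthP[i ->] h]].
  rewrite big1 ?mul1r // => i _; rewrite indicE mem_setE in_itv /=.
  by rewrite h.
rewrite (bigD1 i) //= indicE mem_setE in_itv /= (negbTE h) mul0r mul0r //.
Qed.

Lemma slice_fun_cons n W s u (w : n.-tuple RR) :
  slice_fun W s (tcons (u, w)) =
  if 0 <= u <= 1 then slice_fun (fun v => W (u :: v)) (s - u) w else 0.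
Proof.
rewrite /slice_fun /= big_cons opprD addrA.
by case: (0 <= u <= 1).
Qed.

Definition slice_int n W s : \bar R := (\int[lebesgue_tuple R n]_w (slice_fun W s w)%:E)%E.

Lemma slice_fun_ge0 n b P0 P1 W s (w : n.-tuple RR) : 1 <= b -> regular b P0 P1 W n.+1 ->
  0 <= slice_fun W s w.
Proof.
move=> b1 [WP _ _]; rewrite /slice_fun; case: ifP => // h.
have bx : all (fun x => 1 - b <= x <= b) (slice_tuple s w) by apply: sub_all h => x; lra.
by have /andP[] := WP (slice_tuple s w) (size_tuple _) bx.
Qed.

Lemma regular_cons b P0 P1 W m u : 1 - b <= u <= b -> regular b P0 P1 W m.+1 ->
  regular b P0 P1 (fun v => W (u :: v)) m.
Proof.
move=> ub [WP WL mW]; split.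
- by move=> w sw bw; apply: WP; rewrite /= ?sw // ub.
- move=> w w' sw sw' bw bw'.
  apply: le_trans (WL _ _ _ _ _ _) _; rewrite /= ?sw ?sw' ?ub //.
  by rewrite /l1 /= big_cons /= subrr normr0 add0r.
- have h := @measurable_cons _ _ _ _ (fun _ : m.-tuple RR => u : RR) m id (measurable_cst _) (@measurable_id _ _ _).
  exact: (measurableT_comp mW h).
Qed.

Lemma slice_int0 W s : slice_int 0 W s = (if 0 <= s <= 1 then W [:: s] else 0)%:E.
Proof.
rewrite /slice_int /= integral_dirac //; last first.
  apply/measurable_EFinP; have -> : @slice_fun 0 W s = cst (slice_fun W s ([tuple] : 0.-tuple RR)).
    by apply/funext => w; rewrite (tuple0 w).
  exact: measurable_cst.
by rewrite diracT mul1e /slice_fun /= big_nil subr0 andbT.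
Qed.

(** Tonelli's theorem for the first coordinate.  The measurability of the inner
    integral is part of the conclusion since it is needed for bounding it. *)
Lemma slice_intS n b P0 P1 W s : 1 <= b -> regular b P0 P1 W n.+2 ->
  measurable_fun setT (fun u => if 0 <= u <= 1 then slice_int n (fun v => W (u :: v)) (s - u) else 0%E) /\
  slice_int (n.+1) W s =
  (\int[mu]_(u in `[0%R, 1%R]) slice_int n (fun v => W (u :: v)) (s - u))%E.
Proof.
move=> b1 rW; have [_ _ mW] := rW.
have mF : measurable_fun setT (fun p : RR * n.-tuple RR => (slice_fun W s (tcons p))%:E).
  apply/measurable_EFinP.
  exact: (measurableT_comp (measurable_slice_fun s mW) (@measurable_tcons R n)).
have F0 (p : RR * n.-tuple RR) : (0 <= (slice_fun W s (tcons p))%:E)%E.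
  by rewrite lee_fin; exact: slice_fun_ge0 b1 rW.
have FE u : (\int[lebesgue_tuple R n]_w (slice_fun W s (tcons (u, w)))%:E)%E =
  (if 0 <= u <= 1 then slice_int n (fun v => W (u :: v)) (s - u) else 0%E).
  under eq_integral do rewrite slice_fun_cons.
  by case: ifP => // _; rewrite integral0.
split.
  rewrite (_ : (fun u => _) = fubini_F (lebesgue_tuple R n) (fun p : RR * n.-tuple RR => (slice_fun W s (tcons p))%:E)).
    exact: measurable_fun_fubini_tonelli_F.
  by apply/funext => u; rewrite -FE.
rewrite /slice_int [LHS]/=.
rewrite (ge0_integral_pushforward (@measurable_tcons R n)) //; last 2 first.
- by apply/measurable_EFinP; exact: measurable_slice_fun.
- by move=> y _; rewrite lee_fin; exact: slice_fun_ge0 b1 rW.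
rewrite preimage_setT.
rewrite fubini_tonelli1 // [RHS]integral_mkcond.
apply: eq_integral => u _; rewrite patchE /= mem_setE in_itv /=.
exact: FE.
Qed.

End Slice.

(** * Riemann sums over a slice *)
Section Riemann.
Local Open Scope classical_set_scope.
Local Open Scope ring_scope.
Variable R : realType.
Notation RR := (measurableTypeR R).
Notation mu := (@lebesgue_measure R).
Variables (N M : nat) (h : R).
Hypotheses (N1 : (1 <= N)%N) (h0 : 0 <= h) (Mh : M%:R = N%:R + 2 * h + 1).
Let b := 1 + h / N%:R.

Definition lat_pt (i : nat) : R := (i%:R - h) / N%:R.

Fixpoint lat n : seq (seq R) :=
  if n is n'.+1 then [seq a :: w | a <- [seq lat_pt i | i <- iota 0 M], w <- lat n'] else [:: [::]].

(** The tolerance [e] applies to the last coordinate only: it is h / N for the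
    lattice of the theorem, and 0 after the first step of the induction in
    [riemann_slice]. *)
Definition slice_sum n (W : seq R -> R) s e : R :=
  \sum_(w <- lat n) if - e <= s - \sum_(x <- w) x <= 1 + e
    then W (rcons w (s - \sum_(x <- w) x)) else 0.

Lemma size_lat n : size (lat n) = (M ^ n)%N.
Proof. by elim: n => //= n IH; rewrite size_allpairs size_map size_iota IH expnS. Qed.

Let N0 : 0 < N%:R :> R. Proof. by rewrite ltr0n. Qed.
Let hN0 : 0 <= h / N%:R. Proof. by rewrite divr_ge0 // ltW. Qed.

Lemma lat_pt_box i : (i < M)%N -> 1 - b <= lat_pt i <= b.
Proof.
move=> iM; rewrite /lat_pt /b; apply/andP; split.
  by rewrite opprD addrA subrr sub0r mulrBl lerDr divr_ge0 // ltW.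
have : i%:R + 1 <= M%:R :> R by rewrite natr1 ler_nat.
rewrite Mh => im; rewrite -subr_ge0.
have -> : 1 + h / N%:R - (i%:R - h) / N%:R = (N%:R + 2 * h - i%:R) / N%:R.
  by field; rewrite lt0r_neq0.
by apply: divr_ge0; [lra|rewrite ltW].
Qed.

Lemma lat_box n w : w \in lat n -> size w = n /\ all (fun x => 1 - b <= x <= b) w.
Proof.
elim: n w => [|n IH] w /=; first by rewrite inE => /eqP ->.
move=> /allpairsP[[a v] /= [aM /IH[sv bv] ->]].
have [j] := mapP aM; rewrite mem_iota => jM ->.
by rewrite /= sv bv lat_pt_box.
Qed.

Lemma lat_sum_bound n (F : seq R -> R) B : (forall w, w \in lat n -> `|F w| <= B) ->
  `|\sum_(w <- lat n) F w| <= (M ^ n)%:R * B.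
Proof.
move=> FB; apply: le_trans (ler_norm_sum _ _ _) _.
apply: (@le_trans _ _ (\sum_(w <- lat n) B)).
  by rewrite big_seq [leRHS]big_seq; apply: ler_sum => w /FB.
by rewrite big_const_seq count_predT size_lat iter_addr_0 mulr_natl.
Qed.

Lemma l1_rcons (w : seq R) a a' : l1 (rcons w a) (rcons w a') = `|a - a'|.
Proof.
rewrite /l1; elim: w => [|x w IH] /=; first by rewrite big_seq1.
by rewrite big_cons /= IH subrr normr0 add0r.
Qed.

Lemma slice_sumS n W s e : slice_sum n.+1 W s e =
  \sum_(w <- lat n) \sum_(i < M)
    if - e <= (s - \sum_(x <- w) x) - lat_pt i <= 1 + e
    then W (lat_pt i :: rcons w ((s - \sum_(x <- w) x) - lat_pt i)) else 0.
Proof.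
rewrite /slice_sum /= big_allpairs_dep exchange_big /=; apply: eq_bigr => w _.
rewrite big_map (_ : iota 0 M = index_iota 0 M) ?big_mkord; last by rewrite /index_iota subn0.
apply: eq_bigr => i _.
by rewrite big_cons opprD addrA [s - _ - _]addrAC.
Qed.

Lemma Rintegral_seq_sum (J : eqType) (r : seq J) (F : J -> R -> R) D : measurable D ->
  (forall j, j \in r -> mu.-integrable D (EFin \o F j)) ->
  mu.-integrable D (EFin \o (fun x => \sum_(j <- r) F j x)) /\
  (\int[mu]_(x in D) (\sum_(j <- r) F j x) = \sum_(j <- r) \int[mu]_(x in D) F j x)%R.
Proof.
move=> mD; elim: r => [|j r IH] iF.
  rewrite big_nil (_ : (fun x : R => _) = cst 0); last by apply/funext => x; rewrite big_nil.
  by rewrite Rintegral_cst // mul0r; split => //; exact: integrable0.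
have [|i1 i2] := IH; first by move=> a ar; apply: iF; rewrite inE ar orbT.
have ij : mu.-integrable D (EFin \o F j) by apply: iF; rewrite inE eqxx.
rewrite big_cons (_ : (fun x : R => _) = (fun x => F j x + \sum_(i <- r) F i x)); last first.
  by apply/funext => x; rewrite big_cons.
rewrite RintegralD // i2; split => //.
by rewrite (_ : _ \o _ = (EFin \o F j) \+ (EFin \o (fun x => \sum_(i <- r) F i x)%R))%E //; exact: integrableD.
Qed.

Variables (P0 P1 : R).
Hypotheses (P00 : 0 <= P0) (P10 : 0 <= P1).
Let C1 := (2 * P1) * (2 * h + 2) + P0 * 8 * (h + 1).

(** [C1] is the constant of [riemann_dim1] for a one-dimensional slice, and
    2h + 2 bounds the number M of lattice points per coordinate divided by N. *)
Fixpoint riemann_cst n : R := if n is n'.+1 then riemann_cst n' + (2 * h + 2) ^+ n' * C1 else 0.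

Let I01 : set R := `[0%R, 1%R]%classic.
Let mI : measurable I01. Proof. exact: measurable_itv. Qed.

Let muI : mu I01 = 1%E.
Proof.
apply: (etrans (lebesgue_measure_itv _)).
by rewrite /= lte_fin ltr01 -EFinB subr0.
Qed.

Let icst B : mu.-integrable I01 (EFin \o cst B).
Proof.
apply/integrableP; split; first by apply/measurable_EFinP; exact: measurable_cst.
by rewrite /= integral_cst // [X in (_ * X)%E]muI mule1 ltry.
Qed.

Lemma integrable01 (f : R -> R) B : measurable_fun I01 f ->
  (forall x, I01 x -> `|f x| <= B) -> mu.-integrable I01 (EFin \o f).
Proof.
move=> mf fB; apply: (@le_integrable _ _ _ mu _ mI (EFin \o f) (EFin \o cst B)) => //.
- exact/measurable_EFinP.
- by move=> x xI; rewrite /= lee_fin; apply: le_trans (fB x xI) _; exact: ler_norm.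
Qed.

Lemma Rintegral01_bound (f : R -> R) B : mu.-integrable I01 (EFin \o f) ->
  (forall x, I01 x -> `|f x| <= B) -> `|\int[mu]_(x in I01) f x|%R <= B.
Proof.
move=> fi fB; have /le_trans := @le_normr_Rintegral _ _ _ mu _ f mI fi; apply.
apply: (@le_trans _ _ (\int[mu]_(x in I01) B)%R).
  by apply: le_Rintegral => //; [exact: integrable_norm|exact: icst].
by have -> := @Rintegral_cst _ _ _ mu _ mI B; rewrite [X in fine X]muI mulr1.
Qed.

(** Induction on the dimension, freeing the first coordinate u.  For fixed u
    the induction hypothesis compares the sum over the other coordinates with
    the inner integral.  This leaves, for every lattice point w in the other
    coordinates, a Riemann sum in u alone, whose last coordinate s - sum w - u
    moves with u; [riemann_dim1] applies to it, with Lipschitz constant 2 P1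
    because two coordinates vary. *)
Lemma riemann_slice n W s e : 0 <= e <= h / N%:R -> (n = 0%N -> e = 0) ->
  regular b P0 P1 W n.+1 ->
  exists2 r, slice_int n W s = r%:E &
    `|(N%:R ^+ n)^-1 * slice_sum n W s e - r| <= riemann_cst n / N%:R.
Proof.
have b1 : 1 <= b by rewrite /b lerDl.
elim: n W s e => [|n IH] W s e /andP[e0 eh] en rW.
  rewrite slice_int0; eexists; first by [].
  rewrite en // /slice_sum /= big_seq1 big_nil subr0 oppr0 addr0 expr0 invr1 mul1r subrr normr0.
  by rewrite mul0r.
have [mG GE] := slice_intS s b1 rW.
have [WP WL mW] := rW.
pose r u := fine (slice_int n (fun v => W (u :: v)) (s - u)).
pose d u := (N%:R ^+ n)^-1 * slice_sum n (fun v => W (u :: v)) (s - u) 0.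
have I01P u : I01 u -> 1 - b <= u <= b.
  by rewrite /I01 /= in_itv /= => ?; lra.
have rd u : I01 u -> slice_int n (fun v => W (u :: v)) (s - u) = (r u)%:E /\
    `|d u - r u| <= riemann_cst n / N%:R.
  move=> uI; have [|//|r' r1 r2] := IH _ (s - u) 0 _ _ (regular_cons (I01P u uI) rW).
    by rewrite lexx.
  by rewrite /r r1 /=.
pose sw (w : seq R) := s - \sum_(x <- w) x.
pose p w v := W (v :: rcons w (sw w - v)).
pose g w v := if 0 <= sw w - v <= 1 then p w v else 0.
have dE u : d u = (N%:R ^+ n)^-1 * \sum_(w <- lat n) g w u.
  rewrite /d /slice_sum; congr (_ * _); apply: eq_bigr => w _.
  by rewrite oppr0 addr0 [s - u - _]addrAC.
have mp w : size w = n -> measurable_fun setT (p w).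
  move=> sw_; pose tw : n.-tuple RR := Tuple (introT eqP sw_).
  have mc := @measurable_cons _ _ _ _ id n (fun _ : RR => tw) (@measurable_id _ _ _) (measurable_cst _).
  rewrite (_ : p w = (W \o (@slice_tuple R n.+1 s)) \o (fun u : RR => [tuple of u :: tw])).
    by apply: (measurableT_comp _ mc); exact: (measurableT_comp mW (measurable_slice_tuple s)).
  apply/funext => u; rewrite /p /= big_cons /sw; congr (W (_ :: rcons _ _)).
  by rewrite opprD addrA addrAC.
have mg w : size w = n -> measurable_fun setT (g w).
  move=> /mp mpw; rewrite (_ : g w = (fun x => \1_(`[sw w - 1, sw w]) x * p w x)).
    by apply: measurable_funM => //; exact: measurable_indic.
  apply/funext => x; rewrite indicE !mem_setE !in_itv /= /g.
  have -> : (sw w - 1 <= x <= sw w) = (0 <= sw w - x <= 1) by apply/idP/idP; lra.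
  by case: ifP; rewrite ?mul1r ?mul0r.
have gB w u : w \in lat n -> I01 u -> 0 <= g w u <= P0.
  move=> /lat_box[sw_ bw] uI; rewrite /g; case: ifP => [h1|_]; last by rewrite lexx.
  apply: WP; first by rewrite /= size_rcons sw_.
  by rewrite /= all_rcons bw (I01P u uI) andbT /=; lra.
have ig w : w \in lat n -> mu.-integrable I01 (EFin \o g w).
  move=> wl; apply: (@integrable01 _ P0); first by apply: measurable_funTS; apply: mg; have [] := lat_box wl.
  by move=> x xI; rewrite ger0_norm; have := gB w x wl xI => /andP[].
have [is_ Is] := Rintegral_seq_sum mI ig.
have id_ : mu.-integrable I01 (EFin \o d).
  rewrite (_ : _ \o _ = (fun u => ((N%:R ^+ n)^-1)%:E * (EFin \o (fun u => \sum_(w <- lat n) g w u)%R) u)%E).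
    exact: integrableZl.
  by apply/funext => u; rewrite /= dE.
have K0 : 0 <= riemann_cst n / N%:R.
  have := rd 0; rewrite /I01 /= in_itv /= lexx ler01 => /(_ isT)[_].
  exact: le_trans.
have ir : mu.-integrable I01 (EFin \o r).
  apply: (@integrable01 _ (((N%:R ^+ n)^-1 * ((M ^ n)%:R * P0)) + riemann_cst n / N%:R)).
    pose G u := if 0 <= u <= 1 then slice_int n (fun v => W (u :: v)) (s - u) else 0%E.
    apply: (@eq_measurable_fun _ _ _ _ _ (fine \o G)).
      by move=> x; rewrite mem_setE in_itv /= /G /r /= => ->.
    by apply: measurable_funTS; apply: measurableT_comp.
  move=> u uI; have [_ dr] := rd u uI.
  rewrite -[r u](subrK (d u)); apply: le_trans (ler_normD _ _) _.
  rewrite addrC distrC lerD // dE normrM ger0_norm ?invr_ge0 ?exprn_ge0 ?ler0n //.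
  rewrite ler_wpM2l ?invr_ge0 ?exprn_ge0 ?ler0n //.
  by apply: lat_sum_bound => w wl; rewrite ger0_norm; have /andP[] := gB w u wl uI.
exists (\int[mu]_(u in I01) r u)%R.
  rewrite GE /Rintegral fineK; last exact: integrable_fin_num.
  by apply: eq_integral => u /set_mem uI; have [-> _] := rd u uI.
have -> : (\int[mu]_(u in I01) r u = \int[mu]_(u in I01) d u + \int[mu]_(u in I01) (r u - d u))%R.
  by rewrite RintegralB // addrC subrK.
have Irda : `|\int[mu]_(u in I01) (r u - d u)|%R <= riemann_cst n / N%:R.
  have ird : mu.-integrable I01 (EFin \o (fun u => r u - d u)).
    by rewrite (_ : _ \o _ = (EFin \o r) \- (EFin \o d))%E //; exact: integrableB.
  by apply: Rintegral01_bound => // u /rd[_]; rewrite distrC.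
have Ida : `|(N%:R ^+ n.+1)^-1 * slice_sum n.+1 W s e - \int[mu]_(u in I01) d u|%R
   <= (2 * h + 2) ^+ n * C1 / N%:R.
  have -> : (\int[mu]_(u in I01) d u = (N%:R ^+ n)^-1 * \sum_(w <- lat n) \int[mu]_(u in I01) g w u)%R.
    by under eq_Rintegral do rewrite dE; rewrite RintegralZl // Is.
  rewrite slice_sumS exprSr invfM -[X in `|X - _|]mulrA -mulrBr mulr_sumr -sumrB.
  rewrite normrM ger0_norm ?invr_ge0 ?exprn_ge0 ?ler0n //.
  apply: (@le_trans _ _ ((N%:R ^+ n)^-1 * ((M ^ n)%:R * (C1 / N%:R)))).
    rewrite ler_wpM2l ?invr_ge0 ?exprn_ge0 ?ler0n //.
    apply: lat_sum_bound => w /lat_box[sw_ bw].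
    have bxW v : 1 - b <= v <= b -> 1 - b <= sw w - v <= b ->
        size (v :: rcons w (sw w - v)) = n.+2 /\
        all (fun x => 1 - b <= x <= b) (v :: rcons w (sw w - v)).
      by move=> v1 v2; rewrite /= size_rcons sw_ all_rcons bw v1 v2.
    have bb : b = 1 + h / N%:R by [].
    apply: (riemann_dim1 N1 h0 Mh e0 eh (mp w sw_)) => //.
    - move=> v v1 v2; have [||w1 w2] := bxW v; [rewrite bb /sw; lra|rewrite bb /sw; lra|exact: WP].
    - move=> v v' v1 v2 v3 v4.
      have [||w1 w2] := bxW v; [rewrite bb /sw; lra|rewrite bb /sw; lra|]; have [||w3 w4] := bxW v'; [rewrite bb /sw; lra|rewrite bb /sw; lra|].
      apply: le_trans (WL _ _ w1 w3 w2 w4) _.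
      rewrite /l1 /= big_cons -/(l1 _ _) l1_rcons /=.
      have -> : sw w - v - (sw w - v') = - (v - v') by ring.
      by rewrite normrN; lra.
    - by rewrite mulr_ge0.
  have MN : M%:R / N%:R <= 2 * h + 2 :> R.
    rewrite ler_pdivrMr // Mh.
    have : 1 <= N%:R :> R by rewrite ler1n.
    have : 2 * h * 1 <= 2 * h * N%:R by rewrite ler_wpM2l ?ler1n // mulr_ge0.
    lra.
  have C10 : 0 <= C1 by rewrite /C1 addr_ge0 // !mulr_ge0 // addr_ge0 // mulr_ge0.
  have -> : (N%:R ^+ n)^-1 * ((M ^ n)%:R * (C1 / N%:R)) = (M%:R / N%:R) ^+ n * (C1 / N%:R).
    by rewrite natrX expr_div_n; ring.
  rewrite -mulrA ler_wpM2r ?mulr_ge0 ?invr_ge0 ?ler0n //.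
  by rewrite lerXn2r // nnegrE ?divr_ge0 ?ler0n // addr_ge0 // mulr_ge0.
rewrite [riemann_cst n.+1]/= [in leRHS]addrC mulrDl opprD addrA.
by apply: le_trans (ler_normB _ _) _; rewrite lerD.
Qed.
End Riemann.

(** * The squared Vandermonde weight *)
Section Weight.
Local Open Scope classical_set_scope.
Local Open Scope ring_scope.
Variable R : realType.
Notation RR := (measurableTypeR R).

Definition bounded_lipschitz (D : set (seq R)) (F : seq R -> R) := exists P0 P1,
  [/\ 0 <= P0, 0 <= P1, forall w, D w -> 0 <= F w <= P0 &
      forall w w', D w -> D w' -> `|F w - F w'| <= P1 * l1 w w'].

Lemma l1_ge0 (w w' : seq R) : 0 <= l1 w w'.
Proof. by apply: sumr_ge0 => p _. Qed.

Lemma l1_nth (w w' : seq R) i : size w = size w' -> `|w`_i - w'`_i| <= l1 w w'.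
Proof.
elim: w w' i => [|x w IH] [|x' w'] //= i.
  by rewrite nth_nil subrr normr0 l1_ge0.
move=> [sw]; rewrite /l1 /= big_cons -/(l1 _ _) /=; case: i => [|i] /=.
  by rewrite lerDl l1_ge0.
by apply: le_trans (IH _ i sw) _; rewrite lerDr.
Qed.

Lemma bounded_lipschitz_mul D F G : bounded_lipschitz D F -> bounded_lipschitz D G -> bounded_lipschitz D (fun w => F w * G w).
Proof.
move=> [P0 [P1 [p0 p1 FB FL]]] [Q0 [Q1 [q0 q1 GB GL]]].
exists (P0 * Q0), (P0 * Q1 + P1 * Q0); split.
- exact: mulr_ge0.
- by rewrite addr_ge0 // mulr_ge0.
- move=> w Dw; have /andP[f0 f1] := FB w Dw; have /andP[g0 g1] := GB w Dw.
  by rewrite mulr_ge0 //= ler_pM.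
move=> w w' Dw Dw'.
have -> : F w * G w - F w' * G w' = F w * (G w - G w') + (F w - F w') * G w' by ring.
apply: le_trans (ler_normD _ _) _; rewrite !normrM mulrDl; apply: lerD.
  rewrite -mulrA ler_pM //; last exact: GL.
  by have /andP[f0 f1] := FB w Dw; rewrite ger0_norm.
have -> : P1 * Q0 * l1 w w' = P1 * l1 w w' * Q0 by ring.
apply: ler_pM => //; first exact: FL.
by have /andP[f0 f1] := GB w' Dw'; rewrite ger0_norm.
Qed.

Lemma bounded_lipschitz_prod D (J : Type) (r : seq J) (F : J -> seq R -> R) :
  (forall j, bounded_lipschitz D (F j)) -> bounded_lipschitz D (fun w => \prod_(j <- r) F j w).
Proof.
move=> FB; elim: r => [|j r IH].
  exists 1, 0; split => // w; first by rewrite big_nil ler01 lexx.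
  by move=> w' _ _; rewrite !big_nil subrr normr0 mul0r.
rewrite (_ : (fun w => _) = (fun w => F j w * \prod_(j <- r) F j w)); first exact: bounded_lipschitz_mul.
by apply/funext => w; rewrite big_cons.
Qed.

Definition vdm_weight k (w : seq R) : R :=
  \prod_(i < k) \prod_(j < k | (i < j)%N) (w`_i - w`_j) ^+ 2.

Lemma bounded_lipschitz_weight k b : 1 <= b ->
  bounded_lipschitz [set w | size w = k /\ all (fun x => 1 - b <= x <= b) w] (vdm_weight k).
Proof.
move=> b1; set D := [set w | _].
rewrite (_ : vdm_weight k = fun w => \prod_(i < k) \prod_(j < k) if (i < j)%N then (w`_i - w`_j) ^+ 2 else 1); last first.
  by apply/funext => w; apply: eq_bigr => i _; exact: big_mkcond.
apply: bounded_lipschitz_prod => i; apply: (@bounded_lipschitz_prod _ _ _ (fun (j : 'I_k) (w : seq R) => if (i < j)%N then (w`_i - w`_j) ^+ 2 else 1)) => j; case: (i < j)%N; last first.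
  by exists 1, 0; split => // *; rewrite ?ler01 ?lexx // subrr normr0 mul0r.
have DB w : D w -> `|w`_i - w`_j| <= 2 * b - 1.
  move=> [sw /allP bw].
  have := bw w`_i (mem_nth _ _); rewrite sw ltn_ord => /(_ isT) h1.
  have := bw w`_j (mem_nth _ _); rewrite sw ltn_ord => /(_ isT) h2.
  by rewrite ler_norml; lra.
exists ((2 * b - 1) ^+ 2), (4 * (2 * b - 1)); split.
- by rewrite exprn_ge0; lra.
- by lra.
- move=> w /DB h; rewrite sqr_ge0 /= -real_normK ?num_real //.
  by rewrite lerXn2r // nnegrE ?normr_ge0 //; lra.
move=> w w' Dw Dw'; have [[sw _] [sw' _]] := (Dw, Dw').
have h1 := DB w Dw; have h2 := DB w' Dw'.
have h3 := @l1_nth w w' i (etrans sw (esym sw')); have h4 := @l1_nth w w' j (etrans sw (esym sw')).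
rewrite subr_sqr normrM mulrC.
have -> : 4 * (2 * b - 1) * l1 w w' = (2 * (2 * b - 1)) * (2 * l1 w w') by ring.
apply: ler_pM => //.
  by apply: le_trans (ler_normD _ _) _; lra.
have -> : w`_i - w`_j - (w'`_i - w'`_j) = (w`_i - w'`_i) - (w`_j - w'`_j) by ring.
by apply: le_trans (ler_normB _ _) _; lra.
Qed.

Lemma measurable_weight k : seq_measurable (vdm_weight k) k.
Proof.
rewrite /seq_measurable.
rewrite (_ : (fun t => _) = fun w : k.-tuple RR => \prod_(i < k) \prod_(j < k) if (i < j)%N then (tnth w i - tnth w j) ^+ 2 else 1); last first.
  apply/funext => w; apply: eq_bigr => i _; rewrite [LHS]big_mkcond; apply: eq_bigr => j _.
  by rewrite !(tnth_nth 0).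
apply: measurable_prod => i _; apply: measurable_prod => j _.
case: (i < j)%N; last exact: measurable_cst.
by apply: measurable_funX; apply: measurable_funB; exact: measurable_tnth.
Qed.

(** The constants are chosen for the largest box, so that they serve all boxes
    b' = 1 + (k-1) / (2N) with N >= 1 at once. *)
Lemma regular_weight k b : 1 <= b -> exists P0 P1, [/\ 0 <= P0, 0 <= P1 &
  forall b', b' <= b -> regular b' P0 P1 (vdm_weight k) k].
Proof.
move=> /(bounded_lipschitz_weight k)[P0 [P1 [p0 p1 WB WL]]]; exists P0, P1; split => // b' bb'.
have sub w : all (fun x => 1 - b' <= x <= b') w -> all (fun x => 1 - b <= x <= b) w.
  by apply: sub_all => x; lra.
split.
- by move=> w sw /sub bw; apply: WB.
- by move=> w w' sw sw' /sub bw /sub bw'; apply: WL.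
- exact: measurable_weight.
Qed.

Lemma gamma_slice n (c : R) : gamma n.+1 c =
  ((n.+1`! * barnesG n.+2 ^ 2)%N%:R)^-1 * fine (slice_int n (vdm_weight n.+1) c).
Proof.
rewrite /gamma; congr (_ * _); rewrite Rintegral_mkcond /Rintegral /slice_int.
congr fine; apply: eq_integral => w _ /=.
rewrite patchE /slice_fun /slice_tuple /=; case: ifPn => [/set_mem /= h|h].
  rewrite ifT; first by [].
  apply/(all_nthP 0) => i; rewrite size_rcons size_tuple => ik.
  exact: (h (Ordinal ik)).
rewrite ifF //; apply/negP => /(all_nthP 0) H; move/negP: h; apply; apply/mem_set => /= i.
by apply: H; rewrite size_rcons size_tuple.
Qed.

Lemma vdm_nat k : vdm (fun i : 'I_k => i%:R : R) = (barnesG k.+1)%:R.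
Proof.
rewrite vdmE /barnesG /=.
rewrite (exchange_big_dep xpredT) //=.
rewrite (eq_bigr (fun j : 'I_k => (j`!)%:R)); last first.
  move=> j _.
  rewrite -(big_ord_widen k (fun i => j%:R - (i%:R : R)) (ltnW (ltn_ord j))).
  rewrite fact_prod big_add1 big_mkord natr_prod /= (reindex_inj rev_ord_inj) /=.
  by apply: eq_bigr => i _; rewrite -natrB ?leq_subr // subKn.
rewrite -natr_prod -(big_mkord xpredT (fun j => j`!)); congr (_%:R).
case: k => [|k]; first by rewrite !big_geq.
by rewrite big_ltn // fact0 mul1n.
Qed.

End Weight.

(** * The lattice formula as a Riemann sum *)
Lemma sum_ffun_pivot (A : nmodType) n M (o : 'I_n.+1) (F : {ffun 'I_n.+1 -> 'I_M} -> A) :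
  \sum_l F l = \sum_a \sum_(l : {ffun 'I_n -> 'I_M}) F [ffun i => oapp l a (unlift o i)].
Proof.
rewrite pair_big /= (reindex (fun p : 'I_M * {ffun 'I_n -> 'I_M} => [ffun i => oapp p.2 p.1 (unlift o i)])) //.
exists (fun q : {ffun 'I_n.+1 -> 'I_M} => (q o, [ffun i => q (lift o i)])).
  by move=> [a l] _ /=; rewrite ffunE unlift_none /=; congr pair; apply/ffunP => i; rewrite !ffunE liftK.
by move=> q _; apply/ffunP => i; rewrite ffunE; case: unliftP => [j|] -> /=; rewrite ?ffunE.
Qed.

Lemma gauss_sum n : ((\sum_(i < n.+1) i) * 2 = n * n.+1)%N.
Proof. by elim: n => [|n IH]; rewrite big_ord_recr /= ?big_ord0 // mulnDl IH; lia. Qed.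

Lemma widen_lift_max n (i : 'I_n) : widen_ord (leqnSn n) i = lift ord_max i.
Proof. by apply: val_inj; rewrite -[RHS]/(nat_of_ord (lift ord_max i)) lift_max. Qed.

Section Lattice.
Variables (R : realType) (N n : nat).
Hypothesis N1 : (1 <= N)%N.
Let M := (N + n.+1)%N.
Let h : R := n%:R / 2.
Let pt := lat_pt N h.

Definition lat_seq r (l : {ffun 'I_r -> 'I_M}) : seq R := [seq pt (l i) | i <- enum 'I_r].

Lemma sum_lat r (G : seq R -> R) :
  \sum_(w <- lat N M h r) G w = \sum_(l : {ffun 'I_r -> 'I_M}) G (lat_seq l).
Proof.
elim: r G => [|r IH] G.
  rewrite /= big_seq1 (eq_bigr (fun _ => G [::])); last first.
    by move=> l _; rewrite /lat_seq (size0nil (size_enum_ord 0)).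
  by rewrite sumr_const card_ffun !card_ord expn0 mulr1n.
rewrite /= big_allpairs_dep big_map (sum_ffun_pivot ord0).
rewrite (_ : iota 0 M = index_iota 0 M) ?big_mkord; last by rewrite /index_iota subn0.
apply: eq_bigr => a _; rewrite IH; apply: eq_bigr => l _; congr (G _).
rewrite /lat_seq enum_ordSl /= ffunE unlift_none /=; congr (_ :: _).
by rewrite -map_comp; apply: eq_map => i /=; rewrite ffunE liftK.
Qed.

Let N0 : N%:R != 0 :> R. Proof. by rewrite pnatr_eq0 -lt0n. Qed.

Lemma sum_lat_seq r (l : {ffun 'I_r -> 'I_M}) :
  \sum_(x <- lat_seq l) x = ((\sum_i l i)%N%:R - r%:R * h) / N%:R.
Proof.
rewrite big_map big_enum /= -mulr_suml; congr (_ / _).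
by rewrite sumrB sumr_const card_ord natr_sum mulr_natl.
Qed.

Lemma lat_seq_rcons (l : {ffun 'I_n -> 'I_M}) (q : 'I_M) :
  lat_seq [ffun i => oapp l q (unlift ord_max i)] = rcons (lat_seq l) (pt q).
Proof.
rewrite /lat_seq enum_ordSr map_rcons ffunE unlift_none /=; congr rcons.
rewrite -map_comp; apply: eq_map => i /=; rewrite ffunE.
by rewrite widen_lift_max liftK.
Qed.

(** The centring h = n/2 is the mean of 0, ..., n, so the shift of the
    coordinates absorbs exactly the excess 0 + ... + n of the sum of [l].  The
    relaxed cut-off on the last coordinate says that it is one of the [M]
    lattice points. *)
Lemma slice_sum_lattice (m : nat) (W : seq R -> R) :
  slice_sum N M h n W (m%:R / N%:R) (h / N%:R) =
  \sum_(l : {ffun 'I_n.+1 -> 'I_M} | (\sum_i l i == m + \sum_(i < n.+1) i)%N) W (lat_seq l).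
Proof.
rewrite /slice_sum sum_lat [RHS]big_mkcond [RHS](sum_ffun_pivot ord_max) exchange_big /=.
apply: eq_bigr => l _.
set T := (m + \sum_(i < n.+1) i)%N; set S := (\sum_i l i)%N.
have TE : T%:R = m%:R + n.+1%:R * h :> R.
  have := congr1 (fun x => x%:R : R) (gauss_sum n); rewrite /= !natrM /T natrD => e.
  have -> : n.+1%:R * h = n%:R * n.+1%:R / 2 by rewrite /h; field.
  by rewrite -e; lra.
have sE : m%:R / N%:R - \sum_(x <- lat_seq l) x = (T%:R - S%:R - h) / N%:R.
  rewrite sum_lat_seq TE -natr1 -/S; field; exact: N0.
have SE (q : 'I_M) : (\sum_(i < n.+1) [ffun i => oapp l q (unlift ord_max i)] i)%N = (S + q)%N.
  rewrite big_ord_recr /= ffunE unlift_none /=; congr (_ + _)%N.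
  by apply: eq_bigr => i _; rewrite ffunE widen_lift_max liftK.
have cE : (- (h / N%:R) <= (T%:R - S%:R - h) / N%:R <= 1 + h / N%:R) = (S <= T <= S + (N + n))%N.
  have -> : 1 + h / N%:R = (N%:R + h) / N%:R by field; exact: N0.
  rewrite -mulNr !ler_pM2r ?invr_gt0 ?ltr0n //.
  rewrite -!(ler_nat R) !natrD /h; apply/idP/idP; lra.
under [RHS]eq_bigr do rewrite SE.
rewrite sE cE; case: ifPn => [/andP[ST TS]|cF].
  have TM : (T - S < M)%N by rewrite /M; lia.
  rewrite (bigD1 (Ordinal TM)) //= subnKC // eqxx lat_seq_rcons /pt /lat_pt natrB //.
  rewrite big1 ?addr0 // => q qT; case: eqP => // e; case/eqP: qT; apply: val_inj => /=.
  by rewrite -e addKn.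
rewrite big1 // => q _; case: eqP => // e; case/negP: cF.
by have := ltn_ord q; rewrite -e /M; lia.
Qed.

Lemma vdm_weight_lat (l : {ffun 'I_n.+1 -> 'I_M}) :
  vdm (fun i => (l i)%:R : R) ^+ 2 = N%:R ^+ (n * n.+1) * vdm_weight n.+1 (lat_seq l).
Proof.
rewrite vdmE /vdm_weight -prodrXl.
have lE (i : 'I_n.+1) : (lat_seq l)`_i = pt (l i).
  by rewrite (nth_map i) ?size_enum_ord ?ltn_ord // nth_ord_enum.
have -> : N%:R ^+ (n * n.+1) = \prod_(i < n.+1) \prod_(j < n.+1 | (i < j)%N) N%:R ^+ 2 :> R.
  rewrite (exchange_big_dep xpredT) //= -gauss_sum mulnC exprM expr_sum.
  apply: eq_bigr => j _.
  rewrite -(big_ord_widen n.+1 (fun i => N%:R ^+ 2) (ltnW (ltn_ord j))).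
  by rewrite prodr_const card_ord.
rewrite -big_split; apply: eq_bigr => i _ /=; rewrite -prodrXl -big_split /=.
by apply: eq_bigr => j _; rewrite !lE /pt /lat_pt; field; exact: N0.
Qed.
End Lattice.

Theorem theorem1p5 (R : realType) (k : nat) (hk : (1 <= k)%N) :
  exists K : R, forall (N : nat) (m : int)
    (mu : probability (unitary_group R N) R),
    (1 <= N)%N -> is_haar mu ->
    let c : R := m%:~R / N%:R in
    0 <= c <= k%:R ->
    `| secular_moment k m mu - gamma k c * N%:R ^+ (k ^ 2 - 1) |
      <= K * N%:R ^ ((k ^ 2)%N%:Z - 2).
Proof.
case: k hk => // n _; pose h : R := n%:R / 2.
have h0 : 0 <= h by rewrite divr_ge0.
have b1 : 1 <= 1 + h by rewrite lerDl.
have [P0 [P1 [P00 P10 rW]]] := @regular_weight R n.+1 _ b1.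
pose A : R := (n.+1`! * barnesG n.+2 ^ 2)%N%:R^-1.
have A0 : 0 <= A by rewrite invr_ge0 ler0n.
exists (A * riemann_cst h P0 P1 n) => N [] m mu N1 haar /= /andP[c0 _]; last first.
  by move: c0; rewrite NegzE mulrNz mulNr oppr_ge0 leNgt divr_gt0 ?ltr0n ?ltr0z.
have NR : 0 < N%:R :> R by rewrite ltr0n.
have -> : m%:~R = m%:R :> R by [].
have hN : h / N%:R <= h.
  by rewrite ler_pdivrMr // ler_peMr // ler1n.
have Mh : (N + n.+1)%:R = N%:R + 2 * h + 1 :> R.
  by rewrite natrD -natr1 /h; field.
have eh : 0 <= h / N%:R <= h / N%:R by rewrite lexx divr_ge0 ?ler0n.
have e0 : n = 0%N -> h / N%:R = 0 by rewrite /h => ->; rewrite !mul0r.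
have bN : 1 + h / N%:R <= 1 + h by rewrite lerD2l.
have [r r1 r2] := riemann_slice N1 h0 Mh P00 P10 (m%:R / N%:R) eh e0 (rW _ bN).
have Nn : (1 < N + n.+1)%N by rewrite addnS ltnS (leq_trans N1) // leq_addr.
rewrite (secular_moment_lattice haar m Nn) gamma_slice r1 /= vdm_nat -natrX -natrM -/A.
under eq_bigr do rewrite vdm_weight_lat //.
rewrite -mulr_sumr -slice_sum_lattice //.
have Nk : N%:R ^+ (n.+1 ^ 2 - 1) = N%:R ^+ (n * n.+1) * N%:R ^+ n :> R.
  by rewrite -exprD; congr (_ ^+ _); rewrite -mulnn; lia.
set S := slice_sum _ _ _ _ _ _ _ in r2 *.
have -> : A * (N%:R ^+ (n * n.+1) * S) - A * r * N%:R ^+ (n.+1 ^ 2 - 1) =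
   A * N%:R ^+ (n.+1 ^ 2 - 1) * (N%:R ^- n * S - r).
  by rewrite Nk; field; rewrite expf_neq0 // lt0r_neq0.
rewrite normrM ger0_norm; last by rewrite mulr_ge0 // exprn_ge0 // ltW.
apply: le_trans (ler_wpM2l _ r2) _; first by rewrite mulr_ge0 // exprn_ge0 // ltW.
have -> : N%:R ^ ((n.+1 ^ 2)%N%:Z - 2) = N%:R ^+ (n.+1 ^ 2 - 1) / N%:R :> R.
  have -> : (n.+1 ^ 2)%N%:Z - 2 = (n.+1 ^ 2 - 1)%N%:Z - 1 by rewrite -subzn ?expn_gt0 //; ring.
  by rewrite expfzDr ?lt0r_neq0.
by rewrite le_eqVlt; apply/orP; left; apply/eqP; ring.
Qed.
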